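(* Let $N=1$, $0<s<1/2$, $r>4-2s$, $\lambda=3-2s$ and $\delta=\frac{r-1}{\lambda}-1>0$. Let $\rho$ be a smooth solution of $$\rho_t=\partial_x\Big[\rho\big(\partial_x(-\Delta)^{-s}\rho+x\big)\Big]-e^{-\lambda\delta t}\rho^r$$ with non-negative initial data $\rho(\cdot,0)=u_0\in L^1(\mathbb{R})\cap L^\infty(\mathbb{R})$. Let $M(t)=\int\rho(x,t)\,\mathrm{d}x$ and let $\rho_{M(t)}$ be the Barenblatt profile with the same mass $M(t)$ as $\rho(t)$. Then the relative entropy $H[\rho(t)|\rho_{M(t)}]:=H[\rho(t)]-H[\rho_{M(t)}]$ decays to zero exponentially fast; that is, there is a constant $C$ depending on the mass $M_0:=\|u_0\|_1$, the sup norm $\|u_0\|_\infty$, the exponents $r$, $s$ and on $H[u_0|\rho_{M_0}]$, such that for all $t>0$ $$H[\rho(t)|\rho_{M(t)}]\le C(1+t)^2\exp\big(-2\min(1,\lambda\delta)\,t\big).$$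
   Context: $\|\cdot\|_p$ is the norm of $L^p(\mathbb{R})$. For $0<s<1/2$, $(-\Delta)^{-s}$ is the Riesz potential on $\mathbb{R}$, i.e. the Fourier multiplier $|\xi|^{-2s}$, equivalently $(-\Delta)^{-s}f(y)=C_{1,s}\int_{\mathbb{R}}|y-z|^{2s-1}f(z)\,\mathrm{d}z$ with $C_{1,s}=\pi^{-1/2}2^{-2s}\Gamma(1/2-s)/\Gamma(s)$. Entropy: $H[\rho]=\int\frac12\rho(-\Delta)^{-s}\rho+\frac12|x|^2\rho$. Entropy dissipation rate: $I[\rho]=\int\rho\,|\partial_x(-\Delta)^{-s}\rho+x|^2$. Barenblatt profile of mass $M>0$: $\rho_M(x)=\frac{2^{2s-1}\Gamma(3/2)}{\Gamma(2-s)\Gamma(3/2-s)}(R^2-x^2)_+^{1-s}$, where $R>0$ is determined by $M=\int\rho_M\,\mathrm{d}x=\frac{2^{2s}\pi^{1/2}\Gamma(3/2)}{(3-2s)\Gamma(3/2-s)^2}R^{3-2s}$. The equation for $\rho$ is the transform of $u_\tau-\partial_y(u\,\partial_y(-\Delta)^{-s}u)=-u^r$, $u(\cdot,0)=u_0$, under $x=y(1+\lambda\tau)^{-1/\lambda}$, $t=\frac1\lambda\log(1+\lambda\tau)$, $\rho(x,t)=(1+\lambda\tau)^{1/\lambda}u(y,\tau)$, and solutions $\rho$ are non-negative and obtained in this way (weak solutions $u$ being limits as $\epsilon\to0^+$, weak* as non-negative measures, of solutions of the equation with $\epsilon\,\partial_{yy}u$ added to the right-hand side). ''Smooth solution'' means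 that $\rho$ is smooth and decays to zero fast enough as $|x|\to\infty$ that $H[\rho(t)]$ is finite and the identity $\frac{d}{dt}H[\rho(t)]=-I[\rho(t)]-e^{-\lambda\delta t}\int\rho^r\big[(-\Delta)^{-s}\rho+\frac{x^2}{2}\big]\mathrm{d}x$ holds. *)

(* Defs.v *)
From HB Require Import structures.
From mathcomp Require Import all_boot all_order all_algebra.
From mathcomp Require Import all_classical all_reals all_analysis.

Set Implicit Arguments.
Unset Strict Implicit.
Unset Printing Implicit Defensive.

Import Order.TTheory GRing.Theory Num.Theory.
Import numFieldNormedType.Exports.

Local Open Scope classical_set_scope.
Local Open Scope ring_scope.

Section Exponents.
Context {R : realType}.
Implicit Types s r : R.

Definition lambda s : R := 3 - 2 * s.

Definition delta s r : R := (r - 1) / lambda s - 1.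

End Exponents.

Section OneVariable.
Context {R : realType}.
Local Notation mu := (@lebesgue_measure R).
Implicit Types (s r a M t x : R) (f : R -> R).

Definition Gamma a : R := \int[mu]_(x in `]0, +oo[) (x `^ (a - 1) * expR (- x)).

Definition in_L1 f : Prop := (f : measurableTypeR R -> R) \in Lfun mu 1%E.

Definition in_Linfty f : Prop := (f : measurableTypeR R -> R) \in Lfun mu +oo%E.

Definition norm1 f : R := fine 'N[mu]_1%E[EFin \o f]%E.

Definition norm_infty f : R := fine 'N[mu]_(+oo)%E[EFin \o f]%E.

Definition riesz_const s : R :=
  pi `^ (- (1 / 2)) * 2 `^ (- (2 * s)) * Gamma (1 / 2 - s) / Gamma s.

(* (-Delta)^{-s} f. The value 0 that powR gives to the kernel at z = y is
   harmless: {y} is a null set. *)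
Definition riesz s f (y : R) : R :=
  riesz_const s * \int[mu]_z (`|y - z| `^ (2 * s - 1) * f z).

Definition mass f : R := \int[mu]_x f x.

Definition entropy_density s f x : R :=
  1 / 2 * (f x * riesz s f x) + 1 / 2 * (x ^+ 2 * f x).

Definition entropy s f : R := \int[mu]_x entropy_density s f x.

Definition dissipation_density s f x : R :=
  f x * (derive1 (riesz s f) x + x) ^+ 2.

Definition dissipation s f : R := \int[mu]_x dissipation_density s f x.

Definition absorption_density s r f x : R :=
  f x `^ r * (riesz s f x + x ^+ 2 / 2).

Definition absorption s r f : R := \int[mu]_x absorption_density s r f x.

(* Since powR is only meaningful on nonnegative reals, the positive part is
   taken explicitly; 1 - s > 0, so the profile vanishes for |x| >= rad. *)
Definition barenblatt_profile s (rad x : R) : R :=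
  2 `^ (2 * s - 1) * Gamma (3 / 2) / (Gamma (2 - s) * Gamma (3 / 2 - s))
  * Num.max 0 (rad ^+ 2 - x ^+ 2) `^ (1 - s).

Definition barenblatt_mass_const s : R :=
  2 `^ (2 * s) * pi `^ (1 / 2) * Gamma (3 / 2)
  / ((3 - 2 * s) * Gamma (3 / 2 - s) ^+ 2).

(* The solution rad of M = barenblatt_mass_const s * rad^(3 - 2 s);
   it is 0, and the profile is the zero function, when M = 0. *)
Definition barenblatt_radius s M : R :=
  (M / barenblatt_mass_const s) `^ (3 - 2 * s)^-1.

Definition barenblatt s M : R -> R :=
  barenblatt_profile s (barenblatt_radius s M).

Definition relative_entropy s f : R :=
  entropy s f - entropy s (barenblatt s (mass f)).

End OneVariable.

Section TwoVariables.
Context {R : realType}.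
Local Notation mu := (@lebesgue_measure R).
Local Notation mu2 := (@lebesgue_measure R \x @lebesgue_measure R)%E.
Implicit Types (s r eps t x : R) (f u rho : R -> R -> R).

(* Functions of (space, time) are curried, space first. *)

Definition d_space f : R -> R -> R := fun x t => derive1 (f ^~ t) x.

Definition d_time f : R -> R -> R := fun x t => derive1 (f x) t.

Definition half_space : set (R * R) := [set z | 0 < z.2].

Fixpoint partial (w : seq bool) f : R -> R -> R :=
  if w is b :: w' then
    if b then d_time (partial w' f) else d_space (partial w' f)
  else f.

(* C^infinity on the open set D: the partial derivatives of all orders, in any
   order of differentiation, exist and are continuous on D. *)
Definition smooth_on (D : set (R * R)) f : Prop :=
  forall (w : seq bool) (z : R * R), D z ->
    [/\ {for z, continuous (fun z' : R * R => partial w f z'.1 z'.2)},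
        derivable ((partial w f) ^~ z.2) z.1 1 &
        derivable (partial w f z.1) z.2 1].

(* Test functions on R x [0, +oo[, as restrictions of functions in
   C_c^infinity(R^2). *)
Definition test_function (phi : R -> R -> R) : Prop :=
  smooth_on setT phi /\
  exists K : R, forall x t, K <= `|x| \/ K <= `|t| -> phi x t = 0.

(* Integrability up to the initial time, locally in space. *)
Definition locally_integrable2 f : Prop :=
  forall K : R,
    mu2.-integrable (`[- K, K] `*` `]0, K])
      (fun z : measurableTypeR R * measurableTypeR R => (f z.1 z.2)%:E).

(* Nonnegative weak solutions of
     u_tau = (u ((-Delta)^{-s} u)_y)_y - u^r + eps u_yy,   u(., 0) = u0. *)
Definition weak_solution s r eps (u0 : R -> R) u : Prop :=
  [/\ forall y tau, 0 < tau -> 0 <= u y tau,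
      forall tau, 0 < tau ->
        [/\ in_L1 (u ^~ tau), in_Linfty (u ^~ tau) &
            forall y, derivable (riesz s (u ^~ tau)) y 1],
      [/\ locally_integrable2 u,
          locally_integrable2
            (fun y tau => u y tau * derive1 (riesz s (u ^~ tau)) y) &
          locally_integrable2 (fun y tau => u y tau `^ r)] &
      forall phi, test_function phi ->
        \int[mu2]_(z in setT `*` `]0, +oo[)
          (u z.1 z.2 * d_time phi z.1 z.2
           - u z.1 z.2 * derive1 (riesz s (u ^~ z.2)) z.1 * d_space phi z.1 z.2
           - u z.1 z.2 `^ r * phi z.1 z.2
           + eps * (u z.1 z.2 * d_space (d_space phi) z.1 z.2))
        + \int[mu]_y (u0 y * phi y 0) = 0].

(* Weak-* convergence of the measures v_n dy dtau to u dy dtau, as measures on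
   R x ]0, +oo[: test functions are continuous with compact support there. *)
Definition weak_star_cvg (v : nat -> R -> R -> R) u : Prop :=
  forall psi : R * R -> R, continuous psi ->
    (exists a K : R, 0 < a /\
       forall x t, K <= `|x| \/ t <= a \/ K <= t -> psi (x, t) = 0) ->
    (fun n => \int[mu2]_(z in setT `*` `]0, +oo[) (v n z.1 z.2 * psi z))
      @ \oo -->
    (\int[mu2]_(z in setT `*` `]0, +oo[) (u z.1 z.2 * psi z) : R).

(* Weak solutions obtained by vanishing viscosity, possibly only along a
   sequence of viscosities. *)
Definition viscosity_weak_solution s r (u0 : R -> R) u : Prop :=
  weak_solution s r 0 u0 u /\
  exists (eps : nat -> R) (v : nat -> R -> R -> R),
    [/\ forall n, 0 < eps n,
        eps @ \oo --> (0 : R),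
        forall n, weak_solution s r (eps n) u0 (v n) &
        weak_star_cvg v u].

(* rho is u in the variables x = y (1 + lambda tau)^(-1/lambda),
   t = ln (1 + lambda tau) / lambda. *)
Definition self_similar_transform s u rho : Prop :=
  forall y tau, 0 <= tau ->
    rho (y * (1 + lambda s * tau) `^ (- (1 / lambda s)))
        (1 / lambda s * ln (1 + lambda s * tau))
    = (1 + lambda s * tau) `^ (1 / lambda s) * u y tau.

Definition solves_equation s r rho : Prop :=
  forall x t, 0 < t ->
    d_time rho x t =
      derive1 (fun x' => rho x' t * (derive1 (riesz s (rho ^~ t)) x' + x')) x
      - expR (- (lambda s * delta s r * t)) * rho x t `^ r.

(* Decay at spatial infinity, locally uniform in positive time. *)
Definition vanishes_at_infinity rho : Prop :=
  forall a b e : R, 0 < a -> 0 < e ->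
    exists K : R, forall x t, a <= t <= b -> K <= `|x| -> `|rho x t| <= e.

(* Integrability is what makes the real-valued integrals [entropy],
   [dissipation] and [absorption] meaningful. The last clause ties the entropy
   for t > 0 to that of the initial datum. *)
Definition entropy_identity s r rho : Prop :=
  [/\ forall t, 0 <= t ->
        mu.-integrable setT (EFin \o entropy_density s (rho ^~ t)),
      forall t, 0 < t ->
        mu.-integrable setT (EFin \o dissipation_density s (rho ^~ t)) /\
        mu.-integrable setT (EFin \o absorption_density s r (rho ^~ t)),
      forall t, 0 < t ->
        is_derive t 1 (fun t' => entropy s (rho ^~ t'))
          (- dissipation s (rho ^~ t)
           - expR (- (lambda s * delta s r * t)) * absorption s r (rho ^~ t)) &
      entropy s (rho ^~ t) @[t --> 0^'+] --> entropy s (rho ^~ 0)].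

Definition smooth_solution s r (u0 : R -> R) rho : Prop :=
  [/\ forall x, rho x 0 = u0 x,
      forall x t, 0 < t -> 0 <= rho x t,
      smooth_on half_space rho /\ vanishes_at_infinity rho,
      solves_equation s r rho /\ entropy_identity s r rho &
      exists u, viscosity_weak_solution s r u0 u /\
                self_similar_transform s u rho].

End TwoVariables.

(* Main.v *)
(* Write H for the entropy and I for its dissipation, and q = 2 s - 1. The minimal
   energy at mass m is ment * m ^ p with p = (4 - q) / (2 - q), by dilation, and
   transporting a density f monotonically onto a competitor of the same mass gives
   H[f] - I[f] / 2 <= ment * m ^ p, since the kernel is convex on each half-line.
   Hence y(t) = H[rho(t)] - ment * M(t) ^ p, which dominates the relative entropy
   because the Barenblatt profile is a competitor, decays like exp (-2 t) up to the
   reaction term. That term is controlled by minimality itself: comparing rho with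
   rho + eps rho ^ r at first order costs y / eps + eps * D, where D is the self
   energy of rho ^ r; taking eps = exp (- lambda delta t) (1 + t) makes
   exp (2 t) y / (1 + t) grow at most like exp (2 (1 - lambda delta) t).
   D is bounded uniformly because the maximum principle, with the divergence of the
   velocity estimated at a maximum, bounds rho(t) for t >= 1 by the entropy alone.
   The mass is only handled through the cut-off integrals of (1 - (x / K) ^ 2) rho,
   with K to infinity at the end. *)
Require Import Defs.
From HB Require Import structures.
From mathcomp Require Import all_boot all_order all_algebra.
From mathcomp Require Import all_classical all_reals all_analysis.
From mathcomp Require Import measurable_realfun ring lra.
Set Implicit Arguments.
Unset Strict Implicit.
Unset Printing Implicit Defensive.
Import Order.TTheory GRing.Theory Num.Theory.
Import numFieldNormedType.Exports.
Local Open Scope classical_set_scope.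
Local Open Scope ring_scope.

(** * Integration toolkit *)

(** The exponent q = 2 s - 1 lies in (-1, 0): the kernel [|z| ^ q] is locally integrable but its
    derivatives are not, so it is handled as [(|z| + eta) ^ q] and the limit eta -> 0 is taken after
    symmetrising. With the minimal energy as reference, the mass lost by absorption lowers the
    reference level, while the absorption term lowers the entropy. At a minimiser the Euler-Lagrange
    equation makes these two effects cancel, so away from it only the first-order deviation is paid
    for. The square in (1 + t)^2 has two sources: the cost y / (1 + t) puts one factor 1 + t into
    the integrating factor, and integrating the remaining forcing exp (2 (1 - lambda delta) u) over
    [1, t] gives the other, genuinely so when lambda delta = 1. Smoothness of rho carries no decay
    of its derivatives, so the flux through the cut-off is charged to a share of order 1 / K of the
    dissipation. Times t < 1, before the sup bound is available, are covered by monotonicity of the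
    entropy. *)

Section Integration.
Context {R : realType}.
Local Notation mu := (@lebesgue_measure R).
Implicit Types (f g h : R -> R).

Definition Int f : Prop := mu.-integrable setT (EFin \o f).

Lemma Int_meas f : Int f -> measurable_fun setT f.
Proof. by move=> /measurable_int /measurable_EFinP. Qed.

Lemma eq_Int f g : f =1 g -> Int f -> Int g.
Proof. by move=> /funext ->. Qed.

Lemma Int_dom f g : measurable_fun setT f -> Int g ->
  (forall x, `|f x| <= g x) -> Int f.
Proof.
move=> mf ig fg; apply: le_integrable ig => //; first exact/measurable_EFinP.
move=> x _ /=; rewrite lee_fin (le_trans (fg x))// ler_norm//.
Qed.

Lemma IntD f g : Int f -> Int g -> Int (fun x => f x + g x).
Proof. by move=> If Ig; have := integrableD measurableT If Ig. Qed.

Lemma IntB f g : Int f -> Int g -> Int (fun x => f x - g x).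
Proof. by move=> If Ig; have := integrableB measurableT If Ig. Qed.

Lemma IntZ k f : Int f -> Int (fun x => k * f x).
Proof. by move=> If; have := integrableZl measurableT k If. Qed.

Lemma Int_norm f : Int f -> Int (fun x => `|f x|).
Proof. by move=> If; have := integrable_abse If. Qed.

Lemma Int0 : Int (fun=> 0).
Proof. exact: integrable0. Qed.

Lemma Int_mulb f g B : measurable_fun setT g -> (forall x, `|g x| <= B) ->
  Int f -> Int (fun x => g x * f x).
Proof.
move=> mg gB If; apply: (@Int_dom _ (fun x => B * `|f x|)).
- by apply: measurable_funM => //; exact: Int_meas.
- exact/IntZ/Int_norm.
- by move=> x; rewrite normrM ler_wpM2r.
Qed.

Lemma intD f g : Int f -> Int g ->
  \int[mu]_x (f x + g x) = \int[mu]_x f x + \int[mu]_x g x.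
Proof. exact: RintegralD. Qed.

Lemma intB f g : Int f -> Int g ->
  \int[mu]_x (f x - g x) = \int[mu]_x f x - \int[mu]_x g x.
Proof. exact: RintegralB. Qed.

Lemma intZ k f : Int f -> \int[mu]_x (k * f x) = k * \int[mu]_x f x.
Proof. by move=> ?; rewrite RintegralZl. Qed.

Lemma int_le f g : Int f -> Int g -> (forall x, f x <= g x) ->
  \int[mu]_x f x <= \int[mu]_x g x.
Proof. by move=> If Ig fg; apply: le_Rintegral. Qed.

Lemma int_ge0 f : (forall x, 0 <= f x) -> 0 <= \int[mu]_x f x.
Proof. by move=> f0; apply: Rintegral_ge0. Qed.

Lemma int_norm f : Int f -> `|\int[mu]_x f x| <= \int[mu]_x `|f x|.
Proof. by move=> If; exact: le_normr_Rintegral. Qed.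

Lemma eq_int f g : f =1 g -> \int[mu]_x f x = \int[mu]_x g x.
Proof. by move=> /funext ->. Qed.

Lemma int0 : \int[mu]_(x in setT) (0 : R) = 0.
Proof. by rewrite /Rintegral integral0. Qed.

Lemma EFin_int f : Int f -> (\int[mu]_x f x)%:E = (\int[mu]_x (f x)%:E)%E.
Proof. by move=> If; rewrite /Rintegral fineK//; exact: integrable_fin_num. Qed.

Lemma ge0_IntP f : measurable_fun setT f -> (forall x, 0 <= f x) ->
  (\int[mu]_x (f x)%:E < +oo)%E -> Int f.
Proof.
move=> mf f0 foo; apply/integrableP; split; first exact/measurable_EFinP.
by under eq_integral do rewrite /= ger0_norm//.
Qed.

Lemma ae_neq (c : R) : {ae mu, forall x, x != c}.
Proof.
exists [set c]; split => //; first exact: lebesgue_measure_set1.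
by move=> x /= /negP; rewrite negbK => /eqP.
Qed.

Lemma ae_imp (P Q : R -> Prop) : (forall x, P x -> Q x) ->
  {ae mu, forall x, P x} -> {ae mu, forall x, Q x}.
Proof. exact: (@filterS _ _ (ae_filter_ringOfSetsType mu)). Qed.

Lemma ae_and (P Q : R -> Prop) :
  {ae mu, forall x, P x} -> {ae mu, forall x, Q x} ->
  {ae mu, forall x, P x /\ Q x}.
Proof. exact: (@filterI _ _ (ae_filter_ringOfSetsType mu)). Qed.

Lemma ae_all (P : R -> Prop) : (forall x, P x) -> {ae mu, forall x, P x}.
Proof. by move=> aP; apply: aeW. Qed.

Lemma int_ae_le f g : Int f -> Int g -> {ae mu, forall x, f x <= g x} ->
  \int[mu]_x f x <= \int[mu]_x g x.
Proof.
move=> If Ig fg; rewrite -subr_ge0 -intB//.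
(* The difference is nonnegative only almost everywhere, so it is swapped for its absolute value
   before taking the sign of the integral. *)
rewrite /Rintegral fine_ge0// (@ae_eq_integral _ _ _ mu setT (fun x => `|(g x - f x)%:E|%E))//.
- exact: integral_ge0.
- by have := Int_meas (IntB Ig If) => /measurable_EFinP.
- apply: measurableT_comp => //; apply/measurable_EFinP.
  exact: Int_meas (IntB Ig If).
- apply: ae_imp fg => x fgx _ /=; rewrite ger0_norm// subr_ge0//.
Qed.

Lemma int_ae_eq f g : Int f -> Int g -> {ae mu, forall x, f x = g x} ->
  \int[mu]_x f x = \int[mu]_x g x.
Proof.
move=> If Ig fg; apply/eqP; rewrite eq_le !int_ae_le//.
- by apply: ae_imp fg => x ->.
- by apply: ae_imp fg => x ->.
Qed.

Lemma Int_ae f g : measurable_fun setT g -> Int f -> {ae mu, forall x, f x = g x} ->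
  Int g.
Proof.
move=> mg If fg; have /integrableP[_ If2] := If.
apply/integrableP; split; first exact/measurable_EFinP.
rewrite (@ae_eq_integral _ _ _ mu setT (fun x => `|(f x)%:E|%E))//.
- apply: measurableT_comp => //; exact/measurable_EFinP.
- apply: measurableT_comp => //; apply/measurable_EFinP; exact: Int_meas.
- by apply: ae_imp fg => x -> _.
Qed.

(** The L1 convergence in the last clause is what [unif_kernel] turns into a rate that is uniform
    over a family of functions. *)
Lemma int_dct (F : nat -> R -> R) f g :
  (forall n, measurable_fun setT (F n)) -> measurable_fun setT f ->
  {ae mu, forall x, F n x @[n --> \oo] --> f x} -> Int g ->
  {ae mu, forall x, forall n, `|F n x| <= g x} ->
  [/\ Int f, \int[mu]_x F n x @[n --> \oo] --> \int[mu]_x f x &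
   \int[mu]_x `|F n x - f x| @[n --> \oo] --> (0:R)].
Proof.
move=> mF mf Ff Ig Fg.
have H a1 a2 a3 a4 a5 := @dominated_convergence _ _ R mu setT measurableT
   (fun n => EFin \o F n) (EFin \o f) (EFin \o g) a1 a2 a3 a4 a5.
have [H1 H2 H3] : [/\ Int f,
  [sequence \int[mu]_x `|(F n x)%:E - (f x)%:E|]_n @ \oo --> 0 &
  [sequence \int[mu]_x (F n x)%:E]_n @ \oo --> \int[mu]_x (f x)%:E ]%E.
  apply: H => //.
  - move=> n. by apply/measurable_EFinP; exact: mF.
  - exact/measurable_EFinP.
  - by apply: ae_imp Ff => x Fx _; apply: cvg_EFin => //; exact: nearW.
  - by apply: ae_imp Fg => x Fx n _; rewrite /= lee_fin.
split => //.
- apply: fine_cvg; move: H3; rewrite [X in _ -> _ --> X]/= => H3.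
  by rewrite -/(Rintegral _ _ _) EFin_int.
- apply: fine_cvg; exact: H2.
Qed.

End Integration.

(** * Affine changes of variables and Fubini for real-valued integrals *)

Section ChangeOfVariables.
Context {R : realType}.
Local Notation mu := (@lebesgue_measure R).
Implicit Types (f g h : R -> R).

Lemma measurable_affine (k b : R) : measurable_fun setT (fun x : R => k * x + b).
Proof. by apply: measurable_funD => //; apply: measurable_funM. Qed.

(** The push-forward of [mu] scaled by [|k|] agrees with [mu] on half-open intervals, and these
    determine Lebesgue measure. For negative k the preimage is half open at the other end but has
    the same length. *)
Lemma lebesgue_measure_affine (k b : R) (A : set (measurableTypeR R)) : k != 0 -> measurable A ->
  mu A = (`|k|%:E * mu ((fun x => k * x + b)%R @^-1` A))%E.
Proof.
move=> k0 mA.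
pose phi := (fun x : measurableTypeR R => (k * x + b)%R : measurableTypeR R).
have mphi : measurable_fun setT phi by exact: measurable_affine.
pose nu0 : {measure set (measurableTypeR R) -> \bar R} :=
  mscale (NngNum (normr_ge0 k)) (pushforward mu phi).
pose nu := nu0 mphi.
suff H : forall X, ocitv X -> mu X = nu X by rewrite (lebesgue_measure_unique H).
move=> _ [[x y]] _ <-; change (mu `]x, y]%classic = (`|k|%:E * mu (phi @^-1` `]x, y]%classic))%E).
case: (ltgtP k 0) => [k1|k1|k1]; last by rewrite k1 eqxx in k0.
- have -> : phi @^-1` `]x, y]%classic = `[(y - b) / k, (x - b) / k[%classic.
    apply/seteqP; split => z /=; rewrite /phi !in_itv/=.
      by rewrite ler_ndivrMr// ltr_ndivlMr// mulrC => /andP[? ?]; apply/andP; split; lra.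
    by rewrite ler_ndivrMr// ltr_ndivlMr// mulrC => /andP[? ?]; apply/andP; split; lra.
  rewrite !lebesgue_measure_itv/= !lte_fin ltr_nM2r ?invr_lt0// ltrD2r.
  case: ifPn => _; last by rewrite mule0.
  rewrite -!EFinD -EFinM; congr EFin; rewrite ltr0_norm//; field; by rewrite lt_eqF.
- have -> : phi @^-1` `]x, y]%classic = `](x - b) / k, (y - b) / k]%classic.
    apply/seteqP; split => z /=; rewrite /phi !in_itv/=.
      by rewrite ler_pdivlMr// ltr_pdivrMr// mulrC => /andP[? ?]; apply/andP; split; lra.
    by rewrite ler_pdivlMr// ltr_pdivrMr// mulrC => /andP[? ?]; apply/andP; split; lra.
  rewrite !lebesgue_measure_itv/= !lte_fin ltr_pM2r ?invr_gt0// ltrD2r.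
  case: ifPn => _; last by rewrite mule0.
  by rewrite -!EFinD -EFinM; congr EFin; rewrite gtr0_norm//; field.
Qed.

Lemma ge0_integral_affine (k b : R) (f : R -> \bar R) : k != 0 ->
  measurable_fun setT f -> (forall x, 0 <= f x)%E ->
  (\int[mu]_x f x = `|k|%:E * \int[mu]_x f (k * x + b)%R)%E.
Proof.
move=> k0 mf f0.
pose phi := (fun x : measurableTypeR R => (k * x + b)%R : measurableTypeR R).
have mphi : measurable_fun setT phi by exact: measurable_affine.
pose nu0 : {measure set (measurableTypeR R) -> \bar R} :=
  mscale (NngNum (normr_ge0 k)) (pushforward mu phi).
pose nu := nu0 mphi.
rewrite (@eq_measure_integral _ _ _ setT nu); last first.
  by move=> A mA _; rewrite /nu /nu0/= /mscale/= /pushforward/=; exact: lebesgue_measure_affine.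
rewrite ge0_integral_mscale//= ge0_integral_pushforward//.
Qed.

Lemma Int_affine (k b : R) f : k != 0 -> Int f -> Int (fun x => f (k * x + b)).
Proof.
move=> k0 If; apply/integrableP; split.
  apply/measurable_EFinP; apply: (measurableT_comp (Int_meas If)).
  exact: measurable_affine.
have /integrableP[m1 m2] := If; move: m2.
rewrite (ge0_integral_affine b k0)//; last first.
  by apply: measurableT_comp => //.
rewrite -[X in (_ -> X < _)%E]/(\int[mu]_x `|(f (k * x + b)%R)%:E|)%E.
set t := (X in (_ -> X < _)%E); rewrite -[X in (_ * X)%E]/t; move: t => [r| |] H; first by rewrite /= ltry.
  by move: H; rewrite mulry gtr0_sg ?normr_gt0// mul1e.
by [].
Qed.

Lemma int_affine (k b : R) f : k != 0 -> Int f ->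
  \int[mu]_x f x = `|k| * \int[mu]_x f (k * x + b).
Proof.
move=> k0.
have pos g : Int g -> (forall x, 0 <= g x) ->
    \int[mu]_x g x = `|k| * \int[mu]_x g (k * x + b).
  move=> Ig g0; apply: EFin_inj; rewrite EFinM !EFin_int//; last exact: Int_affine.
  rewrite (ge0_integral_affine b k0)//.
  by apply/measurable_EFinP; exact: Int_meas.
move=> If.
(* The nonnegative case is applied to the two functions in f = (|f| + f) - |f|. *)
have If1 := IntD (Int_norm If) If.
have -> : \int[mu]_x f x = \int[mu]_x (`|f x| + f x) - \int[mu]_x `|f x|.
  by rewrite -intB//; [apply: eq_int => x; ring|exact: Int_norm].
rewrite (pos _ If1); last by move=> x; have := ler_norm (- f x); rewrite normrN; lra.
rewrite (pos _ (Int_norm If))// -mulrBr -intB//; [|exact: Int_affine If1|exact: (Int_affine _ _ (Int_norm If))].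
by congr (_ * _); apply: eq_int => x; ring.
Qed.

End ChangeOfVariables.

Section ChangeOfVariables2.
Context {R : realType}.
Local Notation mu := (@lebesgue_measure R).
Implicit Types (f g h : R -> R).

Lemma Int_sub (x : R) f : Int f -> Int (fun y => f (x - y)).
Proof.
move=> If; apply: eq_Int (@Int_affine R (-1) x f _ If) => [y|]; last by rewrite oppr_eq0 oner_eq0.
by congr f; ring.
Qed.

Lemma int_sub (x : R) f : Int f -> \int[mu]_y f (x - y) = \int[mu]_y f y.
Proof.
move=> If; rewrite (@int_affine R (-1) x f _ If) ?oppr_eq0 ?oner_eq0// normrN1 mul1r.
by apply: eq_int => y; congr f; ring.
Qed.

Lemma Int_opp f : Int f -> Int (fun y => f (- y)).
Proof. by move=> /(Int_sub 0); apply: eq_Int => y; rewrite sub0r. Qed.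

Lemma int_opp f : Int f -> \int[mu]_y f (- y) = \int[mu]_y f y.
Proof. by move=> If; rewrite -(int_sub 0 If); apply: eq_int => y; rewrite sub0r. Qed.

Definition meas2 (k : R -> R -> R) := measurable_fun setT (fun p : R * R => k p.1 p.2).

Lemma meas2_curry (k : R -> R -> R) x : meas2 k -> measurable_fun setT (k x).
Proof. by move=> mk; exact: (measurable_fun_pair2 x mk). Qed.

Lemma meas2_curry2 (k : R -> R -> R) y : meas2 k -> measurable_fun setT (k ^~ y).
Proof. by move=> mk; exact: (measurable_fun_pair1 y mk). Qed.

Lemma meas2_swap (k : R -> R -> R) : meas2 k -> meas2 (fun x y => k y x).
Proof. by move=> mk; exact: (measurableT_comp mk (@measurable_swap _ _ _ _)). Qed.

Lemma meas2_fst f : measurable_fun setT f -> meas2 (fun x y => f x).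
Proof. by move=> mf; exact: (measurableT_comp mf measurable_fst). Qed.

Lemma meas2_snd f : measurable_fun setT f -> meas2 (fun x y => f y).
Proof. by move=> mf; exact: (measurableT_comp mf measurable_snd). Qed.

Lemma meas2M k1 k2 : meas2 k1 -> meas2 k2 -> meas2 (fun x y => k1 x y * k2 x y).
Proof. by move=> m1 m2; exact: measurable_funM. Qed.

Lemma meas2_comp f k : measurable_fun setT f -> meas2 k -> meas2 (fun x y => f (k x y)).
Proof. by move=> mf mk; exact: (measurableT_comp mf mk). Qed.

Lemma meas2B k1 k2 : meas2 k1 -> meas2 k2 -> meas2 (fun x y => k1 x y - k2 x y).
Proof. by move=> m1 m2; exact: measurable_funB. Qed.

Lemma measurable_int2 (k : R -> R -> R) :
  meas2 k -> (forall x y, 0 <= k x y) ->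
  measurable_fun setT (fun x => \int[mu]_y k x y).
Proof.
move=> mk k0.
apply: (measurableT_comp (f := fine)) => //.
apply: (@measurable_fun_fubini_tonelli_F _ _ _ _ R mu (fun p : R * R => (k p.1 p.2)%:E)) => //.
  by apply/measurable_EFinP.
by move=> p; rewrite lee_fin.
Qed.

(** Integrability of every slice ensures that no inner integral is infinite, so that [fine] never
    returns its default value and the iterated real integrals are the extended ones. *)
Lemma fubini_real (k : R -> R -> R) : meas2 k ->
  (forall x, Int (k x)) -> (forall y, Int (k ^~ y)) ->
  Int (fun x => \int[mu]_y `|k x y|) ->
  [/\ Int (fun x => \int[mu]_y k x y), Int (fun y => \int[mu]_x k x y) &
   \int[mu]_x \int[mu]_y k x y = \int[mu]_y \int[mu]_x k x y].
Proof.
move=> mk I1 I2 I3.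
have H : (mu \x mu)%E.-integrable setT (fun p : R * R => (k p.1 p.2)%:E).
  apply/integrable12ltyP; first exact/measurable_EFinP.
  rewrite [X in (X < _)%E](_ : _ = \int[mu]_x (\int[mu]_y `|k x y|)%:E)%E; last first.
    by apply: eq_integral => x _; rewrite EFin_int//; exact: Int_norm.
  by rewrite -EFin_int ?ltry//.
have E1 : (fun x => \int[mu]_y (k x y)%:E)%E = EFin \o (fun x => \int[mu]_y k x y).
  by apply/funext => x /=; rewrite EFin_int.
have E2 : (fun y => \int[mu]_x (k x y)%:E)%E = EFin \o (fun y => \int[mu]_x k x y).
  by apply/funext => x /=; rewrite (EFin_int (I2 _)).
have J1 : Int (fun x => \int[mu]_y k x y).
  by rewrite /Int -E1; exact: integrable_fubini_F H.
have J2 : Int (fun y => \int[mu]_x k x y).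
  have H' : (mu \x mu)%E.-integrable setT (fun p : R * R => (k p.2 p.1)%:E).
    apply/integrable12ltyP; first by apply/measurable_EFinP; exact: meas2_swap mk.
    have /integrable12ltyP := H => /(_ (proj2 (measurable_EFinP _ _) mk)).
    have T a1 a2 := @fubini_tonelli _ _ _ _ R mu mu (fun p => `|(k p.1 p.2)%:E|)%E a1 a2.
    rewrite /= in T *; rewrite T//.
    have m1 : measurable_fun setT (fun p : R * R => (k p.1 p.2)%:E) by apply/measurable_EFinP; exact: mk.
    exact: (@measurableT_comp _ _ _ _ _ _ (@abse R) _ _ _ m1).
  by rewrite /Int -E2; exact: integrable_fubini_F H'.
split => //; apply: EFin_inj; rewrite !EFin_int//.
have := Fubini H; rewrite /=.
by rewrite E1 E2.
Qed.
End ChangeOfVariables2.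

(** * Powers and differentiation *)

Section Powers.
Context {R : realType}.
Local Notation mu := (@lebesgue_measure R).
Implicit Types (f g h : R -> R).

Lemma measurable_leb d (T : measurableType d) (f g : T -> R) : measurable_fun setT f -> measurable_fun setT g ->
  measurable_fun setT (fun x : T => (f x <= g x)%R%:R : R).
Proof.
move=> mf mg.
have -> : (fun x : T => (f x <= g x)%R%:R : R) = \1_(setT `&` [set x | f x <= g x]).
  by apply/funext => x; rewrite indicE setTI; congr (_%:R); rewrite mem_setE.
apply: measurable_indic; exact: measurable_fun_le.
Qed.

Lemma measurable_ltb d (T : measurableType d) (f g : T -> R) : measurable_fun setT f -> measurable_fun setT g ->
  measurable_fun setT (fun x : T => (f x < g x)%R%:R : R).
Proof.
move=> mf mg.
have -> : (fun x : T => (f x < g x)%R%:R : R) = (fun x => 1 - (g x <= f x)%R%:R).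
  by apply/funext => x; rewrite ltNge; case: (_ <= _); rewrite /= ?subrr ?subr0.
by apply: measurable_funB => //; exact: measurable_leb.
Qed.

(** Restrictions to intervals and balls are carried as 0/1 factors on the whole line, which keeps a
    single notion of integrability. This converts them to integrals over sets when the fundamental
    theorem of calculus is applied. *)
Lemma integral_bool (P : R -> bool) f :
  (\int[mu]_(x in [set x | P x]) (f x)%:E = \int[mu]_x ((P x)%:R * f x)%:E)%E.
Proof.
rewrite integral_mkcond; apply: eq_integral => x _.
rewrite patchE mem_setE; have -> : (x \in P) = P x by [].
by case: (P x); rewrite ?mul1r ?mul0r.
Qed.

Lemma powR_cvgy0 (a : R) : a < 0 -> x `^ a @[x --> +oo] --> (0:R).
Proof.
move=> a0; apply/cvgrPdist_lt => e e0.
near=> x.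
rewrite sub0r normrN ger0_norm ?powR_ge0//.
have x0 : 0 < x by near: x; exact: nbhs_pinfty_gt.
have : (e^-1) `^ (- a)^-1 < x by near: x; apply: nbhs_pinfty_gt; rewrite num_real.
move=> /(@gt0_ltr_powR _ (- a)) -/(_ _).
rewrite -powRrM mulVf ?oppr_eq0 ?lt_eqF// powRr1 ?invr_ge0 ?ltW// powRN => H.
rewrite -[ltRHS]invrK -[ltLHS]invrK ltf_pV2 ?posrE ?invr_gt0 ?powR_gt0//.
by apply: H; rewrite ?nnegrE ?oppr_gt0 ?powR_ge0// ltW.
Unshelve. all: by end_near. Qed.

Lemma ftc_y f (F : R -> R) a l : (forall x, a <= x -> 0 <= f x) ->
  (forall x, a <= x -> {for x, continuous f}) ->
  (forall x, a <= x -> is_derive x 1 F (f x)) -> F x @[x --> +oo] --> l ->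
  (\int[mu]_(x in `[a, +oo[) (f x)%:E = (l - F a)%:E)%E.
Proof.
move=> f0 cf dF Fl; rewrite (@ge0_continuous_FTC2y R f F a l)//.
- apply: continuous_in_subspaceT => x; rewrite inE/= in_itv/= andbT; exact: cf.
- by move=> x ax; have := dF x (ltW ax).
- have := dF a (lexx _) => -[/derivable1_diffP/differentiable_continuous Fa _].
  exact: cvg_at_right_filter.
- by move=> x; rewrite in_itv/= andbT => ax; have [_ <-] := dF x (ltW ax); rewrite derive1E.
Qed.

Lemma ftc_ab f (F : R -> R) a b : a < b ->
  (forall x, a <= x <= b -> {for x, continuous f}) ->
  (forall x, a <= x <= b -> is_derive x 1 F (f x)) ->
  (\int[mu]_(x in `[a, b]) (f x)%:E = (F b - F a)%:E)%E.
Proof.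
move=> ab cf dF; rewrite (@continuous_FTC2 R f F a b)//.
- apply: continuous_in_subspaceT => x; rewrite inE/= in_itv/=; exact: cf.
- split => [x||].
  + by rewrite in_itv/= => /andP[ax xb]; have := dF x; rewrite (ltW ax) (ltW xb) => /(_ isT) [].
  + have := dF a; rewrite lexx (ltW ab) => /(_ isT)-[/derivable1_diffP/differentiable_continuous Fa _].
    exact: cvg_at_right_filter.
  + have := dF b; rewrite lexx (ltW ab) => /(_ isT)-[/derivable1_diffP/differentiable_continuous Fa _].
    exact: cvg_at_left_filter.
- move=> x; rewrite in_itv/= => /andP[ax xb]; have := dF x; rewrite (ltW ax) (ltW xb) => /(_ isT) [_ <-].
  by rewrite derive1E.
Qed.

Lemma is_derive_prim (a x : R) : 0 < x -> a != -1 -> is_derive x 1 (fun y => (a + 1)^-1 * y `^ (a + 1)) (x `^ a).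
Proof.
move=> x0 a1.
have [d1 d2] := is_deriveZ (a + 1)^-1 (is_derive1_powR (a + 1) x0).
split => //; rewrite d2 /GRing.scale/= addrK mulrA mulVf ?mul1r//.
by rewrite -(opprK 1) subr_eq0.
Qed.

Lemma continuous_powR (a x : R) : 0 < x -> {for x, continuous (fun y : R => y `^ a)}.
Proof.
move=> x0; apply/differentiable_continuous/derivable1_diffP.
by have := is_derive1_powR a x0.
Qed.

Lemma Int_powR_tail (a : R) : a < -1 -> Int (fun x : R => (1 < x)%R%:R * x `^ a).
Proof.
move=> a1.
have m : measurable_fun setT (fun x : R => (1 < x)%R%:R * x `^ a).
  by apply: measurable_funM; [exact: measurable_ltb|exact: measurable_powR].
apply: ge0_IntP => //; first by move=> x; rewrite mulr_ge0 ?powR_ge0.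
rewrite -integral_bool.
have -> : [set x : R | 1 < x] = `]1, +oo[%classic.
  by apply/seteqP; split => x /=; rewrite in_itv/= andbT.
rewrite integral_itv_obnd_cbnd; last by apply/measurable_EFinP; apply: measurable_funTS; exact: measurable_powR.
have -> : (\int[mu]_(x in `[1%R, +oo[) (x `^ a)%:E = (0 - (a + 1)^-1 * 1 `^ (a + 1))%:E)%E; last by rewrite ltry.
apply: (@ftc_y (fun x => x `^ a) (fun x => (a + 1)^-1 * x `^ (a + 1)) 1 0).
- by move=> x _; exact: powR_ge0.
- by move=> x x1; apply: continuous_powR; lra.
- by move=> x x1; apply: is_derive_prim; [lra|apply/eqP; lra].
- rewrite -(mulr0 (a + 1)^-1); apply: cvgM; first exact: cvg_cst.
  by apply: powR_cvgy0; lra.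
Qed.

Lemma Int_powR_near0 (a : R) : -1 < a -> Int (fun x : R => (0 < x <= 1)%R%:R * x `^ a).
Proof.
move=> a1.
have m : measurable_fun setT (fun x : R => (0 < x <= 1)%R%:R * x `^ a).
  apply: measurable_funM; last exact: measurable_powR.
  under eq_fun do rewrite -mulnb natrM.
  by apply: measurable_funM; [exact: measurable_ltb|exact: measurable_leb].
apply: ge0_IntP => //; first by move=> x; rewrite mulr_ge0 ?powR_ge0.
rewrite -integral_bool.
pose F (n : nat) : set (measurableTypeR R) := `[n.+1%:R^-1, 1]%classic.
have -> : [set x : R | 0 < x <= 1] = \bigcup_n F n.
  apply/seteqP; split => x /=.
    move=> /andP[x0 x1].
    have [n _ /(_ n (leqnn n)) nx] := near_infty_natSinv_lt (PosNum x0).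
    by exists n => //; rewrite /F/= in_itv/= x1 andbT ltW.
  move=> [n _]; rewrite /F/= in_itv/= => /andP[nx ->]; rewrite andbT.
  by rewrite (lt_le_trans _ nx)// invr_gt0 ltr0n.
apply: (@le_lt_trans _ _ ((a + 1)^-1)%:E); last by rewrite ltry.
have H : (\int[mu]_(x in F i) (x `^ a)%:E)%E @[i --> \oo] --> (\int[mu]_(x in \bigcup_n F n) (x `^ a)%:E)%E.
  apply: ge0_nondecreasing_set_cvg_integral => //.
  - apply/nondecreasing_seqP => n; rewrite subsetEset /F => x /=; rewrite !in_itv/=.
    by move=> /andP[nx ->]; rewrite andbT (le_trans _ nx)// lef_pV2 ?posrE ?ltr0n// ler_nat.
  - by move=> n; exact: measurable_itv.
  - by move=> n; apply/measurable_EFinP; apply: measurable_funTS; exact: measurable_powR.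
  - by move=> n x _; rewrite lee_fin powR_ge0.
have <- := cvg_lim _ H => //.
apply: lime_le; first by apply/cvg_ex; eexists; exact: H.
(* For n = 0 the interval degenerates to the point 1, which [ftc_ab] excludes. *)
apply: nearW => -[|n].
  by rewrite /F invr1 set_itv1 integral_set1 lee_fin invr_ge0; lra.
have n0 : 0 < (n.+2%:R : R)^-1 by rewrite invr_gt0 ltr0n.
rewrite /F.
have -> : (\int[mu]_(x in `[(n.+2%:R^-1)%R, 1%R]) (x `^ a)%:E = ((a + 1)^-1 * 1 `^ (a + 1) - (a + 1)^-1 * n.+2%:R^-1 `^ (a + 1))%:E)%E; last first.
  rewrite powR1 mulr1 lee_fin gerBl mulr_ge0 ?powR_ge0// invr_ge0; lra.
apply: (@ftc_ab (fun x => x `^ a) (fun x => (a + 1)^-1 * x `^ (a + 1))).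
- by rewrite invf_lt1 ?ltr0n// ltr1n.
- by move=> x /andP[x1 _]; apply: continuous_powR; exact: lt_le_trans x1.
- by move=> x /andP[x1 _]; apply: is_derive_prim; [exact: lt_le_trans x1|apply/eqP; lra].
Qed.
End Powers.

Section Tails.
Context {R : realType}.
Local Notation mu := (@lebesgue_measure R).
Implicit Types (f g h : R -> R).

Lemma Int_boolM (P : R -> bool) f : measurable_fun setT (fun x => (P x)%:R : R) -> Int f ->
  Int (fun x => (P x)%:R * f x).
Proof. by move=> mP; apply: (@Int_mulb _ _ _ 1) => // x; case: (P x); rewrite ?normr1 ?normr0. Qed.

Lemma Int_norm_powR_tail (a : R) : a < -1 -> Int (fun x : R => (1 < `|x|)%R%:R * `|x| `^ a).
Proof.
move=> a1; apply: eq_Int (IntD (Int_powR_tail a1) (Int_opp (Int_powR_tail a1))) => x.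
have [x0|x0] := leP 0 x.
- by rewrite ger0_norm// (_ : (1 < - x) = false) ?mul0r ?addr0//; apply/negbTE; rewrite -leNgt; lra.
- by rewrite ltr0_norm// (_ : (1 < x) = false) ?mul0r ?add0r//; apply/negbTE; rewrite -leNgt; lra.
Qed.

Lemma Int_norm_powR_near0 (a : R) : -1 < a -> Int (fun x : R => (`|x| <= 1)%R%:R * `|x| `^ a).
Proof.
move=> a1; apply: Int_ae (IntD (Int_powR_near0 a1) (Int_opp (Int_powR_near0 a1))) _.
  apply: measurable_funM; first by apply: measurable_leb.
  exact: (measurableT_comp (@measurable_powR R a)).
apply: ae_imp (ae_neq 0) => x x0.
have [x1|x1|x1] := ltgtP 0 x.
- rewrite gtr0_norm// (_ : (0 < - x) = false) ?mul0r ?addr0//; apply/negbTE; rewrite -leNgt; lra.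
- by rewrite ltr0_norm// mul0r add0r oppr_gt0 x1.
- by rewrite -x1 eqxx in x0.
Qed.

Lemma cvg_nat_trunc (x : R) : (`|x| <= n%:R)%R%:R @[n --> \oo] --> (1 : R).
Proof.
apply: cvg_near_cst; near=> n; rewrite (_ : _ <= _)//.
by near: n; exact: nbhs_infty_ger.
Unshelve. all: by end_near. Qed.

Lemma trunc_cvg f : Int f ->
  \int[mu]_x ((`|x| <= n%:R)%R%:R * f x) @[n --> \oo] --> \int[mu]_x f x.
Proof.
move=> If; have mf := Int_meas If.
have [] := @int_dct R (fun n x => (`|x| <= n%:R)%R%:R * f x) f (fun x => `|f x|) => //.
- by move=> n; apply: measurable_funM => //; exact: measurable_leb.
- apply: ae_all => x; rewrite -[X in _ --> X]mul1r; apply: cvgM; last exact: cvg_cst.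
  exact: cvg_nat_trunc.
- exact: Int_norm.
- apply: ae_all => x n; rewrite normrM ler_piMl//.
  by case: (`|x| <= n%:R); rewrite ?normr1 ?normr0.
Qed.

Lemma tail_cvg f : Int f ->
  \int[mu]_x ((n%:R < `|x|)%R%:R * f x) @[n --> \oo] --> (0 : R).
Proof.
move=> If; have H := trunc_cvg If.
rewrite -(subrr (\int[mu]_x f x)).
have -> : (fun n : nat => \int[mu]_x ((n%:R < `|x|)%R%:R * f x)) =
  (fun n : nat => \int[mu]_x f x - \int[mu]_x ((`|x| <= n%:R)%R%:R * f x)).
  apply/funext => n; rewrite -intB//; last by apply: Int_boolM => //; exact: measurable_leb.
  apply: eq_int => x; rewrite ltNge; case: (`|x| <= n%:R); rewrite /= ?mul0r ?mul1r; ring.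
by apply: cvgB => //; exact: cvg_cst.
Qed.
End Tails.

(** * Derivatives through sequences, and convexity of negative powers *)

Section Derivatives.
Context {R : realType}.
Local Notation mu := (@lebesgue_measure R).
Implicit Types (f g h : R -> R).

Lemma is_derive_cvg f (x l : R) :
  (h^-1 * (f (h + x) - f x)) @[h --> 0^'] --> l -> is_derive x 1 f l.
Proof.
move=> H.
have H' : h^-1 *: (f (h *: 1 + x) - f x) @[h --> 0^'] --> l.
  apply: cvg_trans H; apply: near_eq_cvg; apply: nearW => h.
  by rewrite /GRing.scale/= mulr1.
split; first by apply/cvg_ex; exists l.
exact: cvg_lim H'.
Qed.

Lemma is_derive_cvgP f (x l : R) : is_derive x 1 f l ->
  (h^-1 * (f (h + x) - f x)) @[h --> 0^'] --> l.
Proof.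
move=> [d <-]; move/cvg_ex: d => [l' H]; rewrite /derive (cvg_lim _ H)//.
apply: cvg_trans H; apply: near_eq_cvg; apply: nearW => h.
by rewrite /GRing.scale/= mulr1.
Qed.

(** Dominated convergence is available along sequences, hence this form of the difference
    quotient. *)
Lemma is_derive_seq f (x l : R) :
  (forall t : nat -> R, (forall n, t n != 0) -> t n @[n --> \oo] --> (0 : R) ->
    ((t n)^-1 * (f (t n + x) - f x)) @[n --> \oo] --> l) -> is_derive x 1 f l.
Proof.
move=> H; apply: is_derive_cvg; apply/cvgr_dnbhsP => t [t0 tc].
exact: (H t).
Qed.

Lemma is_derive_seqP f (x l : R) (t : nat -> R) : is_derive x 1 f l ->
  (forall n, t n != 0) -> t n @[n --> \oo] --> (0 : R) ->
    ((t n)^-1 * (f (t n + x) - f x)) @[n --> \oo] --> l.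
Proof. by move=> /is_derive_cvgP/cvgr_dnbhsP H t0 tc; exact: (H t). Qed.

Lemma is_derive_continuous f (x l : R) : is_derive x 1 f l -> {for x, continuous f}.
Proof. by move=> [d _]; exact/differentiable_continuous/derivable1_diffP. Qed.

Lemma is_derive_near (f g : R -> R) (x l : R) : (\forall y \near x, f y = g y) ->
  is_derive x 1 f l -> is_derive x 1 g l.
Proof.
move=> fg [d dl]; split; first exact: near_eq_derivable d.
by rewrite -dl; apply/esym/near_eq_derive.
Qed.

Lemma is_derive_norm (g : R -> R) (z l : R) : z != 0 -> is_derive `|z| 1 g l ->
  is_derive z 1 (fun y => g `|y|) (l * Num.sg z).
Proof.
move=> z0 dg; have [z1|z1|z1] := ltgtP 0 z; last by rewrite -z1 eqxx in z0.
- rewrite gtr0_sg// mulr1; rewrite gtr0_norm// in dg.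
  apply: is_derive_near dg; near=> y; rewrite gtr0_norm//.
  by near: y; exact: lt_nbhsr.
- rewrite ltr0_sg//; rewrite ltr0_norm// in dg.
  have d1 : is_derive z 1 (g \o -%R) (l * -1).
    exact: is_derive1_comp.
  apply: is_derive_near d1; near=> y; rewrite /= ltr0_norm//.
  by near: y; exact: lt_nbhsl.
Unshelve. all: by end_near. Qed.

(** The Lipschitz bound dominates the difference quotients by [L * |rho|], and the one point y = x
    where the kernel may have a kink is null. No smoothness of rho enters. *)
Lemma conv_derive (k k' rho : R -> R) (B L x : R) : measurable_fun setT k -> measurable_fun setT k' ->
  (forall z, `|k z| <= B) -> (forall z, `|k' z| <= L) ->
  (forall z w, `|k z - k w| <= L * `|z - w|) ->
  (forall z : R, z != 0 -> is_derive z 1 k (k' z)) -> Int rho ->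
  is_derive x 1 (fun x => \int[mu]_y (k (x - y) * rho y)) (\int[mu]_y (k' (x - y) * rho y)).
Proof.
move=> mk mk' kB k'L kL kk' Irho; apply: is_derive_seq => t t0 tc.
have mrho := Int_meas Irho.
have msub a : measurable_fun setT (fun y : R => a - y) by exact: measurable_funB.
have Ik a : Int (fun y => k (a - y) * rho y).
  by apply: (@Int_mulb _ _ _ B) => //; exact: (measurableT_comp mk).
have mF n : measurable_fun setT (fun y : R => (t n)^-1 * (k (t n + x - y) * rho y - k (x - y) * rho y)).
  apply: measurable_funM => //; apply: measurable_funB; apply: measurable_funM => //; exact: (measurableT_comp mk).
have [] := @int_dct R (fun n y => (t n)^-1 * (k (t n + x - y) * rho y - k (x - y) * rho y))
   (fun y => k' (x - y) * rho y) (fun y => L * `|rho y|) => //.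
- by apply: measurable_funM => //; exact: (measurableT_comp mk').
- apply: ae_imp (ae_neq x) => y yx.
  have xy0 : x - y != 0 by rewrite subr_eq0 eq_sym.
  have := is_derive_seqP (kk' _ xy0) t0 tc.
  move=> H.
  have H2 : (t n)^-1 * (k (t n + (x - y)) - k (x - y)) * rho y @[n --> \oo] --> k' (x - y) * rho y.
    by apply: cvgM; [exact: H|exact: cvg_cst].
  apply: cvg_trans H2; apply: near_eq_cvg; apply: nearW => n /=.
  by rewrite addrA; ring.
- exact/IntZ/Int_norm.
- apply: ae_all => y n; rewrite -mulrBl mulrA normrM ler_wpM2r//.
  rewrite normrM normfV ler_pdivrMl ?normr_gt0// mulrC (le_trans (kL _ _))//.
  by rewrite (_ : _ - _ - _ = t n)//; ring.
- move=> _ H _; apply: cvg_trans H; apply: near_eq_cvg; apply: nearW => n /=.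
  rewrite intZ; last exact: IntB.
  by rewrite intB.
Qed.
End Derivatives.

Section PowerInequalities.
Context {R : realType}.
Implicit Types (a x y : R).

Lemma powR_le_neg a x y : a <= 0 -> 0 < x -> x <= y -> y `^ a <= x `^ a.
Proof.
move=> a0 x0 xy; have y0 : 0 < y by exact: lt_le_trans xy.
rewrite -[leLHS]invrK -[leRHS]invrK lef_pV2 ?posrE ?invr_gt0 ?powR_gt0// -!powRN.
by apply: ge0_ler_powR => //; rewrite ?oppr_ge0 ?nnegrE// ltW.
Qed.

(** After division by [y ^ a] this is Bernoulli's inequality for u = x / y:
    [u ^ a = expR (a * ln u)] is at least 1 + a ln u, and ln u <= u - 1 with a <= 0. *)
Lemma powR_tangent_neg a x y : a <= 0 -> 0 < x -> 0 < y ->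
  y `^ a + a * y `^ (a - 1) * (x - y) <= x `^ a.
Proof.
move=> a0 x0 y0.
have u0 : 0 < x / y by rewrite divr_gt0.
have H : 1 + a * (x / y - 1) <= (x / y) `^ a.
  rewrite /powR gt_eqF//; apply: le_trans (expR_ge1Dx _); rewrite lerD2l.
  rewrite ler_wnM2l// -[leRHS]expRK ler_ln ?posrE ?expR_gt0//.
  by apply: le_trans (expR_ge1Dx _); rewrite addrC subrK.
have -> : x `^ a = y `^ a * (x / y) `^ a.
  by rewrite -powRM ?ltW//; congr (_ `^ _); field; rewrite gt_eqF.
have -> : y `^ (a - 1) = y `^ a / y by rewrite powRB ?powRr1 ?ltW// (gt_eqF y0) implybT.
rewrite (_ : _ + _ = y `^ a * (1 + a * (x / y - 1))); last by field; rewrite gt_eqF.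
by rewrite ler_wpM2l// powR_ge0.
Qed.

Lemma powR_lip_neg a e x y : a <= 0 -> 0 < e -> e <= x -> e <= y ->
  `|x `^ a - y `^ a| <= - a * e `^ (a - 1) * `|x - y|.
Proof.
move=> a0 e0.
wlog: x y / y <= x => [H ex ey|yx ex ey].
  have [yx|/ltW xy] := leP y x; first exact: H.
  by rewrite distrC (distrC x); exact: H.
have x0 : 0 < x by exact: lt_le_trans ex.
have y0 : 0 < y by exact: lt_le_trans ey.
rewrite ler0_norm ?subr_le0; last exact: powR_le_neg.
rewrite (@ger0_norm _ (x - y)) ?subr_ge0// opprB.
have H := powR_tangent_neg a0 x0 y0.
have H2 : y `^ (a - 1) <= e `^ (a - 1) by apply: powR_le_neg => //; lra.
apply: (@le_trans _ _ (- a * y `^ (a - 1) * (x - y))); first by lra.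
by rewrite ler_wpM2r ?subr_ge0// ler_wpM2l// oppr_ge0.
Qed.
End PowerInequalities.

(** * The Riesz kernel and its potentials *)

Section Kernel.
Context {R : realType}.
Local Notation mu := (@lebesgue_measure R).
Variable q : R.
Context (q0 : q < 0) (q1 : -1 < q).
Local Ltac qlra := (have ? := q0; have ? := q1; lra).
Implicit Types (eta x y z : R).

(* Riesz kernel, regularised by [eta]; at [eta = 0] powR gives the junk value 0 at the origin. *)
Definition W eta z := (`|z| + eta) `^ q.
Definition W1 eta z := q * (`|z| + eta) `^ (q - 1) * Num.sg z.
Definition W2 eta z := q * (q - 1) * (`|z| + eta) `^ (q - 2).

Lemma meas_normD eta : measurable_fun setT (fun z : R => `|z| + eta).
Proof. by apply: measurable_funD => //. Qed.

Lemma meas_W eta : measurable_fun setT (W eta).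
Proof. exact: (measurableT_comp (@measurable_powR R q) (meas_normD eta)). Qed.

Lemma meas_sg : measurable_fun setT (@Num.sg R).
Proof.
have -> : @Num.sg R = (fun x => (0 < x)%R%:R - (x < 0)%R%:R).
  by apply/funext => x; rewrite [RHS]/=; case: sgrP => // _; rewrite ?subrr ?subr0 ?sub0r.
by apply: measurable_funB; exact: measurable_ltb.
Qed.

Lemma meas_W1 eta : measurable_fun setT (W1 eta).
Proof.
apply: measurable_funM; last exact: meas_sg.
apply: measurable_funM => //; exact: (measurableT_comp (@measurable_powR R (q - 1)) (meas_normD eta)).
Qed.

Lemma meas_W2 eta : measurable_fun setT (W2 eta).
Proof.
apply: measurable_funM => //; exact: (measurableT_comp (@measurable_powR R (q - 2)) (meas_normD eta)).
Qed.

Lemma qq_ge0 : 0 <= q * (q - 1).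
Proof. by apply: mulr_le0; qlra. Qed.

Lemma W_ge0 eta z : 0 <= W eta z. Proof. exact: powR_ge0. Qed.
Lemma W2_ge0 eta z : 0 <= W2 eta z.
Proof. by rewrite mulr_ge0 ?powR_ge0 ?qq_ge0. Qed.

Lemma WN eta z : W eta (- z) = W eta z. Proof. by rewrite /W normrN. Qed.
Lemma W1N eta z : W1 eta (- z) = - W1 eta z. Proof. by rewrite /W1 normrN sgrN mulrN. Qed.
Lemma W2N eta z : W2 eta (- z) = W2 eta z. Proof. by rewrite /W2 normrN. Qed.

Lemma W_dec e1 e2 z : z != 0 -> 0 <= e1 -> e1 <= e2 -> W e2 z <= W e1 z.
Proof.
move=> z0 e10 e12; apply: powR_le_neg; rewrite ?lerD2l//; first exact: ltW.
by rewrite ltr_pwDl// normr_gt0.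
Qed.

Lemma W2_dec e1 e2 z : z != 0 -> 0 <= e1 -> e1 <= e2 -> W2 e2 z <= W2 e1 z.
Proof.
move=> z0 e10 e12; rewrite ler_wpM2l//; first exact: qq_ge0.
by apply: powR_le_neg; rewrite ?lerD2l//; [qlra|rewrite ltr_pwDl// normr_gt0].
Qed.

Lemma W_bd eta z : 0 < eta -> `|W eta z| <= eta `^ q.
Proof. by move=> e0; rewrite ger0_norm ?W_ge0//; apply: powR_le_neg; rewrite ?lerDr// ltW. Qed.

Lemma W1_bd eta z : 0 < eta -> `|W1 eta z| <= - q * eta `^ (q - 1).
Proof.
move=> e0; rewrite !normrM (ltr0_norm q0) -mulrA ler_wpM2l//; first qlra.
rewrite ger0_norm ?powR_ge0//.
apply: (@le_trans _ _ ((`|z| + eta) `^ (q - 1) * 1)).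
  by rewrite ler_wpM2l ?powR_ge0// normr_sg; case: (_ == _).
by rewrite mulr1; apply: powR_le_neg; rewrite ?lerDr//; qlra.
Qed.

Lemma W1_bd0 eta z : 0 <= eta -> `|W1 eta z| <= - q * `|z| `^ (q - 1).
Proof.
move=> e0; rewrite !normrM (ltr0_norm q0) -mulrA ler_wpM2l//; first qlra.
have [->|z0] := eqVneq z 0; first by rewrite sgr0 normr0 mulr0 powR_ge0.
rewrite normr_sg z0 mulr1 ger0_norm ?powR_ge0//.
by apply: powR_le_neg; rewrite ?lerDl ?normr_gt0//; qlra.
Qed.

Lemma W2_bd eta z : 0 < eta -> `|W2 eta z| <= q * (q - 1) * eta `^ (q - 2).
Proof.
move=> e0; rewrite ger0_norm ?W2_ge0// ler_wpM2l//; first exact: qq_ge0.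
by apply: powR_le_neg; rewrite ?lerDr//; qlra.
Qed.

Lemma W2_bd0 eta z : z != 0 -> 0 <= eta -> `|W2 eta z| <= q * (q - 1) * `|z| `^ (q - 2).
Proof.
move=> z0 e0; rewrite ger0_norm ?W2_ge0// ler_wpM2l//; first exact: qq_ge0.
by apply: powR_le_neg; rewrite ?lerDl ?normr_gt0//; qlra.
Qed.

Lemma W0_bd z : W 0 z <= (`|z| <= 1)%R%:R * `|z| `^ q + 1.
Proof.
rewrite /W addr0; have [z1|z1] := leP `|z| 1; first by rewrite mul1r lerDl.
rewrite mul0r add0r -[leRHS](_ : 1 `^ q = 1); last by rewrite powR1.
by apply: powR_le_neg => //; exact: ltW.
Qed.

Definition eps_ (n : nat) : R := n.+1%:R^-1.
Lemma eps_gt0 n : 0 < eps_ n. Proof. by rewrite invr_gt0 ltr0n. Qed.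

Lemma eps_cvg0 : eps_ n @[n --> \oo] --> (0 : R).
Proof. exact: cvg_harmonic. Qed.

Lemma powR_eps_cvg a z : z != 0 -> (`|z| + eps_ n) `^ a @[n --> \oo] --> (`|z| + 0) `^ a.
Proof.
move=> z0; have z1 : 0 < `|z| + 0 by rewrite addr0 normr_gt0.
have := @continuous_powR R a _ z1.
move=> /continuous_cvg; apply.
by apply: cvgD; [exact: cvg_cst|exact: eps_cvg0].
Qed.

Lemma W_cvg z : z != 0 -> W (eps_ n) z @[n --> \oo] --> W 0 z.
Proof. exact: powR_eps_cvg. Qed.

Lemma W1_cvg z : W1 (eps_ n) z @[n --> \oo] --> W1 0 z.
Proof.
have [->|z0] := eqVneq z 0.
  by rewrite /W1 sgr0 mulr0; under eq_fun do rewrite mulr0; exact: cvg_cst.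
apply: cvgM; last exact: cvg_cst.
by apply: cvgM; [exact: cvg_cst|exact: powR_eps_cvg].
Qed.

Lemma W2_cvg z : z != 0 -> W2 (eps_ n) z @[n --> \oo] --> W2 0 z.
Proof. by move=> z0; apply: cvgM; [exact: cvg_cst|exact: powR_eps_cvg]. Qed.

Lemma is_derive_powD a eta x : 0 < x + eta ->
  is_derive x 1 (fun y : R => (y + eta) `^ a) (a * (x + eta) `^ (a - 1)).
Proof.
move=> x0; have d1 := is_derive1_powR a x0.
have d2 : is_derive x 1 (fun y : R => y + eta) 1.
  have [u v] := is_deriveD (is_derive_id x 1) (is_derive_cst eta x 1).
  by split => //; rewrite v addr0.
have := @is_derive1_comp R (fun y => y `^ a) (fun y => y + eta) x _ _ d1 d2.
by rewrite mulr1.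
Qed.

Lemma W_derive eta z : 0 <= eta -> z != 0 -> is_derive z 1 (W eta) (W1 eta z).
Proof.
move=> e0 z0; apply: (@is_derive_norm R (fun y => (y + eta) `^ q)) => //.
by apply: is_derive_powD; rewrite ltr_pwDl// normr_gt0.
Qed.

(* W1 with its jump at the origin removed. *)
Definition W1c eta z := W1 eta z - q * eta `^ (q - 1) * Num.sg z.

Lemma is_derive_affpow a c d eta x : 0 < x + eta ->
  is_derive x 1 (fun y : R => c * (y + eta) `^ a + d) (c * (a * (x + eta) `^ (a - 1))).
Proof.
move=> x0.
have [u v] := is_deriveD (is_deriveZ c (is_derive_powD a x0)) (is_derive_cst d x 1).
by split => //; rewrite v addr0.
Qed.

Lemma W1c_derive eta z : 0 <= eta -> z != 0 -> is_derive z 1 (W1c eta) (W2 eta z).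
Proof.
move=> e0 z0.
have zp : 0 < `|z| + eta by rewrite ltr_pwDl// normr_gt0.
have W2E : W2 eta z = q * ((q - 1) * (`|z| + eta) `^ (q - 1 - 1)).
  by rewrite /W2 -mulrA; congr (_ * (_ * _ `^ _)); ring.
have [z1|z1|z1] := ltgtP 0 z; last by rewrite -z1 eqxx in z0.
- rewrite gtr0_norm// in zp W2E; rewrite W2E.
  apply: is_derive_near (is_derive_affpow (q - 1) q (- (q * eta `^ (q - 1))) zp).
  near=> y; have y0 : 0 < y by near: y; exact: lt_nbhsr.
  by rewrite /W1c /W1 gtr0_norm// gtr0_sg// !mulr1.
- rewrite ltr0_norm// in zp W2E.
  have dN : is_derive z 1 (-%R : R -> R) (-1) by exact: is_deriveNid.
  have := @is_derive1_comp R _ (-%R : R -> R) z _ _ (is_derive_affpow (q - 1) (- q) (q * eta `^ (q - 1)) zp) dN.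
  rewrite (_ : _ * -1 = W2 eta z); last by rewrite W2E; ring.
  apply: is_derive_near; near=> y; have y0 : y < 0 by near: y; exact: lt_nbhsl.
  by rewrite /W1c /W1 /= ltr0_norm// ltr0_sg//; ring.
Unshelve. all: by end_near. Qed.

Lemma W_lip eta x y : 0 < eta -> `|W eta x - W eta y| <= - q * eta `^ (q - 1) * `|x - y|.
Proof.
move=> e0.
apply: le_trans (powR_lip_neg (ltW q0) e0 _ _) _; rewrite ?lerDr//.
rewrite (_ : `|x| + eta - (`|y| + eta) = `|x| - `|y|); last by ring.
by rewrite ler_wpM2l ?ler_dist_dist// mulr_ge0 ?powR_ge0// oppr_ge0 ltW.
Qed.

(** On one side of the origin this is the Lipschitz bound for the power q - 1. Since [W1c eta]
    vanishes at the origin, points on opposite sides are compared through it, and their distance is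
    the sum of the two absolute values. *)
Lemma W1c_lip eta x y : 0 < eta ->
  `|W1c eta x - W1c eta y| <= q * (q - 1) * eta `^ (q - 2) * `|x - y|.
Proof.
move=> e0; set C := q * (q - 1) * eta `^ (q - 2).
have q2 : q - 1 - 1 = q - 2 by ring.
have C0 : 0 <= C by rewrite mulr_ge0 ?powR_ge0 ?qq_ge0.
have W1cE z : W1c eta z = q * ((`|z| + eta) `^ (q - 1) - eta `^ (q - 1)) * Num.sg z.
  by rewrite /W1c /W1; ring.
have L (a b : R) : 0 <= a -> 0 <= b -> `|q * ((a + eta) `^ (q - 1) - (b + eta) `^ (q - 1))| <= C * `|a - b|.
  move=> a0 b0; rewrite normrM (ltr0_norm q0).
  have := @powR_lip_neg R (q - 1) eta (a + eta) (b + eta) _ e0 _ _.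
  rewrite !lerDr a0 b0 (_ : a + eta - (b + eta) = a - b); last by ring.
  move=> /(_ _ isT isT) H; rewrite /C -q2.
  have {}H := H _; have qq : q - 1 <= 0 by qlra.
  have nq : 0 <= - q by qlra.
  have := ler_wpM2l nq (H qq); qlra.
have L0 (a : R) : `|q * ((`|a| + eta) `^ (q - 1) - eta `^ (q - 1))| <= C * `|a|.
  by have := @L `|a| 0 (normr_ge0 _) (lexx _); rewrite add0r subr0 normr_id.
have B (a : R) : `|W1c eta a| <= C * `|a|.
  rewrite W1cE normrM; apply: (le_trans _ (L0 a)).
  by rewrite ler_piMr// normr_sg; case: (_ != _).
have [xy|xy] := leP 0 (x * y).
- have [x0|x0] := eqVneq x 0.
    by rewrite x0 W1cE sgr0 mulr0 !sub0r !normrN; exact: B.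
  have [y0|y0] := eqVneq y 0.
    by rewrite y0 (W1cE 0) sgr0 mulr0 !subr0; exact: B.
  have sxy : Num.sg x = Num.sg y.
    have xyp : 0 < x * y by rewrite lt_neqAle xy andbT eq_sym mulf_neq0.
    have [xp|xn|xe] := ltgtP 0 x; last by rewrite -xe eqxx in x0.
      by rewrite pmulr_rgt0// in xyp; rewrite !gtr0_sg.
    by rewrite nmulr_rgt0// in xyp; rewrite !ltr0_sg.
  rewrite !W1cE sxy -mulrBl (_ : _ - _ = q * ((`|x| + eta) `^ (q - 1) - (`|y| + eta) `^ (q - 1))); last by ring.
  rewrite normrM normr_sg y0 mulr1; apply: le_trans (L _ _ _ _) _ => //.
  by rewrite ler_wpM2l ?ler_dist_dist.
- apply: le_trans (ler_normB _ _) _.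
  apply: (@le_trans _ _ (C * `|x| + C * `|y|)); first by rewrite lerD// B.
  rewrite -mulrDr ler_wpM2l//.
  have [x0|x0] := leP 0 x.
    have y0n : y < 0 by rewrite ltNge; apply/negP => yge; have := mulr_ge0 x0 yge; rewrite leNgt xy.
    by rewrite (ger0_norm x0) (ltr0_norm y0n) ger0_norm//; qlra.
  have y0n : 0 < y by rewrite ltNge; apply/negP => yle; have := mulr_le0 (ltW x0) yle; rewrite leNgt xy.
  by rewrite (ltr0_norm x0) (gtr0_norm y0n) ltr0_norm//; qlra.
Qed.

(** The tangent at a stays below the kernel only on the half-line of a, hence the sign condition. In
    use, a = x - y and b is the difference of the images of x and y under a nondecreasing map, so
    the condition is the monotonicity of that map. *)
Lemma W_tangent eta a b : 0 < eta -> 0 <= a * b -> (a = 0 -> b = 0) ->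
  W eta a + W1 eta a * (b - a) <= W eta b.
Proof.
move=> e0 ab a0b.
have [a0|a0] := eqVneq a 0; first by rewrite (a0b a0) a0 subrr mulr0 addr0.
rewrite /W /W1.
have -> : q * (`|a| + eta) `^ (q - 1) * Num.sg a * (b - a) =
    q * (`|a| + eta) `^ (q - 1) * ((`|b| + eta) - (`|a| + eta)).
  rewrite -mulrA; congr (_ * _).
  have [a1|a1|a1] := ltgtP 0 a; last by rewrite -a1 eqxx in a0.
    have b1 : 0 <= b by move: ab; rewrite pmulr_rge0.
    by rewrite gtr0_sg// (gtr0_norm a1) (ger0_norm b1); ring.
  have b1 : b <= 0 by move: ab; rewrite nmulr_rge0.
  by rewrite ltr0_sg// (ltr0_norm a1) (ler0_norm b1); ring.
by apply: powR_tangent_neg; [exact: ltW|rewrite ltr_wpDl|rewrite ltr_wpDl].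
Qed.

End Kernel.

(** * Mean value estimates and limits of derivatives *)

Section MeanValue.
Context {R : realType}.
Local Notation mu := (@lebesgue_measure R).
Implicit Types (f g h : R -> R).

Lemma mvt_eq f (f' : R -> R) (a b : R) : a < b ->
  (forall x, a <= x <= b -> is_derive x 1 f (f' x)) ->
  exists2 c, a < c < b & f b - f a = f' c * (b - a).
Proof.
move=> ab df.
have [||c] := @MVT R f f' a b ab.
- by move=> x; rewrite in_itv/= => /andP[? ?]; apply: df; rewrite !ltW.
- apply: continuous_in_subspaceT => x; rewrite inE/= in_itv/= => xab.
  exact: is_derive_continuous (df x xab).
- by rewrite in_itv/=; exists c.
Qed.

Lemma mvt_le f (f' : R -> R) (a b D : R) :
  (forall x, Num.min a b <= x <= Num.max a b -> is_derive x 1 f (f' x)) ->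
  (forall x, Num.min a b <= x <= Num.max a b -> `|f' x| <= D) ->
  `|f b - f a| <= D * `|b - a|.
Proof.
wlog ab : a b / a <= b => [H df fD|].
  have [ab|/ltW ba] := leP a b; first exact: H.
  by rewrite distrC (distrC b); apply: H; rewrite // minC maxC.
rewrite min_l// max_r//; move: ab; rewrite le_eqVlt => /predU1P[->|ab] df fD.
  by rewrite !subrr normr0 mulr0.
have [c /andP[ac cb] ->] := mvt_eq ab df.
by rewrite normrM ler_wpM2r// fD// !ltW.
Qed.

Lemma cont_bounded f (a b : R) : (forall x : R, {for x, continuous f}) ->
  exists D, forall x, a <= x <= b -> `|f x| <= D.
Proof.
move=> cf; have [ab|ba] := leP a b; last first.
  by exists 0 => x /andP[ax xb]; have := le_trans ax xb; rewrite leNgt ba.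
have cn : {within `[a, b], continuous (fun x => `|f x|)}.
  by apply: continuous_subspaceT => x; apply: continuous_comp; [exact: cf|exact: norm_continuous].
have [c _ H] := EVT_max ab cn.
by exists `|f c| => x xab; apply: H; rewrite in_itv.
Qed.

Lemma continuous_meas f : (forall x : R, {for x, continuous f}) -> measurable_fun setT f.
Proof. by move=> cf; apply: continuous_measurable_fun. Qed.

(** The mean value theorem applied to [F m - F n] makes the difference quotients uniformly close in
    the increment; letting m tend to infinity transfers this to f, and one fixed [F N] then controls
    the limit. *)
Lemma unif_derive (F F' : nat -> R -> R) (f g : R -> R) (a b x : R) :
  a < x < b ->
  (forall n y, a < y < b -> is_derive y 1 (F n) (F' n y)) ->
  (forall y, a < y < b -> F n y @[n --> \oo] --> f y) ->
  (forall e, 0 < e -> exists N, forall n, (N <= n)%N -> forall y, a < y < b -> `|F' n y - g y| <= e) ->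
  is_derive x 1 f (g x).
Proof.
move=> xab dF Ff F'g; apply: is_derive_cvg; apply/cvgrPdist_le => e e0.
have e4 : 0 < e / 4 by rewrite divr_gt0.
have [N HN] := F'g _ e4.
have /andP[ax xb] := xab.
have HF m n y z : (N <= m)%N -> (N <= n)%N -> a < y < b -> a < z < b ->
   `|(F m z - F n z) - (F m y - F n y)| <= (e / 2) * `|z - y|.
  move=> Nm Nn yab zab.
  apply: (@mvt_le (fun y => F m y - F n y) (fun y => F' m y - F' n y)) => t tyz.
    have tab : a < t < b by move: tyz; rewrite ge_min le_max; lra.
    exact: is_deriveB (dF _ _ tab) (dF _ _ tab).
  have tab : a < t < b by move: tyz; rewrite ge_min le_max; lra.
  have := HN _ Nm _ tab; have := HN _ Nn _ tab; rewrite !ler_norml; lra.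
have Hf y : a < y < b -> `|(f y - F N y) - (f x - F N x)| <= (e / 2) * `|y - x|.
  move=> yab.
  have cv : `|(F m y - F N y) - (F m x - F N x)| @[m --> \oo] --> `|(f y - F N y) - (f x - F N x)|.
    apply: cvg_norm; apply: cvgB; (apply: cvgB; last exact: cvg_cst); exact: Ff.
  have <- := cvg_lim _ cv => //.
  apply: limr_le; first by apply/cvg_ex; eexists; exact: cv.
  by near=> m; apply: HF => //; near: m; exact: nbhs_infty_ge.
have /cvgrPdist_le/(_ _ e4) H1 := is_derive_cvgP (dF N x xab).
near=> h.
have h0 : h != 0 by near: h; exact: nbhs_dnbhs_neq.
have hab : a < h + x < b.
  have h1 : `|h| < Num.min (x - a) (b - x).
    near: h; apply: dnbhs0_lt; rewrite lt_min !subr_gt0; exact/andP.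
  move: h1; rewrite lt_min !ltr_norml; lra.
have H2 : `|F' N x - h^-1 * (F N (h + x) - F N x)| <= e / 4 by near: h; exact: H1.
have H3 : `|F' N x - g x| <= e / 4 by exact: HN.
have H4 : `|h^-1 * (f (h + x) - f x) - h^-1 * (F N (h + x) - F N x)| <= e / 2.
  rewrite -mulrBr normrM normfV ler_pdivrMl ?normr_gt0// mulrC.
  have := Hf _ hab; rewrite addrK.
  by rewrite (_ : f (h + x) - F N (h + x) - _ = f (h + x) - f x - (F N (h + x) - F N x)); last by ring.
move: H2 H3 H4; rewrite !ler_norml; lra.
Unshelve. all: by end_near. Qed.

(** The error is at most the L1 norm of (k n - k0) h, which tends to 0 and does not involve [Phi].
    In use, [Phi] runs over the symmetrised differences of f at all points of a compact interval. *)
Lemma unif_kernel (k : nat -> R -> R) (k0 g h : R -> R) :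
  (forall n, measurable_fun setT (k n)) -> measurable_fun setT k0 -> measurable_fun setT h ->
  (forall n z, z != 0 -> `|k n z| <= g z) ->
  (forall z, z != 0 -> k n z @[n --> \oo] --> k0 z) ->
  (forall z, 0 <= h z) -> (forall n, Int (fun z => k n z * h z)) -> Int (fun z => g z * h z) ->
  forall e, 0 < e -> exists N, forall n, (N <= n)%N -> forall Phi : R -> R,
    measurable_fun setT Phi -> (forall z, `|Phi z| <= h z) ->
    `|\int[mu]_z (k n z * Phi z) - \int[mu]_z (k0 z * Phi z)| <= e.
Proof.
move=> mk mk0 mh kg kk0 h0 Ikh Igh e e0.
have [] := @int_dct R (fun n z => k n z * h z) (fun z => k0 z * h z) (fun z => g z * h z) => //.
- by move=> n; exact: measurable_funM.
- exact: measurable_funM.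
- apply: ae_imp (ae_neq 0) => z z0; apply: cvgM; [exact: kk0|exact: cvg_cst].
- apply: ae_imp (ae_neq 0) => z z0 n; rewrite normrM (ger0_norm (h0 z)) ler_wpM2r//; exact: kg.
move=> I0 _ /cvgrPdist_le/(_ _ e0)[N _ HN]; exists N => n Nn Phi mPhi Phih.
have IP (k' : R -> R) : measurable_fun setT k' -> Int (fun z => k' z * h z) -> Int (fun z => k' z * Phi z).
  move=> mk' I; apply: (@Int_dom _ _ (fun z => `|k' z * h z|)); [exact: measurable_funM|exact: Int_norm|].
  by move=> z; rewrite !normrM ler_wpM2l// (le_trans (Phih z))// ler_norm.
rewrite -intB; [|exact: IP|exact: IP].
have IB := IntB (IP _ (mk n) (Ikh n)) (IP _ mk0 I0).
apply: le_trans (int_norm IB) _.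
have := HN n Nn; rewrite /= sub0r normrN => H; apply: le_trans (le_trans _ (ler_norm _)) H.
apply: int_le; [exact: Int_norm|exact: Int_norm (IntB (Ikh n) I0)|] => z.
by rewrite -!mulrBl !normrM ler_wpM2l// (le_trans (Phih z))// ler_norm.
Qed.
End MeanValue.

(** * Regularised potentials and their symmetrised derivatives *)

Section Potential.
Context {R : realType}.
Local Notation mu := (@lebesgue_measure R).
Variable q : R.
Context (q0 : q < 0) (q1 : -1 < q).
Local Ltac qlra := (have ? := q0; have ? := q1; lra).
Implicit Types (f g h : R -> R) (eta x y z : R).
Local Notation W := (W q).
Local Notation W1 := (W1 q).
Local Notation W2 := (W2 q).

Definition nice f := [/\ measurable_fun setT f, exists B, forall x, 0 <= f x <= B & Int f].

Definition pot eta f x := \int[mu]_y (W eta (x - y) * f y).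
Definition dpot eta f x := \int[mu]_y (W1 eta (x - y) * f y).
(* W1 0 and W2 0 are not integrable at the origin: the derivatives of [pot 0 f] are symmetrised differences. *)
Definition dpot0 f x := 1 / 2 * \int[mu]_z (W1 0 z * (f (x - z) - f (x + z))).
Definition ddpot0 f x := 1 / 2 * \int[mu]_z (W2 0 z * (f (x - z) + f (x + z) - 2 * f x)).

Lemma meas_sub x : measurable_fun setT (fun y : R => x - y).
Proof. exact: measurable_funB. Qed.

Definition c0 : R := \int[mu]_z ((`|z| <= 1)%R%:R * `|z| `^ q).

Lemma pot0_dom f B x y : (forall x, 0 <= f x <= B) ->
  W 0 (x - y) * f y <= B * ((`|x - y| <= 1)%R%:R * `|x - y| `^ q) + f y.
Proof.
move=> fB; have /andP[f0 fb] := fB y.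
apply: (@le_trans _ _ (((`|x - y| <= 1)%R%:R * `|x - y| `^ q + 1) * f y)).
  by rewrite ler_wpM2r// W0_bd.
rewrite mulrDl mul1r lerD2r mulrC ler_wpM2r// mulr_ge0 ?powR_ge0//.
Qed.

Lemma Int_pot eta f x : 0 <= eta -> nice f -> Int (fun y => W eta (x - y) * f y).
Proof.
move=> e0 [mf [B fB] If].
have mk : measurable_fun setT (fun y => W eta (x - y) * f y).
  by apply: measurable_funM => //; exact: (measurableT_comp (meas_W q eta) (meas_sub x)).
have I0 : Int (fun y => B * ((`|x - y| <= 1)%R%:R * `|x - y| `^ q) + f y).
  by apply: IntD => //; apply: IntZ; exact: (Int_sub x (Int_norm_powR_near0 q1)).
move: e0; rewrite le_eqVlt => /predU1P[<-|e0].
  apply: (Int_dom _ I0).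
    by apply: measurable_funM => //; exact: (measurableT_comp (meas_W q 0) (meas_sub x)).
  move=> y; rewrite ger0_norm ?mulr_ge0 ?W_ge0//; last by case/andP: (fB y).
  exact: pot0_dom.
apply: (@Int_mulb _ _ _ (eta `^ q)) => //.
  exact: (measurableT_comp (meas_W q eta) (meas_sub x)).
by move=> y; exact: W_bd.
Qed.

Lemma pot_ge0 eta f x : (forall x, 0 <= f x) -> 0 <= pot eta f x.
Proof. by move=> f0; apply: int_ge0 => y; rewrite mulr_ge0 ?W_ge0. Qed.

Lemma pot0_bd f B x : nice f -> (forall x, 0 <= f x <= B) ->
  pot 0 f x <= B * c0 + \int[mu]_y f y.
Proof.
move=> nf fB; have [_ _ If] := nf.
have I1 := Int_sub x (Int_norm_powR_near0 q1).
have <- : \int[mu]_y (B * ((`|x - y| <= 1)%R%:R * `|x - y| `^ q) + f y) = B * c0 + \int[mu]_y f y.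
  rewrite intD//; last exact: IntZ.
  by rewrite (intZ B I1); apply: (congr1 (fun t => B * t + _)); exact: (int_sub x (Int_norm_powR_near0 q1)).
apply: int_le; [exact: Int_pot|by apply: IntD => //; exact: IntZ|].
by move=> y; exact: pot0_dom.
Qed.

Lemma pot_le_pot0 eta f x : 0 <= eta -> nice f -> pot eta f x <= pot 0 f x.
Proof.
move=> e0 nf; have [_ [B fB] _] := nf.
apply: int_ae_le; [exact: Int_pot|exact: Int_pot|].
apply: ae_imp (ae_neq x) => y yx; rewrite ler_wpM2r//; first by case/andP: (fB y).
by apply: W_dec => //; rewrite subr_eq0 eq_sym.
Qed.

Lemma pot_cvg f x : nice f -> pot (eps_ n) f x @[n --> \oo] --> pot 0 f x.
Proof.
move=> nf; have [mf [B fB] If] := nf.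
have [] := @int_dct R (fun n y => W (eps_ n) (x - y) * f y) (fun y => W 0 (x - y) * f y)
   (fun y => W 0 (x - y) * f y) => //.
- by move=> n; exact: Int_meas (Int_pot x (ltW (eps_gt0 _)) nf).
- exact: Int_meas (Int_pot x (lexx _) nf).
- apply: ae_imp (ae_neq x) => y yx; apply: cvgM; last exact: cvg_cst.
  by apply: W_cvg; rewrite subr_eq0 eq_sym.
- exact: Int_pot.
- apply: ae_imp (ae_neq x) => y yx n; have /andP[f0 _] := fB y.
  rewrite ger0_norm ?mulr_ge0 ?W_ge0// ler_wpM2r//; apply: W_dec => //.
    by rewrite subr_eq0 eq_sym.
  exact: ltW (eps_gt0 _).
Qed.

Lemma Int_dpot eta f x : 0 < eta -> Int f -> Int (fun y => W1 eta (x - y) * f y).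
Proof.
move=> e0 If; apply: (@Int_mulb _ _ _ (- q * eta `^ (q - 1))) => //.
  exact: (measurableT_comp (meas_W1 q eta) (meas_sub x)).
by move=> y; exact: W1_bd.
Qed.

Lemma Int_ddpot eta f x : 0 < eta -> Int f -> Int (fun y => W2 eta (x - y) * f y).
Proof.
move=> e0 If; apply: (@Int_mulb _ _ _ (q * (q - 1) * eta `^ (q - 2))) => //.
  exact: (measurableT_comp (meas_W2 q eta) (meas_sub x)).
by move=> y; exact: W2_bd.
Qed.

Lemma pot_derive eta f x : 0 < eta -> Int f -> is_derive x 1 (pot eta f) (dpot eta f x).
Proof.
move=> e0 If.
apply: (@conv_derive R (W eta) (W1 eta) f (eta `^ q) (- q * eta `^ (q - 1)) x) => //.
- exact: meas_W.
- exact: meas_W1.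
- by move=> z; exact: W_bd.
- by move=> z; exact: W1_bd.
- by move=> z w; exact: W_lip.
- by move=> z z0; apply: W_derive => //; exact: ltW.
Qed.

Lemma is_derive_primitive f x : Int f -> {for x, continuous f} ->
  is_derive x 1 (fun x => \int[mu]_(y in `]-oo, x]) f y) (f x).
Proof.
move=> If cf.
have x1 : x < x + 1 by rewrite ltrDl.
have If1 : mu.-integrable [set` Interval (BInfty _ true) (BRight (x + 1))] (EFin \o f).
  exact: integrableS If.
have [|d1 d2] := @continuous_FTC1 R f (BInfty _ true) x (x + 1) x1 If1 _ cf; first by rewrite ltNyr.
by split; [exact: d1|rewrite -d2 derive1E].
Qed.

(** Convolution with the sign is, up to constants, a primitive of f. It accounts for the jump of
    [W1 eta] at the origin. *)
Lemma int_sg f x : Int f ->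
  \int[mu]_y (Num.sg (x - y) * f y) = 2 * (\int[mu]_(y in `]-oo, x]) f y) - \int[mu]_y f y.
Proof.
move=> If.
have E : \int[mu]_(y in `]-oo, x]) f y = \int[mu]_y ((y <= x)%R%:R * f y).
  have S : `]-oo, x]%classic = [set y | y <= x] by apply/seteqP; split => y /=; rewrite in_itv.
  by rewrite /Rintegral S integral_bool.
have I1 : Int (fun y => (y <= x)%R%:R * f y) by apply: Int_boolM => //; exact: measurable_leb.
have Isg : Int (fun y => Num.sg (x - y) * f y).
  apply: (@Int_mulb _ _ _ 1) => //; first exact: (measurableT_comp (@meas_sg R) (meas_sub x)).
  by move=> y; rewrite normr_sg; case: (_ != _).
rewrite E -intZ// -intB//; last exact: IntZ.
apply: int_ae_eq => //; first by apply: IntB => //; exact: IntZ.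
apply: ae_imp (ae_neq x) => y yx.
have [yx'|yx'|yx'] := ltgtP y x; last by rewrite yx' eqxx in yx.
- by rewrite gtr0_sg ?subr_gt0// ?mul1r; ring.
- by rewrite ltr0_sg ?subr_lt0// ?mul0r; ring.
Qed.

(** [W1 eta] splits into the Lipschitz part [W1c eta], to which [conv_derive] applies, and a
    multiple of the sign, whose convolution differentiates to the local term. That term diverges as
    eta -> 0 and is compensated only in [ddpot_sym]. *)
Lemma dpot_derive eta f x : 0 < eta -> Int f -> {for x, continuous f} ->
  is_derive x 1 (dpot eta f)
   (2 * q * eta `^ (q - 1) * f x + \int[mu]_y (W2 eta (x - y) * f y)).
Proof.
move=> e0 If cf; set c := q * eta `^ (q - 1).
have mW1c : measurable_fun setT (W1c q eta).
  by apply: measurable_funB; [exact: meas_W1|apply: measurable_funM => //; exact: meas_sg].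
have bW1c z : `|W1c q eta z| <= - q * eta `^ (q - 1) + `|c|.
  apply: le_trans (ler_normB _ _) _; rewrite lerD ?W1_bd// normrM ler_piMr//.
  by rewrite normr_sg; case: (_ != _).
have E : dpot eta f = fun x => (c * (2 * (\int[mu]_(y in `]-oo, x]) f y) - \int[mu]_y f y) +
    \int[mu]_y (W1c q eta (x - y) * f y)).
  apply/funext => t; rewrite /dpot -int_sg//.
  have Isg : Int (fun y => Num.sg (t - y) * f y).
    apply: (@Int_mulb _ _ _ 1) => //; first exact: (measurableT_comp (@meas_sg R) (meas_sub t)).
    by move=> y; rewrite normr_sg; case: (_ != _).
  rewrite -intZ// -intD//; last 2 first.
  - exact: IntZ.
  - by apply: (@Int_mulb _ _ _ (- q * eta `^ (q - 1) + `|c|)) => //; exact: (measurableT_comp mW1c (meas_sub t)).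
  by apply: eq_int => y; rewrite /W1c -/c; ring.
rewrite E.
have d1 : is_derive x 1 (fun x => \int[mu]_y (W1c q eta (x - y) * f y)) (\int[mu]_y (W2 eta (x - y) * f y)).
  apply: (@conv_derive R (W1c q eta) (W2 eta) f (- q * eta `^ (q - 1) + `|c|) (q * (q - 1) * eta `^ (q - 2)) x) => //.
  - exact: meas_W2.
  - by move=> z; exact: W2_bd.
  - by move=> z w; exact: W1c_lip.
  - by move=> z z0; apply: W1c_derive => //; exact: ltW.
have d2 := is_derive_primitive If cf.
have d3 := is_deriveB (is_deriveZ 2 d2) (is_derive_cst (\int[mu]_y f y) x 1).
have [u v] := is_deriveD (is_deriveZ c d3) d1.
split => //; rewrite v /GRing.scale/= subr0 /c; ring.
Qed.

(** Oddness of [W1 eta]. The difference f (x - z) - f (x + z) gains one power of |z|, which makes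
    the limit eta -> 0 absolutely integrable near the origin. *)
Lemma dpot_sym eta f x : 0 < eta -> Int f ->
  dpot eta f x = 1 / 2 * \int[mu]_z (W1 eta z * (f (x - z) - f (x + z))).
Proof.
move=> e0 If.
have I1 := Int_dpot x e0 If.
have E1 : dpot eta f x = \int[mu]_z (W1 eta z * f (x - z)).
  rewrite /dpot -(int_sub x I1); apply: eq_int => z.
  by rewrite (_ : x - (x - z) = z)//; ring.
have J1 : Int (fun z => W1 eta z * f (x - z)).
  by apply: eq_Int (Int_sub x I1) => z; rewrite (_ : x - (x - z) = z)//; ring.
have J2 : Int (fun z => W1 eta z * f (x + z)).
  have := IntZ (-1) (Int_opp J1); apply: eq_Int => z; rewrite W1N opprK; ring.
have E2 : dpot eta f x = - \int[mu]_z (W1 eta z * f (x + z)).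
  rewrite E1 -(int_opp J1) -[RHS]mulN1r -intZ//; apply: eq_int => z.
  by rewrite W1N opprK; ring.
under eq_int do rewrite mulrBr.
rewrite intB//; move: E1 E2; lra.
Qed.

Lemma Int_W2 eta : 0 < eta -> Int (W2 eta).
Proof.
move=> e0.
have I2 : Int (fun z => (`|z| <= 1)%R%:R * `|z| `^ 0 : R) by apply: Int_norm_powR_near0; lra.
have I3 : Int (fun z => (1 < `|z|)%R%:R * `|z| `^ (q - 2) : R) by apply: Int_norm_powR_tail; qlra.
apply: (Int_dom _ (IntD (IntZ (q * (q - 1) * eta `^ (q - 2)) I2) (IntZ (q * (q - 1)) I3))).
  exact: meas_W2.
move=> z; rewrite powRr0 mulr1; have [z1|z1] := leP `|z| 1.
  by rewrite mulr1 mul0r mulr0 addr0; exact: W2_bd.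
rewrite mulr0 add0r mul1r; apply: W2_bd0 => //; last exact: ltW.
by rewrite -normr_gt0 (lt_trans _ z1).
Qed.

(** This value is the opposite of the coefficient of the local term in [dpot_derive], so that term
    can be put under the integral as - 2 f x. *)
Lemma int_W2 eta : 0 < eta -> \int[mu]_z W2 eta z = - 2 * q * eta `^ (q - 1).
Proof.
move=> e0; have I := Int_W2 e0.
have Ip : Int (fun z => (0 < z)%R%:R * W2 eta z) by apply: Int_boolM => //; exact: measurable_ltb.
have In : Int (fun z => (0 < - z)%R%:R * W2 eta z).
  by apply: eq_Int (Int_opp Ip) => z; rewrite W2N.
have -> : \int[mu]_z W2 eta z = \int[mu]_z ((0 < z)%R%:R * W2 eta z + (0 < - z)%R%:R * W2 eta z).
  apply: int_ae_eq => //; first exact: IntD.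
  apply: ae_imp (ae_neq 0) => z z0; rewrite oppr_gt0.
  by have [zp|zp|ze] := ltgtP 0 z; rewrite ?mul0r ?mul1r ?addr0 ?add0r//; rewrite -ze eqxx in z0.
rewrite intD//.
have -> : \int[mu]_z ((0 < - z)%R%:R * W2 eta z) = \int[mu]_z ((0 < z)%R%:R * W2 eta z).
  by rewrite -(int_opp Ip); apply: eq_int => z; rewrite W2N.
have -> : \int[mu]_z ((0 < z)%R%:R * W2 eta z) = - q * eta `^ (q - 1); last by ring.
apply: EFin_inj; rewrite EFin_int// -integral_bool.
have -> : [set x : R | 0 < x] = `]0, +oo[%classic.
  by apply/seteqP; split => x /=; rewrite in_itv/= andbT.
rewrite integral_itv_obnd_cbnd; last by apply/measurable_EFinP; apply: measurable_funTS; exact: meas_W2.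
transitivity (\int[mu]_(x in `[0%R, +oo[) (q * ((q - 1) * (x + eta) `^ (q - 1 - 1)))%:E)%E.
  apply: eq_integral => x; rewrite inE/= in_itv/= andbT => x0.
  by rewrite /W2 ger0_norm// -mulrA; congr (q * ((q - 1) * _ `^ _))%:E; ring.
have -> : - q * eta `^ (q - 1) = 0 - (q * (0 + eta) `^ (q - 1) + 0) by rewrite (_ : 0 + eta = eta) ?add0r// addr0 mulNr.
apply: (@ftc_y R (fun x => q * ((q - 1) * (x + eta) `^ (q - 1 - 1))) (fun x => q * (x + eta) `^ (q - 1) + 0)).
- move=> x x0; rewrite mulrA mulr_ge0 ?powR_ge0//; exact: qq_ge0.
- move=> x x0; have x1 : 0 < x + eta by rewrite ltr_wpDl.
  have := is_derive_continuous (@is_derive_affpow R (q - 1 - 1) (q * (q - 1)) 0 eta x x1).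
  by rewrite (_ : (fun _ => _ + 0) = (fun x => q * ((q - 1) * (x + eta) `^ (q - 1 - 1))))//; apply/funext => y; ring.
- by move=> x x0; apply: is_derive_affpow; rewrite ltr_wpDl.
- rewrite -[X in _ --> X](_ : q * 0 + 0 = 0); last by rewrite mulr0 addr0.
  apply: cvgD; last exact: cvg_cst.
  apply: cvgM; first exact: cvg_cst.
  apply: (@cvg_comp _ _ _ (fun x => x + eta) (fun y => y `^ (q - 1)) _ (@pinfty_nbhs R)).
    apply/cvgryPgt => A; near=> x.
    have : A - eta < x by near: x; apply: nbhs_pinfty_gt; rewrite num_real.
    by rewrite ltrBlDr.
  by apply: powR_cvgy0; qlra.
Unshelve. all: by end_near. Qed.

(** [int_W2] turns the local term into the centre of a second difference. For smooth f this is of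
    order z^2, integrable against |z|^(q-2) near the origin because q > -1. *)
Lemma ddpot_sym eta f x : 0 < eta -> Int f ->
  2 * q * eta `^ (q - 1) * f x + \int[mu]_y (W2 eta (x - y) * f y) =
  1 / 2 * \int[mu]_z (W2 eta z * (f (x - z) + f (x + z) - 2 * f x)).
Proof.
move=> e0 If.
have I1 := Int_ddpot x e0 If.
have E1 : \int[mu]_y (W2 eta (x - y) * f y) = \int[mu]_z (W2 eta z * f (x - z)).
  rewrite -(int_sub x I1); apply: eq_int => z.
  by rewrite (_ : x - (x - z) = z)//; ring.
have J1 : Int (fun z => W2 eta z * f (x - z)).
  by apply: eq_Int (Int_sub x I1) => z; rewrite (_ : x - (x - z) = z)//; ring.
have J2 : Int (fun z => W2 eta z * f (x + z)).
  by apply: eq_Int (Int_opp J1) => z; rewrite W2N opprK.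
have E2 : \int[mu]_z (W2 eta z * f (x + z)) = \int[mu]_z (W2 eta z * f (x - z)).
  by rewrite -(int_opp J1); apply: eq_int => z; rewrite W2N opprK.
have I3 := IntZ (2 * f x) (Int_W2 e0).
rewrite E1 (@eq_int R (fun z => W2 eta z * (f (x - z) + f (x + z) - 2 * f x))
  (fun z => W2 eta z * f (x - z) + W2 eta z * f (x + z) - 2 * f x * W2 eta z)); last first.
  by move=> z; ring.
rewrite intB//; last exact: IntD.
by rewrite intD// E2 (intZ (2 * f x) (Int_W2 e0)) int_W2//; field.
Qed.

End Potential.

(** * Two derivatives of the singular potential *)

Section Regularity.
Context {R : realType}.
Local Notation mu := (@lebesgue_measure R).
Variable q : R.
Context (q0 : q < 0) (q1 : -1 < q).
Local Ltac qlra := (have ? := q0; have ? := q1; lra).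
Implicit Types (eta x y z : R).
Local Notation W := (W q).
Local Notation W1 := (W1 q).
Local Notation W2 := (W2 q).
Local Notation pot := (pot q).
Local Notation dpot := (dpot q).
Local Notation dpot0 := (dpot0 q).
Local Notation ddpot0 := (ddpot0 q).
Variables (f f1 f2 : R -> R).
Hypothesis nf : nice f.
Hypothesis df : forall x, is_derive x 1 f (f1 x).
Hypothesis df1 : forall x, is_derive x 1 f1 (f2 x).
Hypothesis cf2 : forall x, {for x, continuous f2}.

Let cf x : {for x, continuous f}. Proof. exact: is_derive_continuous (df x). Qed.
Let cf1 x : {for x, continuous f1}. Proof. exact: is_derive_continuous (df1 x). Qed.
Let mf : measurable_fun setT f. Proof. by case: nf. Qed.
Let If : Int f. Proof. by case: nf. Qed.

(** Common majorant of the symmetrised differences: the power a = 1 or 2 near the origin comes from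
    local bounds on derivatives, the constant farther out from boundedness of f. *)
Definition cut (A B a : R) z : R := A * ((`|z| <= 1)%R%:R * `|z| `^ a) + B * (1 < `|z|)%R%:R.

Lemma meas_cut A B a : measurable_fun setT (cut A B a).
Proof.
apply: measurable_funD; apply: measurable_funM => //; last exact: measurable_ltb.
apply: measurable_funM; first exact: measurable_leb.
exact: (measurableT_comp (@measurable_powR R a)).
Qed.

Lemma cut_ge0 (A B a : R) z : 0 <= A -> 0 <= B -> 0 <= cut A B a z.
Proof. by move=> A0 B0; rewrite addr_ge0// mulr_ge0// mulr_ge0// powR_ge0. Qed.

Lemma cut_bd (A B a : R) z : 0 <= A -> 0 <= B -> 0 <= a -> `|cut A B a z| <= A + B.
Proof.
move=> A0 B0 a0; rewrite ger0_norm ?cut_ge0// /cut; have [z1|z1] := leP `|z| 1.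
  rewrite mul1r mulr0 addr0 (@le_trans _ _ A) ?lerDl// ler_piMr//.
  rewrite -[leRHS](_ : 1 `^ a = 1); last by rewrite powR1.
  by apply: ge0_ler_powR => //; rewrite nnegrE.
by rewrite mul0r mulr0 add0r mulr1 lerDr.
Qed.

Lemma Int_cut (A B a b : R) : 0 <= A -> 0 <= B -> -1 < a + b -> a + b < 0 -> b < -1 -> 0 < a ->
  Int (fun z => `|z| `^ b * cut A B a z).
Proof.
move=> A0 B0 ab ab0 b1 a0.
apply: eq_Int (IntD (IntZ A (Int_norm_powR_near0 ab)) (IntZ B (Int_norm_powR_tail b1))) => z.
have [->|z0] := eqVneq z 0.
  rewrite /cut normr0 ler01 ltr10 /= !powR0 ?mulr0 ?mul0r ?addr0 ?mulr0//; apply/negP => /eqP; lra.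
rewrite powRD ?normr_eq0 ?z0 ?implybT// /cut; ring.
Qed.

Lemma Phi1_bd (K : R) : exists A B, [/\ 0 <= A, 0 <= B & forall x z, `|x| <= K ->
  `|f (x - z) - f (x + z)| <= cut A B 1 z].
Proof.
have [B fB] : exists B, forall x, 0 <= f x <= B by case: nf.
have [D fD] := @cont_bounded R f1 (- (K + 1)) (K + 1) cf1.
have B0 : 0 <= B by case/andP: (fB 0) => /le_trans h /h.
exists (2 * `|D|), B; split => // x z.
rewrite ler_norml => /andP[xK1 xK2]; rewrite /cut.
have [z1|z1] := leP `|z| 1; last first.
  rewrite mul0r mulr0 add0r mulr1 ler_norml.
  by have := fB (x - z); have := fB (x + z); lra.
rewrite mul1r mulr0 addr0 powRr1// distrC.
have M : `|f (x + z) - f (x - z)| <= `|D| * `|x + z - (x - z)|.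
  apply: (@mvt_le R f f1) => t.
  rewrite ge_min le_max => H; apply: le_trans (ler_norm D); apply: fD.
  by move: z1 H; rewrite ler_norml; lra.
apply: (le_trans M).
by rewrite (_ : x + z - (x - z) = 2 * z) ?normrM ?(@ger0_norm _ 2)//; [lra|ring].
Qed.

(** The mean value theorem is used twice: t -> f (x - t) + f (x + t) has as derivative a difference
    of f1 over a length 2 t, itself bounded through f2. Only |z| <= 1 needs this, hence the interval
    [- (K + 1), K + 1]. *)
Lemma Phi2_bd (K : R) : exists A B, [/\ 0 <= A, 0 <= B & forall x z, `|x| <= K ->
  `|f (x - z) + f (x + z) - 2 * f x| <= cut A B 2 z].
Proof.
have [B fB] : exists B, forall x, 0 <= f x <= B by case: nf.
have [D fD] := @cont_bounded R f2 (- (K + 1)) (K + 1) cf2.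
have B0 : 0 <= B by case/andP: (fB 0) => /le_trans h /h.
exists (2 * `|D|), (2 * B); split => //; [by rewrite mulr_ge0|] => x z.
rewrite ler_norml => /andP[xK1 xK2]; rewrite /cut.
have [z1|z1] := leP `|z| 1; last first.
  rewrite mul0r mulr0 add0r mulr1 ler_norml.
  by have := fB (x - z); have := fB (x + z); have := fB x; lra.
rewrite mul1r mulr0 addr0.
pose g t := f (x - t) + f (x + t).
have g0 : g 0 = 2 * f x by rewrite /g subr0 addr0; ring.
have dg (t : R) : is_derive t 1 g (f1 (x + t) - f1 (x - t)).
  have a1 : is_derive t 1 (fun t => x - t) (-1).
    have [u v] := is_deriveB (is_derive_cst x t 1) (is_derive_id t 1).
    by split => //; rewrite v sub0r.
  have a2 : is_derive t 1 (fun t => x + t) 1.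
    have [u v] := is_deriveD (is_derive_cst x t 1) (is_derive_id t 1).
    by split => //; rewrite v add0r.
  have [u v] := is_deriveD (@is_derive1_comp R f _ t _ _ (df _) a1) (@is_derive1_comp R f _ t _ _ (df _) a2).
  by split => //; rewrite v; ring.
rewrite -/(g z) -g0.
apply: (le_trans (@mvt_le R g _ 0 z (2 * `|D| * `|z|) (fun t _ => dg t) _)).
- move=> t; rewrite ge_min le_max => H.
  have tz : `|t| <= `|z| by case: (ler0P z) H => ?; rewrite ler_norml; lra.
  have M : `|f1 (x + t) - f1 (x - t)| <= `|D| * `|x + t - (x - t)|.
    apply: (@mvt_le R f1 f2) => y.
    rewrite ge_min le_max => H'; apply: le_trans (ler_norm D); apply: fD.
    by move: z1 tz H'; rewrite !ler_norml; lra.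
  apply: (le_trans M).
  rewrite (_ : x + t - (x - t) = 2 * t); last by ring.
  rewrite normrM (@ger0_norm _ 2)//.
  have := ler_wpM2l (normr_ge0 D) tz; lra.
- by rewrite subr0 (powR_mulrn 2)// expr2 !mulrA.
Qed.

Let mPhi1 x : measurable_fun setT (fun z : R => f (x - z) - f (x + z)).
Proof. by apply: measurable_funB; apply: measurableT_comp => //; [exact: measurable_funB|exact: measurable_funD]. Qed.
Let mPhi2 x : measurable_fun setT (fun z : R => f (x - z) + f (x + z) - 2 * f x).
Proof.
apply: measurable_funB => //; apply: measurable_funD; apply: measurableT_comp => //; [exact: measurable_funB|exact: measurable_funD].
Qed.

Lemma dpot_unif (K e : R) : 0 < e -> exists N, forall n, (N <= n)%N -> forall x, `|x| <= K ->
  `|dpot (eps_ n) f x - dpot0 f x| <= e.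
Proof.
move=> e0; have [A [B [A0 B0 H]]] := Phi1_bd K.
have I1 : Int (fun z => - q * `|z| `^ (q - 1) * cut A B 1 z).
  apply: eq_Int (IntZ (- q) (@Int_cut A B 1 (q - 1) A0 B0 _ _ _ _)) => [z||||]; [by rewrite mulrA|qlra|qlra|qlra|by []].
have [|||||||N HN] := @unif_kernel R (fun n => W1 (eps_ n)) (W1 0) (fun z => - q * `|z| `^ (q - 1)) (cut A B 1) _ _ _ _ _ _ _ I1 e e0.
- by move=> n; exact: meas_W1.
- exact: meas_W1.
- exact: meas_cut.
- by move=> n z _; apply: W1_bd0 => //; exact: ltW (eps_gt0 _).
- by move=> z _; exact: W1_cvg.
- by move=> z; exact: cut_ge0.
- move=> n; apply: (Int_dom _ I1); first by apply: measurable_funM; [exact: meas_W1|exact: meas_cut].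
  move=> z; rewrite normrM (ger0_norm (cut_ge0 _ _ A0 B0)) ler_wpM2r ?cut_ge0//.
  by apply: W1_bd0 => //; exact: ltW (eps_gt0 _).
exists N => n Nn x xK; rewrite dpot_sym ?eps_gt0// /(dpot0 _ _) -mulrBr normrM.
rewrite ger0_norm; last lra.
have := HN n Nn _ (mPhi1 x) (fun z => H x z xK); lra.
Qed.

Lemma ddpot_unif (K e : R) : 0 < e -> exists N, forall n, (N <= n)%N -> forall x, `|x| <= K ->
  `|(2 * q * eps_ n `^ (q - 1) * f x + \int[mu]_y (W2 (eps_ n) (x - y) * f y)) - ddpot0 f x| <= e.
Proof.
move=> e0; have [A [B [A0 B0 H]]] := Phi2_bd K.
have I1 : Int (fun z => q * (q - 1) * `|z| `^ (q - 2) * cut A B 2 z).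
  apply: eq_Int (IntZ (q * (q - 1)) (@Int_cut A B 2 (q - 2) A0 B0 _ _ _ _)) => [z||||]; [by rewrite !mulrA|qlra|qlra|qlra|by []].
have [|||||||N HN] := @unif_kernel R (fun n => W2 (eps_ n)) (W2 0) (fun z => q * (q - 1) * `|z| `^ (q - 2)) (cut A B 2) _ _ _ _ _ _ _ I1 e e0.
- by move=> n; exact: meas_W2.
- exact: meas_W2.
- exact: meas_cut.
- by move=> n z z0; apply: W2_bd0 => //; exact: ltW (eps_gt0 _).
- by move=> z; exact: W2_cvg.
- by move=> z; exact: cut_ge0.
- move=> n; have := @Int_mulb R (W2 (eps_ n)) (cut A B 2) (A + B) (meas_cut _ _ _) _ (Int_W2 q0 q1 (eps_gt0 n)).
  by move=> I2; apply: eq_Int (I2 _) => [z|z]; [rewrite mulrC|apply: cut_bd].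
exists N => n Nn x xK; rewrite ddpot_sym ?eps_gt0// /(ddpot0 _ _) -mulrBr normrM.
rewrite ger0_norm; last lra.
have := HN n Nn _ (mPhi2 x) (fun z => H x z xK); lra.
Qed.

Let itv_bd x y : x - 1 < y < x + 1 -> `|y| <= `|x| + 1.
Proof. by move=> yx; rewrite ler_norml; have := ler_norm x; have := ler_norm (- x); rewrite normrN; lra. Qed.

Lemma pot0_derive x : is_derive x 1 (pot 0 f) (dpot0 f x).
Proof.
apply: (@unif_derive R (fun n => pot (eps_ n) f) (fun n => dpot (eps_ n) f) _ _ (x - 1) (x + 1)).
- lra.
- by move=> n y _; apply: pot_derive => //; exact: eps_gt0.
- by move=> y _; exact: pot_cvg.
- move=> e e0; have [N HN] := dpot_unif (`|x| + 1) e0.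
  by exists N => n Nn y /itv_bd; exact: HN.
Qed.

Lemma dpot0_derive x : is_derive x 1 (dpot0 f) (ddpot0 f x).
Proof.
apply: (@unif_derive R (fun n => dpot (eps_ n) f) (fun n x => 2 * q * eps_ n `^ (q - 1) * f x + \int[mu]_y (W2 (eps_ n) (x - y) * f y)) _ _ (x - 1) (x + 1)).
- lra.
- by move=> n y _; apply: dpot_derive => //; exact: eps_gt0.
- move=> y yx; apply/cvgrPdist_le => e e0; have [N HN] := dpot_unif (`|x| + 1) e0.
  by exists N => // n /= Nn; rewrite distrC; apply: HN => //; exact: itv_bd.
- move=> e e0; have [N HN] := ddpot_unif (`|x| + 1) e0.
  by exists N => n Nn y /itv_bd; exact: HN.
Qed.

(* At a maximum the second difference is nonpositive, so replacing W2 0 by the smaller kernel W2 eta only increases the integral. *)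
Lemma ddpot0_max x eta : 0 < eta -> (forall y, f y <= f x) ->
  ddpot0 f x <= 2 * q * eta `^ (q - 1) * f x + q * (q - 1) * eta `^ (q - 2) * \int[mu]_y f y.
Proof.
move=> e0 fx.
have [A [B [A0 B0 H]]] := Phi2_bd `|x|.
have f0 y : 0 <= f y by have [_ [C fC] _] := nf; case/andP: (fC y).
apply: (@le_trans _ _ (2 * q * eta `^ (q - 1) * f x + \int[mu]_y (W2 eta (x - y) * f y))).
  rewrite ddpot_sym//; apply: ler_wpM2l; first lra.
  have Iint e : 0 <= e -> Int (fun z => W2 e z * (f (x - z) + f (x + z) - 2 * f x)).
    have mW : measurable_fun setT (fun z => W2 e z * (f (x - z) + f (x + z) - 2 * f x)).
      by apply: measurable_funM => //; exact: meas_W2.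
    rewrite le_eqVlt => /predU1P[<-|e1].
      have I1 : Int (fun z => q * (q - 1) * (`|z| `^ (q - 2) * cut A B 2 z)).
        by apply: IntZ; apply: Int_cut => //; qlra.
      apply: (Int_dom _ I1) => [|z].
        by apply: measurable_funM => //; exact: meas_W2.
      rewrite normrM mulrA; apply: ler_pM => //; last exact: H.
      have [->|z0] := eqVneq z 0; last exact: W2_bd0.
      by rewrite /(W2 _ _) normr0 addr0 normrM ger0_norm ?qq_ge0// ger0_norm ?powR_ge0.
    have := @Int_mulb R (W2 e) (fun z => f (x - z) + f (x + z) - 2 * f x) (A + B) (mPhi2 x) _ (Int_W2 q0 q1 e1).
    move=> I2; apply: eq_Int (I2 _) => [z|z]; first by rewrite mulrC.
    by apply: le_trans (H x z (lexx _)) _; apply: le_trans (ler_norm _) _; exact: cut_bd.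
  apply: int_ae_le; [exact: Iint|exact: Iint (ltW e0)|].
  apply: ae_imp (ae_neq 0) => z z0; rewrite ler_wnM2r ?W2_dec//; last exact: ltW.
  by have := fx (x - z); have := fx (x + z); lra.
rewrite lerD2l -intZ//; apply: int_le; [exact: Int_ddpot|exact: IntZ|].
move=> y; rewrite ler_wpM2r//; apply: le_trans (ler_norm _) _; exact: W2_bd.
Qed.

End Regularity.

(** * Monotone transport *)

Section Transport.
Context {R : realType}.
Local Notation mu := (@lebesgue_measure R).
Implicit Types (f g h k : R -> R) (x y z : R).

Definition cdf f x := \int[mu]_y ((y <= x)%R%:R * f y).

Lemma Int_cdf f x : Int f -> Int (fun y => (y <= x)%R%:R * f y).
Proof. by move=> If; apply: Int_boolM => //; exact: measurable_leb. Qed.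

Lemma ge0_cdf_le f x y : Int f -> (forall x, 0 <= f x) -> x <= y -> cdf f x <= cdf f y.
Proof.
move=> If f0 xy; apply: int_le; [exact: Int_cdf|exact: Int_cdf|] => z.
rewrite ler_wpM2r//; case: (leP z x) => zx; last by rewrite ler0n.
by rewrite (le_trans zx xy).
Qed.

Lemma cdf_ge0 f x : (forall x, 0 <= f x) -> 0 <= cdf f x.
Proof. by move=> f0; apply: int_ge0 => y; rewrite mulr_ge0. Qed.

Lemma cdf_le f x : Int f -> (forall x, 0 <= f x) -> cdf f x <= \int[mu]_y f y.
Proof.
move=> If f0; apply: int_le => //; first exact: Int_cdf.
by move=> y; rewrite ler_piMl//; case: (y <= x).
Qed.

Lemma meas_cdf f : Int f -> (forall x, 0 <= f x) -> measurable_fun setT (cdf f).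
Proof. by move=> If f0; apply: nondecreasing_measurable => // x y; exact: ge0_cdf_le. Qed.

Lemma int_itv_len (a b : R) : a <= b -> Int (fun z => (a < z <= b)%R%:R : R) /\ \int[mu]_z (a < z <= b)%R%:R = b - a.
Proof.
move=> ab.
have E : (fun z => (a < z <= b)%R%:R : R) = \1_(`]a, b]%classic : set R).
  apply/funext => z; rewrite indicE; congr (_%:R); congr nat_of_bool.
  by apply/idP/idP; rewrite inE/= in_itv.
have I : Int (fun z => (a < z <= b)%R%:R : R).
  by rewrite E /Int; exact: integrable_indic_itv.
split => //; apply: EFin_inj; rewrite EFin_int//.
have -> : (\int[mu]_z ((a < z <= b)%R%:R)%:E = \int[mu]_z (\1_(`]a, b]%classic : set R) z)%:E)%E.
  by apply: eq_integral => z _; rewrite -E.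
transitivity (mu `]a, b]%classic).
  by rewrite integral_indic//; congr (mu _); rewrite setIT.
rewrite lebesgue_measure_itv /= lte_fin; case: ltP => //.
by move=> ba; rewrite (_ : b - a = 0)//; lra.
Qed.

Lemma cdf_lip f B x y : Int f -> (forall x, 0 <= f x <= B) -> x <= y ->
  cdf f y - cdf f x <= B * (y - x).
Proof.
move=> If fB xy; have [I1 E1] := int_itv_len xy.
rewrite -E1 -intZ// -intB; [|exact: Int_cdf|exact: Int_cdf].
apply: int_le; [by apply: IntB; exact: Int_cdf|exact: IntZ|] => z.
have /andP[f0 fb] := fB z; have B0 := le_trans f0 fb.
have [zx|zx] := leP z x; first by rewrite (le_trans zx xy)/= subrr mulr_ge0.
by case: (z <= y); rewrite /= ?mul1r ?mul0r ?mulr1 ?mulr0 ?subr0.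
Qed.

Lemma cdf_cont f B x : Int f -> (forall x, 0 <= f x <= B) -> {for x, continuous (cdf f)}.
Proof.
move=> If fB; have f0 z : 0 <= f z by case/andP: (fB z).
have B0 : 0 <= B by case/andP: (fB 0) => /le_trans H /H.
apply/cvgrPdist_le => e e0; near=> y.
have H : `|x - y| <= e / (B + 1).
  near: y; apply: cvgr_dist_le; first exact: cvg_id.
  by rewrite divr_gt0//; lra.
have {}H : B * `|x - y| <= e.
  apply: (le_trans (ler_wpM2l B0 H)); rewrite mulrA ler_pdivrMr; lra.
have [xy|yx] := leP x y.
  rewrite distrC ger0_norm ?subr_ge0 ?ge0_cdf_le//.
  apply: le_trans (cdf_lip If fB xy) _; apply: le_trans H.
  by rewrite ler_wpM2l// distrC ler_norm.
rewrite ger0_norm ?subr_ge0 ?ge0_cdf_le// ?(ltW yx)//.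
apply: le_trans (cdf_lip If fB (ltW yx)) _; apply: le_trans H.
by rewrite ler_wpM2l// ler_norm.
Unshelve. all: by end_near. Qed.

Lemma cdf_lo f c : Int f -> (forall x, 0 <= f x) -> 0 < c -> exists x, cdf f x < c.
Proof.
move=> If f0 c0; have /cvgrPdist_lt/(_ _ c0)[n _ /(_ n (leqnn n))/=] := tail_cvg If.
rewrite sub0r normrN => H; exists (- n.+1%:R); apply: le_lt_trans H.
apply: le_trans (ler_norm _); apply: int_le; [exact: Int_cdf| |].
  by apply: Int_boolM => //; exact: measurable_ltb.
move=> y; rewrite ler_wpM2r//; have [yn|//] := leP y _.
suff -> : n%:R < `|y| by [].
have n0 : (0 : R) <= n%:R by []. rewrite -natr1 in yn.
by rewrite ler0_norm; lra.
Qed.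

Lemma cdf_hi f c : Int f -> (forall x, 0 <= f x) -> c < \int[mu]_y f y ->
  exists x, c < cdf f x.
Proof.
move=> If f0 c0; have c1 : 0 < \int[mu]_y f y - c by rewrite subr_gt0.
have /cvgrPdist_lt/(_ _ c1)[n _ /(_ n (leqnn n))/=] := tail_cvg If.
rewrite sub0r normrN => H; exists n%:R.
suff : \int[mu]_y f y - cdf f n%:R <= `|\int[mu]_x ((n%:R < `|x|)%R%:R * f x)| by lra.
rewrite -intB//; last exact: Int_cdf.
apply: le_trans (ler_norm _); apply: int_le; [by apply: IntB => //; exact: Int_cdf| |].
  by apply: Int_boolM => //; exact: measurable_ltb.
move=> y; have [yn|yn] := leP y n%:R; first by rewrite mul1r subrr mulr_ge0.
by rewrite (lt_le_trans yn (ler_norm y)) mul0r subr0 mul1r.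
Qed.

(* Under f dx, the distribution function of f is uniformly distributed. *)
Lemma cdf_level f B c : Int f -> (forall x, 0 <= f x <= B) -> 0 <= c <= \int[mu]_y f y ->
  \int[mu]_x ((cdf f x < c)%R%:R * f x) = c.
Proof.
move=> If fB /andP[c0 cM]; have f0 z : 0 <= f z by case/andP: (fB z).
move: c0; rewrite le_eqVlt => /predU1P[<-|c0].
  rewrite (eq_int (g := fun=> 0)) ?int0// => x; rewrite ltNge cdf_ge0// mul0r//.
have [cM'|] := boolP `[< forall x, cdf f x < c >].
  have {}cM' := asboolP _ cM'.
  have Ec : c = \int[mu]_y f y.
    apply/eqP; rewrite eq_le cM leNgt; apply/negP => H.
    by have [x] := cdf_hi If f0 H; rewrite ltNge (ltW (cM' x)).
  by rewrite [RHS]Ec; apply: eq_int => x; rewrite cM' mul1r.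
move=> /asboolPn/existsNP[b /negP]; rewrite -leNgt => bc.
have [a ac] := cdf_lo If f0 c0.
pose S := [set x | c <= cdf f x].
have aS x : S x -> a <= x.
  rewrite /S/= => cx; rewrite leNgt; apply/negP => xa.
  by have := ge0_cdf_le If f0 (ltW xa); lra.
have infS : has_inf S by split; [exists b|exists a => x; exact: aS].
(* t is the leftmost point where the distribution function reaches c. Continuity gives
   [cdf f t = c], and the sublevel set is the half-line below t up to a null set. *)
pose t := inf S.
have tlt x : x < t -> cdf f x < c.
  move=> xt; rewrite ltNge; apply/negP => cx.
  have : t <= x by apply: ge_inf => //; case: infS.
  by rewrite leNgt xt.
have tge : cdf f t <= c.
  have := @cdf_cont f B t If fB => /cvg_at_left_filter ct.
  have <- := cvg_lim _ ct => //.
  apply: limr_le; first by apply/cvg_ex; eexists; exact: ct.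
  by near=> x; apply/ltW/tlt; near: x; exact: nbhs_left_lt.
have tle : c <= cdf f t.
  rewrite leNgt; apply/negP => ct.
  have : \forall x \near t, cdf f x < c.
    by have H := @cdf_cont f B t If fB; exact: (cvgr_lt _ H _ ct).
  move=> [e /= e0 He].
  have [x Sx xe] := inf_adherent e0 infS.
  have tx : t <= x by apply: ge_inf => //; case: infS.
  have : cdf f x < c by apply: He; rewrite /= ltr_distlC; apply/andP; split; rewrite /t in tx *; lra.
  by move: Sx; rewrite /S/=; lra.
have ct : cdf f t = c by apply/eqP; rewrite eq_le tge tle.
rewrite -[RHS]ct /cdf; apply: int_ae_eq.
- by apply: Int_boolM => //; apply: measurable_ltb => //; exact: meas_cdf.
- exact: Int_cdf.
- apply: ae_imp (ae_neq t) => x xt; congr (_%:R * _); congr nat_of_bool.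
  have [xt1|xt1|xt1] := ltgtP x t; last by rewrite xt1 eqxx in xt.
    by rewrite tlt.
  by apply/negbTE; rewrite -leNgt -ct; apply: ge0_cdf_le => //; exact: ltW.
Unshelve. all: by end_near. Qed.

(* For h absolutely continuous, the integral of h o T against f only depends on the distribution function G of T under f dx. *)
Lemma int_transport f T G h h' (L C : R) :
  nice f -> measurable_fun setT T -> measurable_fun setT h -> measurable_fun setT h' ->
  measurable_fun setT G ->
  (forall x, f x != 0 -> - L <= T x <= L) ->
  (forall z, - L < z <= L -> \int[mu]_x ((T x < z)%R%:R * f x) = G z) ->
  (forall z, `|h' z| <= C) ->
  (forall y, - L <= y <= L -> h L - h y = \int[mu]_z ((y < z <= L)%R%:R * h' z)) -> 0 <= L ->
  Int (fun x => f x * h (T x)) /\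
  \int[mu]_x (f x * h (T x)) = h L * (\int[mu]_x f x) - \int[mu]_z ((- L < z <= L)%R%:R * h' z * G z).
Proof.
move=> [mf [B fB] If] mT mh mh' mG fT TG h'C hL L0.
have f0 z : 0 <= f z by case/andP: (fB z).
have LL : - L <= L by lra.
have C0 : 0 <= C := le_trans (normr_ge0 _) (h'C 0).
have [IL EL] := int_itv_len LL.
have mle : measurable_fun setT (fun z : R => (- L < z <= L)%R%:R : R) by exact: Int_meas IL.
(* Writing h (T x) as h L minus the integral of h' over ]T x, L] and exchanging the integrals leaves
   only the mass of { T < z }, that is [G z]. *)
pose k x z := (T x < z)%R%:R * f x * ((- L < z <= L)%R%:R * h' z).
have mlt : meas2 (fun x z => (T x < z)%R%:R : R).
  apply: (@measurable_ltb R _ _ (fun p : R * R => T p.1) (fun p : R * R => p.2)).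
    exact: (measurableT_comp mT measurable_fst).
  exact: measurable_snd.
have mk : meas2 k.
  apply: meas2M; last by apply: meas2_snd; exact: measurable_funM.
  by apply: meas2M => //; exact: meas2_fst.
have kb x z : `|k x z| <= f x * (C * (- L < z <= L)%R%:R).
  rewrite /k !normrM !normr_nat (ger0_norm (f0 x)).
  apply: ler_pM; rewrite ?mulr_ge0//; first by case: (T x < z); rewrite ?mul1r ?mul0r.
  by rewrite mulrC ler_wpM2r.
have Ik1 x : Int (k x).
  apply: (Int_dom _ (IntZ (f x) (IntZ C IL))); first exact: meas2_curry.
  by move=> z; exact: kb.
have Ik2 z : Int (k ^~ z).
  apply: (Int_dom _ (IntZ C If)); first exact: meas2_curry2.
  move=> x; apply: (le_trans (kb x z)); rewrite mulrC ler_wpM2r// ler_piMr//; by case: (_ < _ <= _).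
have Ik3 : Int (fun x => \int[mu]_z `|k x z|).
  apply: (Int_dom _ (IntZ (C * (2 * L)) If)).
    by apply: (@measurable_int2 R (fun x z => `|k x z|)) => //; exact: measurableT_comp.
  move=> x; rewrite ger0_norm; last by apply: int_ge0.
  have -> : C * (2 * L) * f x = \int[mu]_z (f x * (C * (- L < z <= L)%R%:R)).
    by rewrite intZ ?intZ// ?EL; [ring|exact: IntZ].
  by apply: int_le; [exact: Int_norm|exact: IntZ (IntZ _ _)|exact: kb].
have [J1 J2 J3] := fubini_real mk Ik1 Ik2 Ik3.
have E1 x : f x * h (T x) = h L * f x - \int[mu]_z k x z.
  have [fx0|fx0] := eqVneq (f x) 0.
    by rewrite fx0 mul0r mulr0 sub0r (eq_int (g := fun=> 0)) ?int0 ?oppr0// => z; rewrite /k fx0 mulr0 mul0r.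
  have TL := fT x fx0; have := hL _ TL.
  have -> : \int[mu]_z k x z = f x * \int[mu]_z ((T x < z <= L)%R%:R * h' z).
    rewrite -intZ; last first.
      have TL2 : T x <= L by case/andP: TL.
      have [Ix _] := int_itv_len TL2.
      apply: (Int_dom _ (IntZ C Ix)); first by apply: measurable_funM => //; exact: Int_meas Ix.
      by move=> z; rewrite normrM normr_nat mulrC ler_wpM2r.
    apply: eq_int => z; rewrite /k.
    have -> : (T x < z <= L) = (T x < z) && (- L < z <= L).
      have [/= Tz|//] := boolP (T x < z); case/andP: TL => TL1 _; rewrite (le_lt_trans TL1 Tz)//.
    by case: (T x < z); rewrite /= ?mul1r ?mul0r; ring.
  by move=> <-; ring.
have E2 z : \int[mu]_x k x z = (- L < z <= L)%R%:R * h' z * G z.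
  have [zL|zL] := boolP (- L < z <= L); last first.
    by rewrite !mul0r (eq_int (g := fun=> 0)) ?int0// => x; rewrite /k (negbTE zL) mul0r mulr0.
  rewrite -(TG z zL) -intZ; last by apply: Int_boolM => //; exact: measurable_ltb.
  by apply: eq_int => x; rewrite /k zL; ring.
have E3 : (fun x => f x * h (T x)) = (fun x => h L * f x - \int[mu]_z k x z) by apply/funext.
rewrite E3; split; first by apply: IntB => //; exact: IntZ.
rewrite intB//; last exact: IntZ.
by rewrite intZ// J3; congr (_ - _); apply: eq_int => z; exact: E2.
Qed.
End Transport.

Lemma itv_opp_eq (R : realType) (a b z : R) : z != - a -> z != - b ->
  (- b < z <= - a) = (a < - z <= b).
Proof.
move=> za zb; have -> : (- b < z) = (- z <= b) by rewrite lt_neqAle eq_sym zb /= lerNl.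
have -> : (z <= - a) = (a < - z) by rewrite le_eqVlt (negbTE za) /= ltrNr.
by rewrite andbC.
Qed.

(** * The regularised kernel as an integral of its derivative *)

Section KernelFTC.
Context {R : realType}.
Local Notation mu := (@lebesgue_measure R).
Variable q : R.
Context (q0 : q < 0) (q1 : -1 < q).
Implicit Types (eta a b x y z : R).
Local Notation W := (W q).
Local Notation W1 := (W1 q).

Lemma Int_itvW1 eta a b : 0 < eta -> a <= b -> Int (fun z => (a < z <= b)%R%:R * W1 eta z).
Proof.
move=> e0 ab; have [I _] := int_itv_len ab.
have := @Int_mulb R _ (W1 eta) (- q * eta `^ (q - 1)) (meas_W1 q eta) (fun z => @W1_bd R q q0 q1 eta z e0) I.
by apply: eq_Int => z; rewrite mulrC.
Qed.

Lemma W_ftc_pos eta a b : 0 < eta -> 0 <= a -> a <= b ->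
  W eta b - W eta a = \int[mu]_z ((a < z <= b)%R%:R * W1 eta z).
Proof.
move=> e0 a0; rewrite le_eqVlt => /predU1P[<-|ab].
  rewrite subrr (eq_int (g := fun=> 0)) ?int0// => z.
  by rewrite (_ : (a < z <= a) = false) ?mul0r//; apply/negbTE/negP; lra.
apply: EFin_inj; rewrite EFin_int; last exact/Int_itvW1/ltW.
rewrite -(integral_bool (fun z => a < z <= b)).
have -> : [set x : R | a < x <= b] = `]a, b]%classic.
  by apply/seteqP; split => x /=; rewrite in_itv.
transitivity (\int[mu]_(z in `]a, b]) (q * (z + eta) `^ (q - 1))%:E)%E; last first.
  apply: eq_integral => z; rewrite inE/= in_itv/= => /andP[az _].
  have z0 : 0 < z by exact: le_lt_trans az.
  by rewrite /(W1 _ _) gtr0_norm// gtr0_sg// mulr1.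
rewrite integral_itv_obnd_cbnd; last first.
  apply/measurable_EFinP/measurable_funTS; apply: measurable_funM => //.
  by apply: (measurableT_comp (@measurable_powR R (q - 1))); exact: measurable_funD.
rewrite !/(W _ _) (ger0_norm a0) (ger0_norm (le_trans a0 (ltW ab))).
apply/esym; apply: (@ftc_ab R (fun z => q * (z + eta) `^ (q - 1)) (fun z => (z + eta) `^ q)) => //.
- move=> x /andP[ax _]; have x1 : 0 < x + eta by rewrite ltr_wpDl// (le_trans a0).
  have := is_derive_continuous (@is_derive_affpow R (q - 1) q 0 eta x x1).
  by rewrite (_ : (fun _ => _ + 0) = (fun x => q * (x + eta) `^ (q - 1)))//; apply/funext => y; rewrite addr0.
- by move=> x /andP[ax _]; apply: is_derive_powD; rewrite ltr_wpDl// (le_trans a0).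
Qed.

(** Supplies the absolute continuity across the kink that [int_tmap] asks of its test function. The
    negative side is the reflection of the positive one; reflection moves the open end of the
    interval, which costs a null set. *)
Lemma W_ftc eta a b : 0 < eta -> a <= b ->
  W eta b - W eta a = \int[mu]_z ((a < z <= b)%R%:R * W1 eta z).
Proof.
move=> e0 ab.
have neg a' b' : b' <= 0 -> a' <= b' -> W eta b' - W eta a' = \int[mu]_z ((a' < z <= b')%R%:R * W1 eta z).
  move=> b0 ab'.
  have bp : 0 <= - b' by rewrite oppr_ge0.
  have abp : - b' <= - a' by rewrite lerN2.
  have H := W_ftc_pos e0 bp abp.
  rewrite !WN in H.
  rewrite -(int_opp (Int_itvW1 e0 ab')) -[LHS]opprK opprB H -mulN1r -intZ; last exact: Int_itvW1.
  apply: int_ae_eq.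
  - exact/IntZ/Int_itvW1.
  - by apply: (Int_opp (Int_itvW1 e0 ab')).
  apply: ae_imp (ae_and (ae_neq (- a')) (ae_neq (- b'))) => z [za zb].
  rewrite W1N mulrN mulN1r; congr (- (_%:R * _)); congr nat_of_bool.
  by rewrite itv_opp_eq.
have [a0|a0] := leP 0 a; first exact: W_ftc_pos.
have [b0|b0] := leP b 0; first exact: neg.
have -> : W eta b - W eta a = (W eta b - W eta 0) + (W eta 0 - W eta a) by ring.
rewrite (W_ftc_pos e0 (lexx 0) (ltW b0)) (neg a 0 (lexx _) (ltW a0)) -intD; last 2 first.
- exact: Int_itvW1 (ltW _).
- exact: Int_itvW1 (ltW _).
apply: eq_int => z; cbv beta.
have [z0|z0] := leP z 0.
  have -> : (z <= b) = true by lra.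
  by rewrite mul0r add0r.
have -> : (a < z) = true by lra.
by rewrite andbF mul0r addr0.
Qed.
End KernelFTC.

(** * Double integrals against bounded kernels *)

Section Bilinear.
Context {R : realType}.
Local Notation mu := (@lebesgue_measure R).
Implicit Types (f : R -> R) (k : R -> R -> R).
Variable f : R -> R.
Hypothesis nf : nice f.
Let mf : measurable_fun setT f. Proof. by case: nf. Qed.
Let If : Int f. Proof. by case: nf. Qed.
Let f0 x : 0 <= f x. Proof. by case: nf => _ [B fB] _; case/andP: (fB x). Qed.

(** Boundedness is what eta > 0 provides: with f integrable, every exchange of integrals below is
    then automatic. *)
Definition bker k := meas2 k /\ exists C, forall x y, `|k x y| <= C.
Definition dbl k := \int[mu]_x \int[mu]_y (k x y * (f x * f y)).

Lemma dbl_fub k : bker k ->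
  [/\ meas2 (fun x y => k x y * (f x * f y)), forall x, Int (fun y => k x y * (f x * f y)),
   forall y, Int (fun x => k x y * (f x * f y)) & Int (fun x => \int[mu]_y `|k x y * (f x * f y)|)].
Proof.
move=> [mk [C kC]].
have C0 : 0 <= C := le_trans (normr_ge0 _) (kC 0 0).
have m : meas2 (fun x y => k x y * (f x * f y)).
  by apply: meas2M => //; apply: meas2M; [exact: meas2_fst|exact: meas2_snd].
have kb x y : `|k x y * (f x * f y)| <= C * (f x * f y).
  by rewrite normrM (ger0_norm (mulr_ge0 _ _))// ler_wpM2r// mulr_ge0.
split => //.
- move=> x; apply: (Int_dom _ (IntZ (C * f x) If)); first exact: (meas2_curry x m).
  by move=> y; rewrite -mulrA.
- move=> y; apply: (Int_dom _ (IntZ (C * f y) If)); first exact: (meas2_curry2 y m).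
  by move=> x; rewrite -mulrA (mulrC (f y)).
- apply: (Int_dom _ (IntZ (C * \int[mu]_y f y) If)).
    by apply: (@measurable_int2 R (fun x y => `|k x y * (f x * f y)|)) => //; exact: measurableT_comp.
  move=> x; rewrite ger0_norm; last exact: int_ge0.
  have -> : C * (\int[mu]_y f y) * f x = \int[mu]_y (C * f x * f y) by rewrite intZ//; ring.
  apply: int_le; [|exact: IntZ|by move=> y; rewrite -mulrA].
  apply: Int_norm; apply: (Int_dom _ (IntZ (C * f x) If)); first exact: (meas2_curry x m).
  by move=> y; rewrite -mulrA.
Qed.

Lemma Int_dbl k : bker k -> Int (fun x => \int[mu]_y (k x y * (f x * f y))).
Proof. by move=> /dbl_fub[m i1 i2 i3]; have [] := fubini_real m i1 i2 i3. Qed.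

Lemma dbl_le k1 k2 : bker k1 -> bker k2 -> (forall x y, k1 x y <= k2 x y) -> dbl k1 <= dbl k2.
Proof.
move=> b1 b2 k12; apply: int_le; [exact: Int_dbl|exact: Int_dbl|] => x.
have [_ i1 _ _] := dbl_fub b1; have [_ i2 _ _] := dbl_fub b2.
by apply: int_le => // y; rewrite ler_wpM2r// mulr_ge0.
Qed.

Lemma bkerD k1 k2 : bker k1 -> bker k2 -> bker (fun x y => k1 x y + k2 x y).
Proof.
move=> [m1 [C1 H1]] [m2 [C2 H2]]; split; first exact: measurable_funD.
by exists (C1 + C2) => x y; apply: le_trans (ler_normD _ _) _; rewrite lerD.
Qed.

Lemma bkerM k1 k2 : bker k1 -> bker k2 -> bker (fun x y => k1 x y * k2 x y).
Proof.
move=> [m1 [C1 H1]] [m2 [C2 H2]]; split; first exact: measurable_funM.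
by exists (C1 * C2) => x y; rewrite normrM ler_pM.
Qed.

Lemma bkerN k : bker k -> bker (fun x y => - k x y).
Proof.
move=> [m1 [C1 H1]]; split; first exact: measurableT_comp.
by exists C1 => x y; rewrite normrN.
Qed.

Lemma bker_swap k : bker k -> bker (fun x y => k y x).
Proof. by move=> [m1 [C1 H1]]; split; [exact: meas2_swap|exists C1]. Qed.

Lemma bker_fst (h : R -> R) (C : R) : measurable_fun setT h -> (forall x, `|h x| <= C) -> bker (fun x y => h x).
Proof. by move=> mh hC; split; [exact: meas2_fst|exists C]. Qed.

Lemma dblD k1 k2 : bker k1 -> bker k2 -> dbl (fun x y => k1 x y + k2 x y) = dbl k1 + dbl k2.
Proof.
move=> b1 b2; rewrite /dbl -intD; [|exact: Int_dbl|exact: Int_dbl]; apply: eq_int => x.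
have [_ i1 _ _] := dbl_fub b1; have [_ i2 _ _] := dbl_fub b2.
by rewrite -intD//; apply: eq_int => y; ring.
Qed.

Lemma dblN k : bker k -> dbl (fun x y => - k x y) = - dbl k.
Proof.
move=> b1; rewrite -mulN1r /dbl -intZ; last exact: Int_dbl.
apply: eq_int => x.
have [_ i1 _ _] := dbl_fub b1.
by rewrite -intZ//; apply: eq_int => y; ring.
Qed.

Lemma dbl_swap k : bker k -> dbl (fun x y => k y x) = dbl k.
Proof.
move=> b; have [m i1 i2 i3] := dbl_fub b.
have [_ _ E] := fubini_real m i1 i2 i3.
rewrite /dbl E; by apply: eq_int => x; apply: eq_int => y; rewrite (mulrC (f x)).
Qed.

Lemma dblE k : bker k -> dbl k = \int[mu]_x (f x * \int[mu]_y (k x y * f y)).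
Proof.
move=> [mk [C kC]]; apply: eq_int => x; rewrite -intZ.
  by apply: eq_int => y; ring.
by apply: (@Int_mulb _ _ _ C) => //; exact: (meas2_curry x mk).
Qed.

End Bilinear.

(** * The monotone rearrangement of f onto g *)

Section MonotoneMap.
Context {R : realType}.
Local Notation mu := (@lebesgue_measure R).
Variable q : R.
Context (q0 : q < 0) (q1 : -1 < q).
Implicit Types (eta a b x y z : R).
Local Notation W := (W q).
Local Notation W1 := (W1 q).
Local Notation pot := (pot q).
Local Notation dpot := (dpot q).
Variables (f g : R -> R) (L : R).
Hypotheses (nf : nice f) (ng : nice g) (L0 : 0 <= L).
Hypothesis gL : forall y, L < `|y| -> g y = 0.
Hypothesis fg : \int[mu]_x f x = \int[mu]_y g y.

Let mf : measurable_fun setT f. Proof. by case: nf. Qed.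
Let If : Int f. Proof. by case: nf. Qed.
Let f0 x : 0 <= f x. Proof. by case: nf => _ [B fB] _; case/andP: (fB x). Qed.
Let mg : measurable_fun setT g. Proof. by case: ng. Qed.
Let Ig : Int g. Proof. by case: ng. Qed.
Let g0 x : 0 <= g x. Proof. by case: ng => _ [B fB] _; case/andP: (fB x). Qed.

(* Monotone rearrangement of f dx onto g dx; restricting to [-L, L] keeps it bounded. *)
Definition tset x : set R := [set y | - L <= y <= L /\ cdf g y <= cdf f x].
Definition tmap x := sup (tset x).

Lemma cdf_gNL : cdf g (- L) = 0.
Proof.
rewrite /cdf -[RHS](@int0 R); apply: int_ae_eq; [exact: Int_cdf|exact: Int0|].
apply: ae_imp (ae_neq (- L)) => y yL; have [yl|] := leP y (- L); last by rewrite mul0r.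
have {}yl : y < - L by rewrite lt_neqAle yL.
rewrite gL ?mulr0// -normrN (@lt_le_trans _ _ (- y)) ?ler_norm//; lra.
Qed.

Lemma tset_sup x : has_sup (tset x).
Proof.
split; last by exists L => y [/andP[]].
exists (- L); split; first by have := L0; lra.
by rewrite cdf_gNL; exact: cdf_ge0.
Qed.

Lemma tmap_itv x : - L <= tmap x <= L.
Proof.
have [ne ub] := tset_sup x; apply/andP; split; last by apply: ge_sup => // y [/andP[]].
apply: ub_le_sup => //; split; first by have := L0; lra.
by rewrite cdf_gNL; exact: cdf_ge0.
Qed.

Lemma tmap_nd x y : x <= y -> tmap x <= tmap y.
Proof.
move=> xy; apply: ge_sup; first by have [] := tset_sup x.
move=> z [zL zx]; apply: ub_le_sup; first by have [] := tset_sup y.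
by split => //; apply: (le_trans zx); exact: ge0_cdf_le.
Qed.

Lemma meas_tmap : measurable_fun setT tmap.
Proof. by apply: nondecreasing_measurable => // x y; exact: tmap_nd. Qed.

(** From right to left, continuity of [cdf g] gives a point w < z with [cdf f x < cdf g w] still,
    and w bounds the whole set [tset x]; without this room the supremum could equal z. *)
Lemma tmap_lt x z : - L < z <= L -> (tmap x < z) = (cdf f x < cdf g z).
Proof.
move=> /andP[zL1 zL2]; apply/idP/idP => H.
  rewrite ltNge; apply/negP => gz; move: H; rewrite ltNge => /negP; apply.
  apply: ub_le_sup; first by have [] := tset_sup x.
  by split => //; rewrite zL2 ltW.
have [B gB] : exists B, forall x, 0 <= g x <= B by case: ng.
have := @cdf_cont R g B z Ig gB => /cvgrPdist_lt.
move=> /(_ (cdf g z - cdf f x)); rewrite subr_gt0 => /(_ H) [e /= e0 He].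
pose w := Num.max (z - e / 2) (- L).
have wz : w < z by rewrite gt_max zL1 andbT; lra.
have fw : cdf f x < cdf g w.
  have := He w; rewrite /= => /(_ _) h.
  have : `|cdf g z - cdf g w| < cdf g z - cdf f x.
    apply: h; rewrite ger0_norm ?subr_ge0 ?ltW//.
    have : z - e / 2 <= w by rewrite le_max lexx.
    lra.
  by rewrite ger0_norm ?subr_ge0 ?ge0_cdf_le// ?ltW//; lra.
apply: le_lt_trans wz; apply: ge_sup; first by have [] := tset_sup x.
move=> y [_ yx]; rewrite leNgt; apply/negP => wy.
by have := ge0_cdf_le Ig g0 (ltW wy); lra.
Qed.

Lemma tmap_cdf z : - L < z <= L -> \int[mu]_x ((tmap x < z)%R%:R * f x) = cdf g z.
Proof.
move=> zL; have [B fB] : exists B, forall x, 0 <= f x <= B by case: nf.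
have H : 0 <= cdf g z <= \int[mu]_x f x by rewrite cdf_ge0// fg cdf_le.
by rewrite -[RHS](cdf_level If fB H); apply: eq_int => x; rewrite tmap_lt.
Qed.

Lemma id_cdf z : \int[mu]_x ((x < z)%R%:R * g x) = cdf g z.
Proof.
apply: int_ae_eq; [by apply: Int_boolM => //; exact: measurable_ltb|exact: Int_cdf|].
by apply: ae_imp (ae_neq z) => x xz; rewrite le_eqVlt (negbTE xz).
Qed.

(** The map T under f and the identity under g have the same distribution function [cdf g], so
    [int_transport] gives the same value for both. *)
Lemma int_tmap (h h' : R -> R) (C : R) : measurable_fun setT h -> measurable_fun setT h' ->
  (forall z, `|h' z| <= C) ->
  (forall y, - L <= y <= L -> h L - h y = \int[mu]_z ((y < z <= L)%R%:R * h' z)) ->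
  [/\ Int (fun x => f x * h (tmap x)), Int (fun x => g x * h x) &
  \int[mu]_x (f x * h (tmap x)) = \int[mu]_x (g x * h x)].
Proof.
move=> mh mh' h'C hL.
have mG := meas_cdf Ig g0.
have [I1 E1] := int_transport nf meas_tmap mh mh' mG (fun x _ => tmap_itv x) tmap_cdf h'C hL L0.
have gsupp x : g x != 0 -> - L <= x <= L.
  by move=> gx; rewrite -ler_norml leNgt; apply: contra gx => /gL ->.
have [I2 E2] := int_transport ng (@measurable_id _ _ _) mh mh' mG gsupp (fun z _ => id_cdf z) h'C hL L0.
by split => //; rewrite E1 E2 fg.
Qed.

Lemma int_tmap_W eta a : 0 < eta ->
  \int[mu]_y (W eta (a - tmap y) * f y) = pot eta g a.
Proof.
move=> e0.
have [||||_ _ H] := @int_tmap (fun y => W eta (a - y)) (fun z => W1 eta (z - a)) (- q * eta `^ (q - 1)).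
- exact: (measurableT_comp (meas_W q eta) (meas_sub a)).
- by apply: (measurableT_comp (meas_W1 q eta)); exact: measurable_funB.
- by move=> z; apply: W1_bd.
- move=> y /andP[_ yL]; rewrite -WN opprB -(WN _ _ (a - y)) opprB.
  have yL' : y - a <= L - a by rewrite lerD2r.
  rewrite (W_ftc q0 q1 e0 yL') (@int_affine R 1 (- a) _ (oner_neq0 _) (Int_itvW1 q0 q1 e0 yL')).
  rewrite normr1 mul1r; apply: eq_int => z; rewrite mul1r ltrD2r lerD2r.
  by [].
rewrite (eq_int (g := fun y => f y * W eta (a - tmap y))); last by move=> y; rewrite mulrC.
by rewrite H; apply: eq_int => y; rewrite mulrC.
Qed.

Lemma int_tmap_sq : 
  [/\ Int (fun x => f x * tmap x ^+ 2), Int (fun x => g x * x ^+ 2) &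
  \int[mu]_x (f x * tmap x ^+ 2) = \int[mu]_x (g x * x ^+ 2)].
Proof.
have mleb : measurable_fun setT (fun z : R => (`|z| <= L)%R%:R : R) by exact: measurable_leb.
(* The derivative 2 z is cut to [-L, L] because a bound on the whole line is required. *)
apply: (@int_tmap (fun y => y ^+ 2) (fun z => (`|z| <= L)%R%:R * (2 * z)) (2 * L)).
- exact: measurable_funX.
- by apply: measurable_funM => //; exact: measurable_funM.
- move=> z; rewrite normrM normr_nat; have [zL|zL] := leP `|z| L.
    by rewrite mul1r normrM ger0_norm// ler_wpM2l.
  by rewrite mul0r mulr_ge0.
- move=> y /andP[yL1 yL2].
  rewrite (eq_int (g := fun z => (y < z <= L)%R%:R * (2 * z))); last first.
    move=> z; have [/andP[yz zL]|] := boolP (y < z <= L); last by rewrite !mul0r.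
    by rewrite (_ : `|z| <= L) ?mul1r// ler_norml zL andbT; lra.
  move: yL2; rewrite le_eqVlt => /predU1P[->|yL].
    rewrite subrr (eq_int (g := fun=> 0)) ?int0// => z.
    by rewrite (_ : (L < z <= L) = false) ?mul0r//; apply/negbTE/negP; lra.
  have I : Int (fun z => (y < z <= L)%R%:R * (2 * z)).
    have [I _] := int_itv_len (ltW yL).
    apply: (Int_dom _ (IntZ (2 * L) I)).
      by apply: measurable_funM; [exact: Int_meas I|exact: measurable_funM].
    move=> z; rewrite normrM normr_nat mulrC; have [/andP[yz zL]|] := boolP (y < z <= L); last by rewrite !mulr0.
    by rewrite !mulr1 normrM ger0_norm// ler_wpM2l// ler_norml zL andbT; lra.
  apply: EFin_inj; rewrite EFin_int// -(integral_bool (fun z => y < z <= L)).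
  have -> : [set x : R | y < x <= L] = `]y, L]%classic.
    by apply/seteqP; split => x /=; rewrite in_itv.
  rewrite integral_itv_obnd_cbnd; last first.
    by apply/measurable_EFinP/measurable_funTS; exact: measurable_funM.
  apply/esym; apply: (@ftc_ab R (fun z => 2 * z) (fun z => z ^+ 2)) => //.
  + by move=> x _; apply: cvgM; [exact: cvg_cst|exact: cvg_id].
  + move=> x _; have [u v] := is_deriveM (is_derive_id x 1) (is_derive_id x 1).
    by split => //; rewrite v /GRing.scale/= mulr1 mulr_natl.
Qed.

End MonotoneMap.

Section PotEnergy.
Context {R : realType}.
Local Notation mu := (@lebesgue_measure R).
Variable q : R.
Context (q0 : q < 0) (q1 : -1 < q).
Local Ltac qlra := (have ? := q0; have ? := q1; lra).
Implicit Types (f g h : R -> R) (eta a b x y z : R).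
Local Notation W := (W q).
Local Notation pot := (pot q).

Lemma nice_ge0 f x : nice f -> 0 <= f x.
Proof. by case=> _ [B fB] _; case/andP: (fB x). Qed.

Lemma nice_Int f : nice f -> Int f. Proof. by case. Qed.
Lemma nice_meas f : nice f -> measurable_fun setT f. Proof. by case. Qed.

Lemma meas2_W eta : meas2 (fun x y => W eta (x - y)).
Proof. apply: meas2_comp; first exact: meas_W. by apply: meas2B; [exact: meas2_fst|exact: meas2_snd]. Qed.

Lemma meas_pot eta f : nice f -> measurable_fun setT (pot eta f).
Proof.
move=> nf; apply: (@measurable_int2 R (fun x y => W eta (x - y) * f y)).
  by apply: meas2M; [exact: meas2_W|apply: meas2_snd; exact: nice_meas].
by move=> x y; rewrite mulr_ge0 ?W_ge0 ?nice_ge0.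
Qed.

Lemma pot0_bounded f : nice f -> exists2 C, 0 <= C & forall eta x, 0 <= eta -> 0 <= pot eta f x <= C.
Proof.
move=> nf; have [_ [B fB] _] := nf.
exists (B * c0 q + \int[mu]_y f y).
  apply: le_trans (pot0_bd q0 q1 0 nf fB); apply: pot_ge0 => x; exact: nice_ge0.
move=> eta x e0; rewrite pot_ge0 /=; last by move=> y; exact: nice_ge0.
by apply: le_trans (pot_le_pot0 q0 q1 x e0 nf) _; exact: pot0_bd.
Qed.

Lemma Int_fpot f g eta : nice f -> nice g -> 0 <= eta -> Int (fun x => g x * pot eta f x).
Proof.
move=> nf ng e0; have [C C0 fC] := pot0_bounded nf.
have := @Int_mulb R g (pot eta f) C (meas_pot eta nf) _ (nice_Int ng).
move=> H; apply: eq_Int (H _) => [x|x]; first by rewrite mulrC.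
by have /andP[p0 p1] := fC eta x e0; rewrite ger0_norm.
Qed.

Lemma pot_sym f g eta : nice f -> nice g -> 0 <= eta ->
  \int[mu]_x (g x * pot eta f x) = \int[mu]_x (f x * pot eta g x).
Proof.
move=> nf ng e0.
pose k x y := g x * (W eta (x - y) * f y).
have mk : meas2 k.
  apply: meas2M; first by apply: meas2_fst; exact: nice_meas.
  by apply: meas2M; [exact: meas2_W|apply: meas2_snd; exact: nice_meas].
have k0 x y : 0 <= k x y by rewrite !mulr_ge0 ?W_ge0 ?nice_ge0.
have I1 x : Int (k x) by apply: IntZ; exact: Int_pot.
have I2 y : Int (k ^~ y).
  have := IntZ (f y) (Int_pot q0 q1 y e0 ng); apply: eq_Int => x.
  by rewrite /k -(WN q eta (y - x)) opprB; ring.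
have I3 : Int (fun x => \int[mu]_y `|k x y|).
  apply: eq_Int (Int_fpot nf ng e0) => x; rewrite !/(pot _ _ _) -intZ; last exact: Int_pot.
  by apply: eq_int => y; rewrite ger0_norm.
have [_ _ E] := fubini_real mk I1 I2 I3.
transitivity (\int[mu]_x \int[mu]_y k x y).
  by apply: eq_int => x; rewrite !/(pot _ _ _) -intZ//; exact: Int_pot.
rewrite E; apply: eq_int => y; rewrite !/(pot _ _ _) -intZ; last exact: Int_pot.
by apply: eq_int => x; rewrite /k -(WN q eta (y - x)) opprB; ring.
Qed.
End PotEnergy.

Lemma cut_energy_arith (R : realType) (a b p p0 e m t c : R) :
  a + (b - - b) <= p + (m * t + (m * t + e)) -> e <= t * c -> p <= p0 ->
  a + 2 * b <= p0 + t * (2 * m + c).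
Proof. lra. Qed.

(** Completing the square: the defect is one half of f (T + c d)^2. The displacement T - x is paired
    with the velocity c d + x. *)
Lemma hwi_arith (R : realType) (f c d x T : R) : 0 <= f ->
  1 / 2 * (x ^+ 2 * f) <= c * (f * (T - x) * d) + 1 / 2 * (f * T ^+ 2) + 1 / 2 * (f * (c * d + x) ^+ 2).
Proof.
move=> f0; rewrite -subr_ge0.
have -> : c * (f * (T - x) * d) + 1 / 2 * (f * T ^+ 2) + 1 / 2 * (f * (c * d + x) ^+ 2) - 1 / 2 * (x ^+ 2 * f) =
  1 / 2 * (f * (T - x + (c * d + x)) ^+ 2) by field.
by rewrite mulr_ge0// mulr_ge0// sqr_ge0.
Qed.

(** * Energy, dissipation and transport *)

Section HWI.
Context {R : realType}.
Local Notation mu := (@lebesgue_measure R).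
Variable q : R.
Context (q0 : q < 0) (q1 : -1 < q).
Local Ltac qlra := (have ? := q0; have ? := q1; lra).
Implicit Types (eta a b x y z : R).
Local Notation W := (W q).
Local Notation W1 := (W1 q).
Local Notation pot := (pot q).
Local Notation dpot := (dpot q).
Local Notation dpot0 := (dpot0 q).
Variables (f f1 f2 g : R -> R) (L : R).
Hypotheses (nf : nice f) (ng : nice g) (L0 : 0 <= L).
Hypothesis df : forall x, is_derive x 1 f (f1 x).
Hypothesis df1 : forall x, is_derive x 1 f1 (f2 x).
Hypothesis cf2 : forall x, {for x, continuous f2}.
Hypothesis gL : forall y, L < `|y| -> g y = 0.
Hypothesis fg : \int[mu]_x f x = \int[mu]_y g y.

Let If : Int f. Proof. exact: nice_Int. Qed.
Let f0 x : 0 <= f x. Proof. exact: nice_ge0. Qed.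
Let M := \int[mu]_x f x.
Local Notation T := (tmap f g L).

(* The transport is cut off to the identity far out, where no decay of [dpot0 f] is known. *)
Definition tcut (n : nat) x := if `|x| <= n%:R then T x else x.
Definition xi n x := tcut n x - x.
Definition tailm (n : nat) := \int[mu]_x ((n%:R < `|x|)%R%:R * f x).

(** Monotonicity survives the cut because T takes its values in [-L, L], which lies between the two
    far regions |x| > n. *)
Lemma tcut_nd n : L <= n%:R -> {homo tcut n : x y / x <= y}.
Proof.
move=> Ln x y xy; rewrite /tcut.
have [/andP[Tx1 Tx2] /andP[Ty1 Ty2]] := (tmap_itv nf ng L0 gL x, tmap_itv nf ng L0 gL y).
case: ifPn => hx; case: ifPn => hy => //.
- exact: tmap_nd.
- rewrite -ltNge in hy; have [y0|y0] := leP 0 y; last first.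
    by rewrite ltr0_norm// in hy; move: hx; rewrite ler_norml; lra.
  by rewrite ger0_norm// in hy; lra.
- rewrite -ltNge in hx; have [x0|x0] := leP 0 x.
    by rewrite ger0_norm// in hx; move: hy; rewrite ler_norml; lra.
  by rewrite ltr0_norm// in hx; lra.
Qed.

Lemma meas_tcut n : L <= n%:R -> measurable_fun setT (tcut n).
Proof. by move=> Ln; apply: nondecreasing_measurable => // x y; exact: tcut_nd. Qed.

Lemma meas_xi n : L <= n%:R -> measurable_fun setT (xi n).
Proof. by move=> Ln; apply: measurable_funB => //; exact: meas_tcut. Qed.

Lemma xi_bd n x : L <= n%:R -> `|xi n x| <= n%:R + n%:R.
Proof.
move=> Ln; rewrite /xi /tcut; case: ifPn => [xn|_]; last by rewrite subrr normr0 addr_ge0.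
apply: le_trans (ler_normB _ _) _; rewrite lerD//.
by have := tmap_itv nf ng L0 gL x; rewrite ler_norml; lra.
Qed.

Lemma bker_W eta (k : R -> R -> R) : 0 < eta -> meas2 k -> bker (fun x y => W eta (k x y)).
Proof.
move=> e0 mk; split; first exact: (meas2_comp (meas_W q eta) mk).
by exists (eta `^ q) => x y; exact: W_bd.
Qed.

Lemma bker_W1 eta (k : R -> R -> R) : 0 < eta -> meas2 k -> bker (fun x y => W1 eta (k x y)).
Proof.
move=> e0 mk; split; first exact: (meas2_comp (meas_W1 q eta) mk).
by exists (- q * eta `^ (q - 1)) => x y; exact: W1_bd.
Qed.

Lemma meas2_diff (h : R -> R) : measurable_fun setT h -> meas2 (fun x y => h x - h y).
Proof. by move=> mh; apply: meas2B; [exact: meas2_fst|exact: meas2_snd]. Qed.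

Lemma meas_far n : measurable_fun setT (fun x : R => (n%:R < `|x|)%R%:R : R).
Proof. exact: measurable_ltb. Qed.

(** The interaction energy of the image of f under [tcut n] is bounded below by its first variation
    at the identity and above by the energy of g plus terms carried by the mass beyond n. *)
Lemma cut_energy eta n C : 0 < eta -> L + 1 <= n%:R ->
  (forall x, pot 0 f x <= C) ->
  \int[mu]_x (f x * pot eta f x) + 2 * \int[mu]_x (f x * xi n x * dpot eta f x)
  <= \int[mu]_x (g x * pot 0 g x) + tailm n * (2 * M + C).
Proof.
move=> e0 Ln1 fC; have Ln : L <= n%:R by lra.
have mT := meas_tmap nf ng L0 gL.
have mTn := meas_tcut Ln. have mxi := meas_xi Ln.
have bk1 : bker (fun x y => W eta (tcut n x - tcut n y)) by apply: bker_W => //; exact: meas2_diff.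
have bk2 : bker (fun x y => W eta (x - y)) by apply: bker_W => //; apply: meas2_diff; exact: measurable_id.
have bw1 : bker (fun x y => W1 eta (x - y)) by apply: bker_W1 => //; apply: meas2_diff; exact: measurable_id.
have bxi : bker (fun x _ : R => xi n x) by apply: (bker_fst mxi) => x; exact: xi_bd.
have bk3 : bker (fun x y => W1 eta (x - y) * xi n x) by exact: bkerM.
have bk4 : bker (fun x y => W1 eta (x - y) * xi n y) by apply: bkerM => //; exact: (bker_swap bxi).
have bk5 : bker (fun x y => W eta (T x - T y)) by apply: bker_W => //; exact: meas2_diff.
have bk6 : bker (fun x _ : R => (n%:R < `|x|)%R%:R : R).
  by apply: (bker_fst (C := 1)); [exact: meas_far|move=> x; rewrite normr_nat; case: (_ < _)].
have bk7 := bker_swap bk6.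
have bk8 := bkerM bk6 bk2.
have lo : dbl f (fun x y => W eta (x - y) + (W1 eta (x - y) * xi n x + - (W1 eta (x - y) * xi n y))) <=
   dbl f (fun x y => W eta (tcut n x - tcut n y)).
  apply: dbl_le => //; first by apply: bkerD => //; apply: bkerD => //; exact: bkerN.
  move=> x y.
  have -> : W1 eta (x - y) * xi n x + - (W1 eta (x - y) * xi n y) = W1 eta (x - y) * (tcut n x - tcut n y - (x - y)).
    by rewrite /xi; ring.
  apply: W_tangent => //.
    have [xy|/ltW xy] := leP x y.
      by apply: mulr_le0; rewrite subr_le0// tcut_nd.
    by apply: mulr_ge0; rewrite subr_ge0// tcut_nd.
  by move=> /subr0_eq ->; rewrite subrr.
(* If exactly one of the two points is beyond n, the images are at distance at least 1 because n >=
   L + 1, so the kernel is at most 1. If both are, the kernel is unchanged and integrates to at most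
   the tail mass times C. *)
have hi : dbl f (fun x y => W eta (tcut n x - tcut n y)) <=
   dbl f (fun x y => W eta (T x - T y) + ((n%:R < `|x|)%R%:R + ((n%:R < `|y|)%R%:R + (n%:R < `|x|)%R%:R * W eta (x - y)))).
  apply: dbl_le => //; first by do 3 apply: bkerD => //.
  move=> x y.
  have far u v : n%:R < `|v| -> - L <= u <= L -> W eta (u - v) <= 1.
    move=> nv uL; rewrite -[leRHS](_ : 1 `^ q = 1); last by rewrite powR1.
    apply: powR_le_neg => //; first exact: ltW.
    suff : 1 <= `|u - v| by lra.
    rewrite distrC; apply: le_trans (lerB_dist v u).
    suff : `|u| <= L by lra.
    by rewrite ler_norml.
  rewrite /tcut !ltNge.
  have [xn|xn] := boolP (`|x| <= n%:R); have [yn|yn] := boolP (`|y| <= n%:R); rewrite /= ?mul0r ?addr0 ?add0r ?mul1r//.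
  - apply: le_trans (far _ _ _ _) _; [by rewrite ltNge|exact: tmap_itv|].
    by rewrite lerDr W_ge0.
  - rewrite -(WN q eta (x - T y)) opprB.
    have := far (T y) x; rewrite ltNge xn => /(_ isT (tmap_itv nf ng L0 gL y)).
    by have := W_ge0 q eta (T x - T y); have := W_ge0 q eta (x - y); lra.
  - by rewrite !addrA lerDr !addr_ge0// W_ge0.
have := le_trans lo hi.
have E3 : dbl f (fun x y => W1 eta (x - y) * xi n x) = \int[mu]_x (f x * xi n x * dpot eta f x).
  rewrite (dblE nf bk3).
  apply: eq_int => x.
  cbv beta.
  rewrite -mulrA.
  apply: (congr1 (fun t => f x * t)).
  rewrite /(dpot _ _ _) -intZ; last exact: Int_dpot.
  by apply: eq_int => y; ring.
(* Oddness of [W1 eta] under exchange of x and y; together with E3 it produces the factor 2. *)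
have E4 : dbl f (fun x y => W1 eta (x - y) * xi n y) = - \int[mu]_x (f x * xi n x * dpot eta f x).
  rewrite -E3 -(dblN nf bk3) -[RHS](dbl_swap nf (bkerN bk3)).
  apply: eq_int => x; apply: eq_int => y.
  have -> : W1 eta (x - y) = - W1 eta (y - x) by rewrite -W1N opprB.
  by ring.
have E2 : dbl f (fun x y => W eta (x - y)) = \int[mu]_x (f x * pot eta f x) by rewrite dblE.
(* The push-forward is used in one variable at a time: [int_tmap_W] for the inner integral, then
   again for the other variable after exchanging the order. *)
have E5 : dbl f (fun x y => W eta (T x - T y)) = \int[mu]_x (g x * pot eta g x).
  rewrite (dblE nf bk5).
  rewrite (eq_int (g := fun x => f x * pot eta g (T x))); last first.
    by move=> x; rewrite (int_tmap_W q0 q1 nf ng L0 gL fg).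
  pose k x y := f x * (W eta (T x - y) * g y).
  have mk : meas2 k.
    apply: meas2M; first by apply: meas2_fst; exact: nice_meas.
    apply: meas2M; last by apply: meas2_snd; exact: nice_meas.
    apply: (meas2_comp (meas_W q eta)); apply: meas2B; last exact: (meas2_snd (@measurable_id _ _ _)).
    exact: meas2_fst.
  have k0 x y : 0 <= k x y by rewrite !mulr_ge0 ?W_ge0 ?nice_ge0.
  have I1 x : Int (k x) by apply: IntZ; apply: Int_pot => //; exact: ltW.
  have I2 y : Int (k ^~ y).
    have Iy : Int (fun x => W eta (T x - y) * f x).
      apply: (@Int_mulb _ _ _ (eta `^ q)) => //; last by move=> x; exact: W_bd.
      by apply: (measurableT_comp (meas_W q eta)); exact: measurable_funB.
    by apply: eq_Int (IntZ (g y) Iy) => x; rewrite /k; ring.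
  have [C' C'0 gC'] := pot0_bounded q0 q1 ng.
  have mpT : measurable_fun setT (fun x => pot eta g (T x)).
    by apply: (measurableT_comp (meas_pot q eta ng)).
  have I3 : Int (fun x => \int[mu]_y `|k x y|).
    have pb x : `|pot eta g (T x)| <= C'.
      by have /andP[p0 p1] := gC' eta (T x) (ltW e0); rewrite ger0_norm.
    apply: eq_Int (Int_mulb mpT pb If) => x; rewrite mulrC !/(pot _ _ _) -intZ; last by apply: Int_pot => //; exact: ltW.
    by apply: eq_int => y; rewrite ger0_norm.
  have [_ _ E] := fubini_real mk I1 I2 I3.
  transitivity (\int[mu]_x \int[mu]_y k x y).
    by apply: eq_int => x; rewrite !/(pot _ _ _) -intZ//; apply: Int_pot => //; exact: ltW.
  rewrite E; apply: eq_int => y; rewrite -(int_tmap_W q0 q1 nf ng L0 gL fg y e0) -intZ.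
    by apply: eq_int => x; rewrite /k -(WN q eta (y - T x)) opprB; ring.
  apply: (@Int_mulb _ _ _ (eta `^ q)) => //; last by move=> x; exact: W_bd.
  by apply: (measurableT_comp (meas_W q eta)); exact: measurable_funB.
have E6 : dbl f (fun x y => (n%:R < `|x|)%R%:R) = M * tailm n.
  rewrite (dblE nf bk6) -[RHS]intZ; last by apply: Int_boolM => //; exact: meas_far.
  by apply: eq_int => x; rewrite intZ// -/M; ring.
have E7 : dbl f (fun x y => (n%:R < `|y|)%R%:R) = M * tailm n.
  by rewrite -E6 -(dbl_swap nf bk6).
have E8 : dbl f (fun x y => (n%:R < `|x|)%R%:R * W eta (x - y)) <= tailm n * C.
  rewrite (dblE nf bk8) mulrC -intZ; last by apply: Int_boolM => //; exact: meas_far.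
  have Ifar : Int (fun x => (n%:R < `|x|)%R%:R * f x) by apply: Int_boolM => //; exact: meas_far.
  have E x : f x * \int[mu]_y ((n%:R < `|x|)%R%:R * W eta (x - y) * f y) =
      (n%:R < `|x|)%R%:R * (f x * pot eta f x).
    rewrite [RHS]mulrCA !/(pot _ _ _) -[in RHS]intZ; last by apply: Int_pot => //; exact: ltW.
    by apply: (congr1 (fun t => _ * t)); apply: eq_int => y; ring.
  rewrite (eq_int E); apply: int_le.
  - by apply: Int_boolM; [exact: meas_far|apply: Int_fpot => //; exact: ltW].
  - exact: IntZ.
  move=> x; rewrite (_ : C * _ = (n%:R < `|x|)%R%:R * (f x * C)); last by ring.
  do 2 apply: ler_wpM2l => //.
  by apply: le_trans (fC x); apply: pot_le_pot0 => //; exact: ltW.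
rewrite (dblD nf bk2); last by apply: bkerD => //; exact: bkerN.
rewrite (dblD nf bk3 (bkerN bk4)) (dblN nf bk4) E2 E3 E4.
rewrite (dblD nf bk5 (bkerD bk6 (bkerD bk7 bk8))) (dblD nf bk6 (bkerD bk7 bk8)) (dblD nf bk7 bk8).
rewrite E5 E6 E7.
have gg : \int[mu]_x (g x * pot eta g x) <= \int[mu]_x (g x * pot 0 g x).
  apply: int_le; [by apply: Int_fpot => //; exact: ltW|exact: Int_fpot|] => x.
  by rewrite ler_wpM2l ?nice_ge0// pot_le_pot0// ltW.
by move=> H; exact: cut_energy_arith H E8 gg.
Qed.

Let cdp : forall x, {for x, continuous (dpot0 f)}.
Proof. by move=> x; exact: is_derive_continuous (dpot0_derive q0 q1 nf df df1 cf2 x). Qed.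

Let mdp : measurable_fun setT (dpot0 f).
Proof. exact: continuous_meas cdp. Qed.

Lemma Int_near_dpot0 n (h : R -> R) : measurable_fun setT h ->
  (exists C, forall x, `|x| <= n%:R -> `|h x| <= C) ->
  Int (fun x => (`|x| <= n%:R)%R%:R * (f x * h x)).
Proof.
move=> mh [C hC]; apply: (Int_dom _ (IntZ `|C| If)).
  apply: measurable_funM; first exact: measurable_leb.
  by apply: measurable_funM => //; exact: nice_meas.
move=> x; rewrite normrM normr_nat normrM (ger0_norm (f0 x)).
have [xn|xn] := leP `|x| n%:R; last by rewrite mul0r mulr_ge0.
rewrite mul1r mulrC; apply: ler_wpM2r => //.
by apply: (le_trans (hC x xn)); exact: ler_norm.
Qed.

Lemma xi_far n x : n%:R < `|x| -> xi n x = 0.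
Proof. by move=> xn; rewrite /xi /tcut leNgt xn subrr. Qed.

Lemma dpot0_near n : exists C, forall x, `|x| <= n%:R -> `|dpot0 f x| <= C.
Proof.
have [C H] := @cont_bounded R (dpot0 f) (- n%:R) n%:R cdp.
by exists C => x; rewrite ler_norml; exact: H.
Qed.

Lemma Int_fxi n : L <= n%:R -> Int (fun x => f x * xi n x).
Proof.
move=> Ln; have := @Int_mulb R f (xi n) _ (meas_xi Ln) (fun x => xi_bd x Ln) If.
by apply: eq_Int => x; rewrite mulrC.
Qed.

Lemma Int_fxi_dpot0 n : L <= n%:R -> Int (fun x => f x * xi n x * dpot0 f x).
Proof.
move=> Ln; have [C H] := dpot0_near n.
have mh : measurable_fun setT (fun x => xi n x * dpot0 f x) by apply: measurable_funM => //; exact: meas_xi.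
have bh : exists C, forall x, `|x| <= n%:R -> `|xi n x * dpot0 f x| <= C.
  by exists ((n%:R + n%:R) * C) => x xn; rewrite normrM ler_pM// ?xi_bd ?H.
apply: eq_Int (Int_near_dpot0 mh bh) => x.
have [xn|xn] := leP `|x| n%:R; first by rewrite mul1r mulrA.
by rewrite xi_far// mulr0 !mul0r.
Qed.

(** The limit eta -> 0 of [cut_energy]. It is possible because [xi n] vanishes beyond n, and on
    [-n, n] the regularised derivatives converge uniformly. *)
Lemma cut_energy0 n C : L + 1 <= n%:R -> (forall x, pot 0 f x <= C) ->
  \int[mu]_x (f x * pot 0 f x) + 2 * \int[mu]_x (f x * xi n x * dpot0 f x)
  <= \int[mu]_x (g x * pot 0 g x) + tailm n * (2 * M + C).
Proof.
move=> Ln1 fC; have Ln : L <= n%:R by lra.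
set RHS := \int[mu]_x (g x * pot 0 g x) + _.
set B := \int[mu]_x (f x * xi n x * dpot0 f x).
set K := \int[mu]_x `|f x * xi n x|.
have K0 : 0 <= K by apply: int_ge0.
have IK : Int (fun x => `|f x * xi n x|) by exact: Int_norm (Int_fxi Ln).
apply/ler_addgt0Pr => e e0.
have e1 : 0 < e / (2 * K + 1) by rewrite divr_gt0//; lra.
have [N HN] := dpot_unif q0 q1 nf df df1 n%:R e1.
have step m : (N <= m)%N -> \int[mu]_x (f x * pot (eps_ m) f x) <= RHS + e - 2 * B.
  move=> Nm; have := cut_energy (eps_gt0 m) Ln1 fC; rewrite -/RHS.
  have Id : Int (fun x => f x * xi n x * dpot (eps_ m) f x).
    have bd x : `|dpot (eps_ m) f x| <= - q * eps_ m `^ (q - 1) * M.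
      apply: le_trans (int_norm (Int_dpot q0 q1 x (eps_gt0 m) If)) _.
      rewrite /M -intZ//; apply: int_le; [exact: Int_norm (Int_dpot q0 q1 x (eps_gt0 m) If)|exact: IntZ|].
      by move=> y; rewrite normrM (ger0_norm (f0 y)) ler_wpM2r// W1_bd// eps_gt0.
    have md : measurable_fun setT (dpot (eps_ m) f).
      apply: continuous_meas => x; apply: is_derive_continuous (dpot_derive q0 q1 (eps_gt0 m) If _).
      exact: is_derive_continuous (df x).
    have := @Int_mulb R _ (dpot (eps_ m) f) _ md bd (Int_fxi Ln).
    by apply: eq_Int => x; rewrite mulrC.
  suff : `|\int[mu]_x (f x * xi n x * dpot (eps_ m) f x) - B| <= e / (2 * K + 1) * K.
    have : e / (2 * K + 1) * K * 2 <= e by rewrite -mulrA mulrAC ler_pdivrMr; nra.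
    rewrite ler_norml; lra.
  rewrite /B -intB//; last exact: Int_fxi_dpot0.
  apply: le_trans (int_norm (IntB Id (Int_fxi_dpot0 Ln))) _.
  rewrite /K -intZ//; apply: int_le; [exact: Int_norm (IntB Id (Int_fxi_dpot0 Ln))|exact: IntZ|].
  move=> x; rewrite -mulrBr normrM mulrC.
  have [xn|xn] := leP `|x| n%:R; last by rewrite xi_far// mulr0 normr0 !mulr0.
  by rewrite ler_wpM2r// HN.
have cv : \int[mu]_x (f x * pot (eps_ m) f x) @[m --> \oo] --> \int[mu]_x (f x * pot 0 f x).
  have [C' C'0 fC'] := pot0_bounded q0 q1 nf.
  have [] := @int_dct R (fun m x => f x * pot (eps_ m) f x) (fun x => f x * pot 0 f x) (fun x => C' * f x) => //.
  - by move=> m; apply: Int_meas; apply: Int_fpot => //; exact: ltW (eps_gt0 _).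
  - by apply: Int_meas; apply: Int_fpot.
  - apply: ae_all => x; apply: cvgM; [exact: cvg_cst|exact: pot_cvg].
  - exact: IntZ.
  - apply: ae_all => x m; have /andP[p0 p1] := fC' (eps_ m) x (ltW (eps_gt0 m)).
    by rewrite normrM (ger0_norm (f0 x)) (ger0_norm p0) mulrC ler_wpM2r.
suff : \int[mu]_x (f x * pot 0 f x) <= RHS + e - 2 * B by lra.
have <- := cvg_lim _ cv => //.
apply: limr_le; first by apply/cvg_ex; eexists; exact: cv.
by near=> m; apply: step; near: m; exact: nbhs_infty_ge.
Unshelve. all: by end_near. Qed.

Variable c : R.
Hypothesis c_ge0 : 0 <= c.
Hypothesis Ix2 : Int (fun x => x ^+ 2 * f x).
Hypothesis Idiss : Int (fun x => f x * (c * dpot0 f x + x) ^+ 2).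

(** [cut_energy0] bounds the interaction part and [hwi_arith], integrated, the quadratic part.
    Beyond n the displacement is zero, so the second moment of f appears truncated; [trunc_cvg] and
    [tail_cvg] then let n tend to infinity. *)
Theorem hwi :
  c / 2 * \int[mu]_x (f x * pot 0 f x) + 1 / 2 * \int[mu]_x (x ^+ 2 * f x)
    - 1 / 2 * \int[mu]_x (f x * (c * dpot0 f x + x) ^+ 2)
  <= c / 2 * \int[mu]_x (g x * pot 0 g x) + 1 / 2 * \int[mu]_x (x ^+ 2 * g x).
Proof.
have [C C0 fC'] := pot0_bounded q0 q1 nf.
have fC x : pot 0 f x <= C by case/andP: (fC' 0 x (lexx _)).
have [IT Ig2 ET] := int_tmap_sq nf ng L0 gL fg.
set Ef := \int[mu]_x (f x * pot 0 f x); set Eg := \int[mu]_x (g x * pot 0 g x).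
set D := \int[mu]_x (f x * (c * dpot0 f x + x) ^+ 2).
have Eg2 : \int[mu]_x (x ^+ 2 * g x) = \int[mu]_x (f x * T x ^+ 2).
  by rewrite ET; apply: eq_int => x; rewrite mulrC.
have step n : L + 1 <= n%:R ->
  c / 2 * Ef + 1 / 2 * \int[mu]_x ((`|x| <= n%:R)%R%:R * (x ^+ 2 * f x)) - 1 / 2 * D <=
  c / 2 * Eg + 1 / 2 * \int[mu]_x (x ^+ 2 * g x) + c / 2 * (tailm n * (2 * M + C)).
  move=> Ln1; have Ln : L <= n%:R by lra.
  have H := cut_energy0 Ln1 fC; rewrite -/Ef -/Eg in H.
  have {}H := ler_wpM2l (divr_ge0 c_ge0 (ler0n R 2)) H.
  set Y := \int[mu]_x (f x * xi n x * dpot0 f x) in H.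
  suff : 1 / 2 * \int[mu]_x ((`|x| <= n%:R)%R%:R * (x ^+ 2 * f x)) <=
     c * Y + 1 / 2 * \int[mu]_x (f x * T x ^+ 2) + 1 / 2 * D by rewrite Eg2; lra.
  have I1 := IntZ c (Int_fxi_dpot0 Ln).
  have I2 := IntZ (1 / 2) IT.
  have I3 := IntZ (1 / 2) Idiss.
  have I4 : Int (fun x => (`|x| <= n%:R)%R%:R * (x ^+ 2 * f x)) by apply: Int_boolM => //; exact: measurable_leb.
  rewrite -!intZ//; last exact: Int_fxi_dpot0.
  rewrite -intD// -intD//; last exact: IntD.
  apply: int_le; [exact: IntZ|by apply: IntD => //; exact: IntD|] => x.
  have [xn|xn] := leP `|x| n%:R; last first.
    rewrite mul0r mulr0 xi_far// mulr0 mul0r mulr0 add0r.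
    by rewrite addr_ge0// mulr_ge0// mulr_ge0// sqr_ge0.
  rewrite /xi /tcut xn (_ : true%:R * _ = x ^+ 2 * f x); last by rewrite mul1r.
  exact: (hwi_arith _ _ _ _ (f0 x)).
have cvL : c / 2 * Ef + 1 / 2 * \int[mu]_x ((`|x| <= n%:R)%R%:R * (x ^+ 2 * f x)) - 1 / 2 * D @[n --> \oo] -->
    c / 2 * Ef + 1 / 2 * \int[mu]_x (x ^+ 2 * f x) - 1 / 2 * D.
  apply: cvgB; last exact: cvg_cst.
  apply: cvgD; first exact: cvg_cst.
  by apply: cvgM; [exact: cvg_cst|exact: trunc_cvg].
have cvR : c / 2 * Eg + 1 / 2 * \int[mu]_x (x ^+ 2 * g x) + c / 2 * (tailm n * (2 * M + C)) @[n --> \oo] -->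
    c / 2 * Eg + 1 / 2 * \int[mu]_x (x ^+ 2 * g x).
  rewrite -[X in _ --> X]addr0; apply: cvgD; first exact: cvg_cst.
  rewrite -(mulr0 (c / 2)); apply: cvgM; first exact: cvg_cst.
  rewrite -(mul0r (2 * M + C)); apply: cvgM; last exact: cvg_cst.
  exact: tail_cvg.
apply: (ler_cvg_to cvL cvR).
near=> n; apply: step; near: n; exact: nbhs_infty_ger.
Unshelve. all: by end_near. Qed.

End HWI.

(** * Minimal energy at given mass *)

Section Minimum.
Context {R : realType}.
Local Notation mu := (@lebesgue_measure R).
Variables (q c : R).
Context (q0 : q < 0) (q1 : -1 < q) (c_ge0 : 0 <= c).
Local Ltac qlra := (have ? := q0; have ? := q1; lra).
Implicit Types (f g h : R -> R) (a b x y z L : R).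
Local Notation W := (W q).
Local Notation pot := (pot q).

Definition Ent f : R := c / 2 * \int[mu]_x (f x * pot 0 f x) + 1 / 2 * \int[mu]_x (x ^+ 2 * f x).

(** Competitors are compactly supported so that the transport map onto them is bounded. *)
Definition adm f := nice f /\ exists2 L, 0 <= L & forall y, L < `|y| -> f y = 0.

Lemma Ent_ge0 f : (forall x, 0 <= f x) -> 0 <= Ent f.
Proof.
move=> f0; apply: addr_ge0; apply: mulr_ge0.
- by apply: divr_ge0.
- by apply: int_ge0 => x; rewrite mulr_ge0// pot_ge0.
- by apply: divr_ge0.
- by apply: int_ge0 => x; rewrite mulr_ge0// sqr_ge0.
Qed.

Lemma meas_sq : measurable_fun setT (fun x : R => x ^+ 2).
Proof. exact: measurable_funX. Qed.

Lemma adm_sq f : adm f -> Int (fun x => x ^+ 2 * f x).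
Proof.
move=> [nf [L L0 fL]]; apply: (Int_dom _ (IntZ (L ^+ 2) (nice_Int nf))).
  by apply: measurable_funM; [exact: meas_sq|exact: nice_meas].
move=> x; rewrite normrM (ger0_norm (nice_ge0 x nf)) ger0_norm ?sqr_ge0//.
have [xL|xL] := leP `|x| L; last by rewrite fL// !mulr0.
by rewrite ler_wpM2r ?nice_ge0// -(real_normK (num_real x)) lerXn2r ?nnegrE.
Qed.

(* By dilation, the minimal energy at mass m is proportional to [m `^ p_exp]. *)
Definition p_exp := (4 - q) / (2 - q).

Lemma W_scale k z : 0 < k -> W 0 z = k `^ (- q) * W 0 (k * z).
Proof.
move=> k0; rewrite !/(W _ _) !addr0 normrM (gtr0_norm k0) powRM ?(ltW k0)//.
by rewrite mulrA -powRD ?addNr ?powRr0 ?mul1r// (gt_eqF k0) implybT.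
Qed.

Lemma nice_scale f a k : nice f -> 0 <= a -> 0 < k -> nice (fun x => a * f (k * x)).
Proof.
move=> [mf [B fB] If] a0 k0.
have I : Int (fun x => a * f (k * x)).
  apply: IntZ; have := @Int_affine R k 0 f (lt0r_neq0 k0) If.
  by apply: eq_Int => x; rewrite addr0.
split => //; first exact: Int_meas.
exists (a * B) => x; have /andP[f0 f1] := fB (k * x).
by rewrite mulr_ge0//= ler_wpM2l.
Qed.

Lemma int_scale f k : 0 < k -> Int f -> \int[mu]_x f (k * x) = k^-1 * \int[mu]_x f x.
Proof.
move=> k0 If; rewrite (@int_affine R k 0 f (lt0r_neq0 k0) If) gtr0_norm// mulrA mulVf ?gt_eqF// mul1r.
by apply: eq_int => x; rewrite addr0.
Qed.

Lemma pot_scale f a k x : nice f -> 0 <= a -> 0 < k ->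
  pot 0 (fun x => a * f (k * x)) x = a * k `^ (- q) / k * pot 0 f (k * x).
Proof.
move=> nf a0 k0; rewrite !/(pot _ _ _).
have I := Int_pot q0 q1 (k * x) (lexx 0) nf.
have I2 : Int (fun y => W 0 (k * x - k * y) * f (k * y)).
  have := @Int_affine R k 0 _ (lt0r_neq0 k0) I.
  by apply: eq_Int => y; rewrite addr0.
rewrite -mulrA -(int_scale k0 I) -intZ//; apply: eq_int => y.
by rewrite (W_scale (x - y) k0) mulrBr; ring.
Qed.

(** The amplitude [k ^ (q - 1)] is the one for which the interaction energy and the second moment
    scale by the same power q - 4. The mass scales by q - 2, and eliminating k leaves the exponent
    [p_exp]. *)
Lemma Ent_scale f k : adm f -> 0 < k ->
  [/\ adm (fun x => k `^ (q - 1) * f (k * x)),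
    \int[mu]_x (k `^ (q - 1) * f (k * x)) = k `^ (q - 2) * \int[mu]_x f x &
    Ent (fun x => k `^ (q - 1) * f (k * x)) = k `^ (q - 4) * Ent f].
Proof.
move=> af k0; have [nf [L L0 fL]] := af.
have k1 := lt0r_neq0 k0.
have Ifk : Int (fun x => f (k * x)).
  by have := @Int_affine R k 0 f k1 (nice_Int nf); apply: eq_Int => x; rewrite addr0.
have pk (n : nat) r : k `^ (r - n%:R) = k `^ r / k ^+ n.
  by rewrite powRB ?k1 ?implybT// powR_mulrn// ltW.
split.
- split; first by apply: nice_scale => //; exact: powR_ge0.
  exists (L / k); first by rewrite divr_ge0// ltW.
  move=> y; rewrite ltr_pdivrMr// => Ly; rewrite fL ?mulr0//.
  by rewrite normrM (gtr0_norm k0) mulrC.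
- rewrite intZ// int_scale//; last exact: nice_Int.
  by rewrite (pk 1%N) (pk 2%N); field.
- rewrite /Ent mulrDr; congr (_ + _).
    have I3 := Int_fpot q0 q1 nf nf (lexx 0).
    rewrite (eq_int (g := fun x => k `^ (q - 1) * (k `^ (q - 1) * k `^ (- q) / k) * (f (k * x) * pot 0 f (k * x)))); last first.
      by move=> x; rewrite pot_scale ?powR_ge0//; ring.
    rewrite intZ; last first.
      have := @Int_affine R k 0 _ k1 I3; apply: eq_Int => x; by rewrite addr0.
    rewrite (int_scale k0 I3) (pk 1%N) (pk 4%N) powRN; field.
    by rewrite k1 powR_eq0 (negbTE k1).
  rewrite (eq_int (g := fun x => k `^ (q - 1) * (k ^- 2) * ((k * x) ^+ 2 * f (k * x)))); last first.
    by move=> x; field.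
  have I2 := adm_sq af.
  rewrite intZ; last first.
    by have := @Int_affine R k 0 _ k1 I2; apply: eq_Int => x; rewrite addr0.
  rewrite (int_scale k0 I2) (pk 1%N) (pk 4%N); by field.
Qed.

Lemma Ent_rescale f m M : adm f -> \int[mu]_x f x = m -> 0 < m -> 0 < M ->
  exists g, [/\ adm g, \int[mu]_x g x = M & Ent g = (M / m) `^ p_exp * Ent f].
Proof.
move=> af fm m0 M0; have Mm : 0 < M / m by rewrite divr_gt0.
pose k := (M / m) `^ (q - 2)^-1.
have k0 : 0 < k by exact: powR_gt0.
have q2 : q - 2 != 0 by apply/negP => /eqP; qlra.
have [a1 a2 a3] := Ent_scale af k0.
exists (fun x => k `^ (q - 1) * f (k * x)); split => //.
- by rewrite a2 fm /k -powRrM mulVf// powRr1 ?ltW// -mulrA mulVf ?mulr1// gt_eqF.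
- rewrite a3 /k -powRrM; congr (_ `^ _ * _); rewrite /p_exp; field.
  by rewrite q2 -opprB oppr_eq0 q2.
Qed.

Definition unit_energies : set R :=
  [set e | exists f, [/\ adm f, \int[mu]_x f x = 1 & e = Ent f]].

Definition ment := inf unit_energies.

Lemma unit_energies_inf : has_inf unit_energies.
Proof.
split; last by exists 0 => _ [f [[nf _] _ ->]]; apply: Ent_ge0 => x; exact: nice_ge0.
have [I E] := @int_itv_len R 0 1 ler01.
exists (Ent (fun z => (0 < z <= 1)%R%:R)), (fun z => (0 < z <= 1)%R%:R); split => //; last by rewrite E subr0.
split; first by split; [exact: Int_meas|exists 1 => x; case: (_ < _ <= _); rewrite ?lexx ler01|].
exists 1 => // y y1; rewrite (_ : (0 < y <= 1) = false)//; apply/negbTE/negP => /andP[y0 yl].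
by move: y1; rewrite gtr0_norm// ltNge yl.
Qed.

Lemma ment_ge0 : 0 <= ment.
Proof.
apply: lb_le_inf; first by case: unit_energies_inf.
by move=> _ [f [[nf _] _ ->]]; apply: Ent_ge0 => x; exact: nice_ge0.
Qed.

Lemma p_exp_gt1 : 1 < p_exp.
Proof. by rewrite /p_exp ltr_pdivlMr; qlra. Qed.

Lemma ment_adm f : adm f -> ment * (\int[mu]_x f x) `^ p_exp <= Ent f.
Proof.
move=> af; have [nf _] := af; set m := \int[mu]_x f x.
have : 0 <= m by apply: int_ge0 => x; exact: nice_ge0.
rewrite le_eqVlt => /predU1P[<-|m0].
  rewrite powR0; last by apply/negP => /eqP; have := p_exp_gt1; lra.
  by rewrite mulr0; apply: Ent_ge0 => x; exact: nice_ge0.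
have [g [ag g1 Eg]] := Ent_rescale af erefl m0 ltr01.
have : ment <= Ent g by apply: ge_inf; [by case: unit_energies_inf|exists g].
have Em : m^-1 `^ p_exp = (m `^ p_exp)^-1 by rewrite -[m^-1]powR_inv1 ?(ltW m0)// -powRrM mulN1r powRN.
rewrite Eg div1r Em => H.
by rewrite -ler_pdivlMr ?powR_gt0// mulrC.
Qed.

Lemma Ent_trunc f n : nice f -> Int (fun x => x ^+ 2 * f x) ->
  adm (fun x => (`|x| <= n%:R)%R%:R * f x) /\ Ent (fun x => (`|x| <= n%:R)%R%:R * f x) <= Ent f.
Proof.
move=> nf I2; set fn := fun x => _.
have mle : measurable_fun setT (fun x : R => (`|x| <= n%:R)%R%:R : R) by exact: measurable_leb.
have In : Int fn by apply: Int_boolM => //; exact: nice_Int.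
have fnf x : 0 <= fn x <= f x.
  have fx := nice_ge0 x nf; rewrite /fn; case: (`|x| <= n%:R); first by rewrite mul1r fx lexx.
  by rewrite mul0r lexx.
have nfn : nice fn.
  split => //; first exact: Int_meas.
  have [_ [B fB] _] := nf; exists B => x; have /andP[a b] := fnf x; have /andP[d e] := fB x.
  by rewrite a (le_trans b).
split.
  split => //; exists n%:R => // y ny; by rewrite /fn leNgt ny mul0r.
have Ifn2 : Int (fun x => x ^+ 2 * fn x).
  apply: (Int_dom _ I2); first by apply: measurable_funM; [exact: meas_sq|exact: nice_meas].
  move=> x; have /andP[a b] := fnf x.
  by rewrite normrM (ger0_norm a) ger0_norm ?sqr_ge0// ler_wpM2l// sqr_ge0.
apply: lerD; apply: ler_wpM2l; rewrite ?divr_ge0//; apply: int_le => //.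
- exact: Int_fpot.
- exact: Int_fpot.
- move=> x; have /andP[a b] := fnf x; apply: ler_pM => //; first by apply: pot_ge0 => y; case/andP: (fnf y).
  apply: int_le; [exact: Int_pot|exact: Int_pot|] => y; rewrite ler_wpM2l ?W_ge0//.
  by case/andP: (fnf y).
- by move=> x; rewrite ler_wpM2l ?sqr_ge0//; case/andP: (fnf x).
Qed.

(** Truncation to [-n, n] can only lower the energy, since kernel, weight and density are
    nonnegative, while the truncated masses converge to the full one. *)
Lemma ment_le f : nice f -> Int (fun x => x ^+ 2 * f x) ->
  ment * (\int[mu]_x f x) `^ p_exp <= Ent f.
Proof.
move=> nf I2; set m := \int[mu]_x f x.
have : 0 <= m by apply: int_ge0 => x; exact: nice_ge0.
rewrite le_eqVlt => /predU1P[<-|m0].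
  rewrite powR0; last by apply/negP => /eqP; have := p_exp_gt1; lra.
  by rewrite mulr0; apply: Ent_ge0 => x; exact: nice_ge0.
have cv : ment * (\int[mu]_x ((`|x| <= n%:R)%R%:R * f x)) `^ p_exp @[n --> \oo] --> ment * m `^ p_exp.
  apply: cvgM; first exact: cvg_cst.
  have /continuous_cvg := @continuous_powR R p_exp m m0; apply.
  exact: trunc_cvg (nice_Int nf).
have <- := cvg_lim _ cv => //.
apply: limr_le; first by apply/cvg_ex; eexists; exact: cv.
apply: nearW => n; have [an En] := Ent_trunc n nf I2.
by apply: le_trans En; exact: ment_adm.
Qed.

(** [hwi] holds against every compactly supported competitor of the same mass; rescaling the
    competitors of mass 1 to that mass and taking the infimum gives the claim. Mass 0 admits no
    rescaling and is compared with the zero density. *)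
Lemma Ent_diss f f1 f2 : nice f ->
  (forall x : R, is_derive x 1 f (f1 x)) -> (forall x : R, is_derive x 1 f1 (f2 x)) ->
  (forall x : R, {for x, continuous f2}) ->
  Int (fun x => x ^+ 2 * f x) -> Int (fun x => f x * (c * dpot0 q f x + x) ^+ 2) ->
  Ent f - 1 / 2 * \int[mu]_x (f x * (c * dpot0 q f x + x) ^+ 2) <= ment * (\int[mu]_x f x) `^ p_exp.
Proof.
move=> nf df df1 cf2 I2 Id.
set D := \int[mu]_x (f x * _); set M := \int[mu]_x f x.
have key g : adm g -> \int[mu]_x g x = M -> Ent f - 1 / 2 * D <= Ent g.
  move=> [ng [L L0 gL]] gM.
  exact: (@hwi R q q0 q1 f f1 f2 g L nf ng L0 df df1 cf2 gL (esym gM) c c_ge0 I2 Id).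
have : 0 <= M by apply: int_ge0 => x; exact: nice_ge0.
rewrite le_eqVlt => /predU1P[M0|M0].
  rewrite -M0 powR0; last by apply/negP => /eqP; have := p_exp_gt1; lra.
  rewrite mulr0; have -> : 0 = Ent (fun=> 0).
    rewrite /Ent (eq_int (g := fun=> 0)); last by move=> x; rewrite mul0r.
    by rewrite (eq_int (f := fun x => x ^+ 2 * 0) (g := fun=> 0)) ?int0 ?mulr0 ?addr0// => x; rewrite mulr0.
  apply: key; last by rewrite int0 -M0.
  split; last by exists 0.
  by split; [exact: measurable_cst|exists 0 => x; rewrite lexx|exact: Int0].
have Mp : 0 < M `^ p_exp by rewrite powR_gt0.
rewrite [leRHS]mulrC -ler_pdivrMl//; apply: lb_le_inf; first by case: unit_energies_inf.
move=> _ [g [ag g1 ->]].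
have [h [ah hM Eh]] := Ent_rescale ag g1 ltr01 M0.
rewrite ler_pdivrMl//; have := key h ah hM; rewrite Eh divr1//.
Qed.

End Minimum.

(** * Gamma function and mass of the Barenblatt profile *)

Section GammaFunction.
Context {R : realType}.
Local Notation mu := (@lebesgue_measure R).
Implicit Types (a b x y z : R).

Definition gfun a x := (0 < x)%R%:R * (x `^ (a - 1) * expR (- x)).

Lemma is_derive_expRN x : is_derive x 1 (fun x => expR (- x)) (- expR (- x)).
Proof.
have [u v] := @is_derive1_comp R expR (-%R : R -> R) x _ _ (is_derive_expR _) (is_deriveNid x 1).
by split => //; rewrite v mulrN1.
Qed.

Lemma meas_gfun a : measurable_fun setT (gfun a).
Proof.
apply: measurable_funM; first exact: measurable_ltb.
apply: measurable_funM; first exact: measurable_powR.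
by apply: continuous_meas => x; exact: is_derive_continuous (is_derive_expRN x).
Qed.

Lemma gfun_ge0 a x : 0 <= gfun a x.
Proof. by rewrite !mulr_ge0 ?powR_ge0 ?expR_ge0. Qed.

(* From [ln (x / b) <= x / b - 1]. *)
Lemma powR_expR_bd b : 0 < b -> exists2 C, 0 < C & forall x, 0 < x -> x `^ b * expR (- x) <= C.
Proof.
move=> b0; exists (expR (b * ln b - b)); first exact: expR_gt0.
move=> x x0; rewrite {1}/powR gt_eqF// -expRD ler_expR.
have xb : 0 < x / b by rewrite divr_gt0.
have : ln (x / b) <= x / b - 1.
  rewrite -[leRHS]expRK ler_ln ?posrE ?expR_gt0//.
  by apply: le_trans (expR_ge1Dx _); rewrite addrC subrK.
rewrite ln_div ?posrE// => H.
have := ler_wpM2l (ltW b0) H; rewrite !mulrBr mulr1 mulrCA divff ?gt_eqF// mulr1; lra.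
Qed.

Lemma gfun_tail a : 0 < a -> exists2 C, 0 < C & forall x, 1 < x -> x `^ (a - 1) * expR (- x) <= C * x `^ (-2).
Proof.
move=> a0; have [|C C0 H] := @powR_expR_bd (a + 1); first lra.
exists C => // x x1; have x0 : 0 < x by lra.
have -> : x `^ (a - 1) = x `^ (-2) * x `^ (a + 1).
  by rewrite -powRD ?(gt_eqF x0) ?implybT//; congr (_ `^ _); ring.
by rewrite -mulrA mulrC ler_wpM2r ?powR_ge0// H.
Qed.

Lemma Int_gfun a : 0 < a -> Int (gfun a).
Proof.
move=> a0; have [C C0 H] := gfun_tail a0.
have am1 : -1 < a - 1 by lra.
have two : (-2 : R) < -1 by lra.
apply: (Int_dom (meas_gfun a) (IntD (Int_powR_near0 am1) (IntZ C (Int_powR_tail two)))).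
move=> x; rewrite ger0_norm ?gfun_ge0// /gfun.
have [x0|x0] := leP x 0; first by rewrite !mul0r addr_ge0 ?mulr_ge0 ?powR_ge0 ?(ltW C0).
rewrite mul1r; have [x1|x1] := leP x 1.
  by rewrite mul1r mul0r mulr0 addr0 ler_piMr ?powR_ge0// -expR0 ler_expR; lra.
by rewrite mul0r add0r mul1r H.
Qed.

Lemma GammaE a : Gamma a = \int[mu]_x gfun a x.
Proof.
rewrite /Gamma /Rintegral; congr fine.
have -> : `]0, +oo[%classic = [set x : R | 0 < x].
  by apply/seteqP; split => x /=; rewrite in_itv/= andbT.
by rewrite integral_bool.
Qed.

Lemma Gamma_gt0 a : 0 < a -> 0 < Gamma a.
Proof.
move=> a0; rewrite GammaE.
have ab : (1 : R) <= 2 by lra.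
have [I E] := int_itv_len ab.
(* A lower bound of the integrand on ]1, 2]: the power is monotone there in one direction or the
   other, hence at least its smaller endpoint value. *)
pose k := Num.min 1 (2 `^ (a - 1)) * expR (- 2) : R.
have k0 : 0 < k by rewrite mulr_gt0 ?expR_gt0// lt_min ltr01 powR_gt0.
have kE : \int[mu]_z (k * (1 < z <= 2)%R%:R) = k by rewrite intZ// E; ring.
apply: (lt_le_trans k0); rewrite -kE; apply: int_le; [exact: IntZ|exact: Int_gfun|].
move=> x; have [/andP[x1 x2]|_] := boolP (1 < x <= 2); last by rewrite mulr0 gfun_ge0.
have x0 : 0 < x by lra.
rewrite mulr1 /gfun x0 mul1r; apply: ler_pM; rewrite ?expR_ge0 ?le_min ?ler01 ?powR_ge0//.
  have [a1|a1] := leP 1 a.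
    rewrite ge_min; apply/orP; left; rewrite -[leLHS](_ : 1 `^ (a - 1) = 1); last by rewrite powR1.
    by apply: ge0_ler_powR; rewrite ?nnegrE ?subr_ge0//; lra.
  by rewrite ge_min; apply/orP; right; apply: powR_le_neg => //; lra.
by rewrite ler_expR lerN2.
Qed.

Lemma Gamma_rec a : 0 < a -> Gamma (a + 1) = a * Gamma a.
Proof.
move=> a0; have a10 : 0 < a + 1 by lra.
have I1 := Int_gfun a10; have I0 := Int_gfun a0.
rewrite !GammaE -(intZ a I0); apply/eqP; rewrite -subr_eq0 -intB//; last exact: IntZ.
pose h x := gfun (a + 1) x - a * gfun a x.
have Ih : Int h by apply: IntB => //; exact: IntZ.
(* A primitive of h on the positive half-line, vanishing at both ends. The offset in [n.+2] makes
   the truncation interval nondegenerate already for n = 0. *)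
pose F x := - (x `^ a * expR (- x)).
pose Pn (n : nat) x := (n.+2%:R^-1 < x <= n.+2%:R).
have nn (n : nat) : (n.+2%:R^-1 : R) < n.+2%:R.
  apply: (@lt_trans _ _ 1); last by rewrite ltr1n.
  by rewrite invf_lt1 ?ltr0n// ltr1n.
have E n : \int[mu]_x ((Pn n x)%:R * h x) = F n.+2%:R - F n.+2%:R^-1.
  have mP : measurable_fun setT (fun x => (Pn n x)%:R : R) by have [/Int_meas] := int_itv_len (ltW (nn n)).
  apply: EFin_inj; rewrite EFin_int; last exact: Int_boolM.
  rewrite -(integral_bool (Pn n)).
  have -> : [set x : R | Pn n x] = `]n.+2%:R^-1, n.+2%:R]%classic.
    by apply/seteqP; split => x /=; rewrite in_itv.
  rewrite integral_itv_obnd_cbnd; last first.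
    by apply/measurable_EFinP/measurable_funTS; exact: Int_meas Ih.
  have pos x : n.+2%:R^-1 <= x <= n.+2%:R -> 0 < x.
    by move=> /andP[+ _]; apply: lt_le_trans; rewrite invr_gt0 ltr0n.
  transitivity (\int[mu]_(x in `[(n.+2%:R^-1)%R, n.+2%:R]) (x `^ (a + 1 - 1) * expR (- x) - a * (x `^ (a - 1) * expR (- x)))%:E)%E.
    apply: eq_integral => x; rewrite inE/= in_itv/= => /pos x0.
    by rewrite /h /gfun x0 !mul1r.
  apply: (@ftc_ab R _ F) => // x /pos x0.
    apply: cvgB; apply: cvgM; rewrite ?addrK.
    - exact: continuous_powR.
    - exact: is_derive_continuous (is_derive_expRN x).
    - exact: cvg_cst.
    - by apply: cvgM; [exact: continuous_powR|exact: is_derive_continuous (is_derive_expRN x)].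
  have [u v] := is_deriveN (is_deriveM (is_derive1_powR a x0) (is_derive_expRN x)).
  by split => //; rewrite v /GRing.scale/= addrK; ring.
have cv1 : \int[mu]_x ((Pn n x)%:R * h x) @[n --> \oo] --> \int[mu]_x h x.
  have [] := @int_dct R (fun n x => (Pn n x)%:R * h x) h (fun x => `|h x|) => //.
  - move=> n; apply: measurable_funM; last exact: Int_meas.
    by have [/Int_meas] := int_itv_len (ltW (nn n)).
  - exact: Int_meas.
  - apply: ae_all => x; have [x0|x0] := leP x 0.
      have -> : h x = 0 by rewrite /h /gfun ltNge x0/= !mul0r mulr0 subr0.
      by under eq_fun do rewrite mulr0; exact: cvg_cst.
    apply: cvg_near_cst; near=> n; rewrite (_ : Pn n x) ?mul1r//; apply/andP; split.
      apply: (@lt_trans _ _ n.+1%:R^-1); first by rewrite ltf_pV2 ?posrE ?ltr0n// ltr_nat.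
      by near: n; exact: near_infty_natSinv_lt (PosNum x0).
    apply: (@le_trans _ _ n%:R); last by rewrite ler_nat leqW.
    by near: n; exact: nbhs_infty_ger.
  - exact: Int_norm.
  - by apply: ae_all => x n; rewrite normrM normr_nat ler_piMl//; case: (Pn n x).
have cv2 : F n.+2%:R - F n.+2%:R^-1 @[n --> \oo] --> (0 : R).
  rewrite -(subr0 0) /F; apply: cvgB; rewrite -oppr0; apply: cvgN.
    have a1 : 0 < a + 1 by lra.
    have [C C0 HC] := powR_expR_bd a1.
    apply: (@squeeze_cvgr _ _ _ _ (fun=> 0) (fun n => C * n.+2%:R^-1)).
    - apply: nearW => n; rewrite mulr_ge0 ?powR_ge0 ?expR_ge0//=.
      have n0 : 0 < (n.+2%:R : R) by rewrite ltr0n.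
      have := HC _ n0; rewrite -(mulr_powRB1 (ltW n0) a1) addrK => HN.
      by rewrite ler_pdivlMr// mulrC mulrA.
    - exact: cvg_cst.
    - rewrite -(mulr0 C); apply: cvgM; first exact: cvg_cst.
      by have := @cvg_harmonic R; rewrite -cvg_shiftS.
  apply: (@squeeze_cvgr _ _ _ _ (fun=> 0) (fun n => n.+2%:R `^ (- a))).
  - apply: nearW => n; rewrite mulr_ge0 ?powR_ge0 ?expR_ge0//=.
    have e1 : expR (- n.+2%:R^-1) <= 1 :> R by rewrite -expR0 ler_expR oppr_le0 invr_ge0.
    apply: (le_trans (ler_wpM2l (powR_ge0 _ _) e1)).
    by rewrite mulr1 -powR_inv1 ?ler0n// -powRrM mulN1r.
  - exact: cvg_cst.
  - apply: (@cvg_comp _ _ _ (fun n : nat => n.+2%:R : R) (fun x => x `^ (- a)) _ (@pinfty_nbhs R)).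
      by have := @cvgr_idn R; rewrite -cvg_shiftS -cvg_shiftS.
    by apply: powR_cvgy0; lra.
have cv3 : \int[mu]_x ((Pn n x)%:R * h x) @[n --> \oo] --> (0 : R).
  by apply: cvg_trans cv2; apply: near_eq_cvg; apply: nearW => n; rewrite E.
by apply/eqP; rewrite -(cvg_lim _ cv1)// -(cvg_lim _ cv3).
Unshelve. all: by end_near. Qed.
End GammaFunction.

(** * A beta integral and the mass of the Barenblatt profile *)

Section BarenblattMass.
Context {R : realType}.
Local Notation mu := (@lebesgue_measure R).
Implicit Types (b x u z s : R).

Definition bump b x := Num.max 0 (1 - x ^+ 2) `^ b : R.

Lemma meas_max0 : measurable_fun setT (fun x : R => Num.max 0 x).
Proof. by apply: measurable_maxr. Qed.

Lemma meas_bump b : measurable_fun setT (bump b).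
Proof.
apply: (measurableT_comp (@measurable_powR R b)).
apply: (measurableT_comp meas_max0); apply: measurable_funB => //; exact: measurable_funX.
Qed.

Lemma bump_far b x : b != 0 -> 1 < `|x| -> bump b x = 0.
Proof.
move=> b0 x1; rewrite /bump max_l ?powR0// subr_le0.
by rewrite -(real_normK (num_real x)) expr_ge1// ltW.
Qed.

Lemma bump_itv b x : 0 <= b -> 0 <= bump b x <= 1.
Proof.
move=> b0; rewrite powR_ge0 /bump /= -[leRHS](_ : 1 `^ b = 1); last by rewrite powR1.
apply: ge0_ler_powR => //; rewrite ?nnegrE ?le_max ?lexx// ge_max ler01 gerBl sqr_ge0//.
Qed.

Lemma Int_bump b : 0 < b -> Int (bump b).
Proof.
move=> b0; have n22 : (- 2 : R) <= 2 by lra.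
have [I _] := int_itv_len n22.
apply: (Int_dom (meas_bump b) I) => x; have /andP[p0 p1] := bump_itv x (ltW b0).
rewrite ger0_norm//; have [x1|x1] := leP `|x| 1; last by rewrite bump_far// gt_eqF.
by rewrite (_ : (- 2 < x <= 2) = true)//; move: x1; rewrite ler_norml; lra.
Qed.

Lemma powR_mul_sqrt b u : 0 < u -> u `^ (b + 3 / 2 - 1) = u `^ b * Num.sqrt u.
Proof.
move=> u0; rewrite -powR12_sqrt ?ltW// -powRD ?(gt_eqF u0) ?implybT//.
by congr (_ `^ _); lra.
Qed.

(** The beta integral B(1/2, b + 1) by Fubini on exp (- x^2) (u - x^2)_+^b exp (- (u - x^2)).
    Integrating u first gives the left side. Integrating x first, the exponentials combine to exp (-
    u), and x = sqrt u * y produces the bump and the Gamma integral at b + 3/2. *)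
Lemma int_bump b : 0 < b -> Num.sqrt pi * Gamma (b + 1) = (\int[mu]_x bump b x) * Gamma (b + 3 / 2).
Proof.
move=> b0; have b10 : 0 < b + 1 by lra. have b32 : 0 < b + 3 / 2 by lra.
have Ig : Int (@gauss_fun R) by exact: integrableT_gauss.
have gE : \int[mu]_x gauss_fun x = Num.sqrt pi.
  by apply: EFin_inj; rewrite EFin_int// integralT_gauss.
have IG := Int_gfun b10. have IJ := Int_bump b0.
pose k x u := gauss_fun x * gfun (b + 1) (u - x ^+ 2).
have mk : meas2 k.
  apply: meas2M; first by apply: meas2_fst; exact: Int_meas.
  apply: (meas2_comp (meas_gfun _)); apply: meas2B; first exact: (meas2_snd (@measurable_id _ _ _)).
  by apply: (meas2_fst (f := fun x => x ^+ 2)); exact: measurable_funX.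
have k0 x u : 0 <= k x u by rewrite mulr_ge0 ?gfun_ge0 ?gauss_fun_ge0.
have Ishift x : Int (fun u => gfun (b + 1) (u - x ^+ 2)) /\ \int[mu]_u gfun (b + 1) (u - x ^+ 2) = Gamma (b + 1).
  have := @Int_affine R 1 (- x ^+ 2) _ (oner_neq0 _) IG.
  have := @int_affine R 1 (- x ^+ 2) _ (oner_neq0 _) IG.
  rewrite normr1 mul1r -GammaE => -> I; split.
    by apply: eq_Int I => u; rewrite mul1r.
  by apply: eq_int => u; rewrite mul1r.
have kE x u : k x u = (0 < u)%R%:R * (u `^ b * expR (- u)) * bump b ((Num.sqrt u)^-1 * x + 0).
  rewrite /k /gfun /gauss_fun addr0 addrK.
  have [u0|u0] := leP u 0.
    have -> : (0 < u - x ^+ 2) = false by apply/negbTE; rewrite -leNgt; have := sqr_ge0 x; lra.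
    by rewrite !mul0r mulr0.
  have E : (Num.sqrt u)^-1 * x = x / Num.sqrt u by rewrite mulrC.
  rewrite E /bump expr_div_n sqr_sqrtr ?ltW//.
  have -> : 1 - x ^+ 2 / u = u^-1 * (u - x ^+ 2) by field; rewrite gt_eqF.
  have [h|h] := ltP 0 (u - x ^+ 2).
    rewrite max_r; last by rewrite mulr_ge0 ?invr_ge0// ltW.
    rewrite powRM ?invr_ge0 ?ltW// -powR_inv1 ?ltW// -powRrM mulN1r powRN !mul1r.
    have -> : expR (- u) = expR (- x ^+ 2) * expR (- (u - x ^+ 2)) by rewrite -expRD; congr expR; ring.
    by field; rewrite gt_eqF// powR_gt0.
  rewrite max_l; last by rewrite pmulr_rle0 ?invr_gt0.
  by rewrite powR0 ?gt_eqF// mul0r !mulr0.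
have I1 x : Int (k x) by apply: IntZ; exact: (Ishift x).1.
have su u : 0 < u -> (Num.sqrt u)^-1 != 0 by move=> u0; rewrite invr_eq0 gt_eqF// sqrtr_gt0.
have I2 u : Int (k ^~ u).
  have [u0|u0] := leP u 0.
    by apply: eq_Int (@Int0 R) => x; rewrite kE ltNge u0/= !mul0r.
  have := IntZ ((0 < u)%R%:R * (u `^ b * expR (- u))) (@Int_affine R _ 0 _ (su u u0) IJ).
  by apply: eq_Int => x; rewrite kE.
have I3 : Int (fun x => \int[mu]_u `|k x u|).
  apply: eq_Int (IntZ (Gamma (b + 1)) Ig) => x.
  rewrite (eq_int (g := k x)); last by move=> u; rewrite ger0_norm.
  by rewrite intZ; [rewrite (Ishift x).2 mulrC|exact: (Ishift x).1].
have [_ _ E] := fubini_real mk I1 I2 I3.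
transitivity (\int[mu]_x \int[mu]_u k x u).
  rewrite -gE [LHS]mulrC -(intZ _ Ig); apply: eq_int => x.
  by rewrite intZ; [rewrite (Ishift x).2 mulrC|exact: (Ishift x).1].
rewrite E GammaE -intZ; last exact: Int_gfun.
apply: eq_int => u.
have [u0|u0] := leP u 0.
  rewrite (eq_int (g := fun=> 0)); last by move=> x; rewrite kE ltNge u0/= !mul0r.
  by rewrite int0 /gfun ltNge u0/= mul0r mulr0.
rewrite (eq_int (kE ^~ u)) u0 mul1r intZ; last exact: (@Int_affine R _ 0 _ (su u u0) IJ).
rewrite /gfun u0 mul1r (@int_affine R _ 0 _ (su u u0) IJ).
have su0 : 0 < Num.sqrt u by rewrite sqrtr_gt0.
rewrite normfV (gtr0_norm su0).
have -> : u `^ (b + 3 / 2 - 1) = u `^ b * Num.sqrt u.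
  exact: powR_mul_sqrt.
move: (u `^ b) (expR (- u)) (\int[mu]_x bump b x) (Num.sqrt u) su0 => A B C D D0.
by field; rewrite gt_eqF.
Qed.

Lemma Gamma_half_gt0 s : 0 < s < 1 / 2 ->
  [/\ 0 < Gamma s, 0 < Gamma (1 / 2 - s), 0 < Gamma (2 - s), 0 < Gamma (3 / 2 - s) & 0 < Gamma (3 / 2 : R)].
Proof. by move=> /andP[s0 s1]; split; apply: Gamma_gt0; lra. Qed.

Lemma riesz_const_gt0 s : 0 < s < 1 / 2 -> 0 < riesz_const s.
Proof.
move=> H; have [G1 G2 _ _ _] := Gamma_half_gt0 H.
rewrite /riesz_const; move: (Gamma s) (Gamma (1 / 2 - s)) G1 G2 => A B A0 B0.
by rewrite divr_gt0// !mulr_gt0// powR_gt0 ?pi_gt0.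
Qed.

Lemma barenblatt_mass_const_gt0 s : 0 < s < 1 / 2 -> 0 < barenblatt_mass_const s.
Proof.
move=> H; have ? : 0 < 3 - 2 * s by move: H; lra.
have [_ _ _ G1 G2] := Gamma_half_gt0 H; rewrite /barenblatt_mass_const.
move: (Gamma (3 / 2 - s)) (Gamma (3 / 2)) G1 G2 => A B A0 B0.
by rewrite divr_gt0// !mulr_gt0// ?exprn_gt0// powR_gt0 ?pi_gt0.
Qed.

Definition bar_const s : R := 2 `^ (2 * s - 1) * Gamma (3 / 2) / (Gamma (2 - s) * Gamma (3 / 2 - s)).

Lemma bar_const_gt0 s : 0 < s < 1 / 2 -> 0 < bar_const s.
Proof.
move=> H; have [_ _ G1 G2 G3] := Gamma_half_gt0 H.
rewrite /bar_const; move: (Gamma (2 - s)) (Gamma (3 / 2 - s)) (Gamma (3 / 2)) G1 G2 G3 => A B C A0 B0 C0.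
by rewrite divr_gt0// !mulr_gt0// powR_gt0.
Qed.

Lemma barenblatt_profileE s rad x : 0 < rad ->
  barenblatt_profile s rad x = bar_const s * rad `^ (2 - 2 * s) * bump (1 - s) (rad^-1 * x).
Proof.
move=> r0; rewrite /barenblatt_profile /bump -/(bar_const s) -mulrA; congr (_ * _).
have -> : 2 - 2 * s = 2 * (1 - s) by ring.
rewrite powRrM -powRM ?powR_ge0 ?le_max ?lexx//; congr (_ `^ _).
rewrite -[2]/(2%:R) powR_mulrn ?ltW// maxr_pMr ?sqr_ge0// mulr0; congr (Num.max _ _).
by field; rewrite gt_eqF.
Qed.

Lemma barenblatt_profile0 s x : s < 1 -> barenblatt_profile s 0 x = 0.
Proof.
move=> s1; rewrite /barenblatt_profile max_l ?powR0 ?mulr0//; first by rewrite gt_eqF// subr_gt0.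
by rewrite expr0n/= sub0r oppr_le0 sqr_ge0.
Qed.

Lemma bump_nice s : 0 < s < 1 / 2 -> nice (bump (1 - s)).
Proof.
move=> /andP[s0 s1]; have s2 : 0 < 1 - s by lra.
split; [exact: meas_bump| |exact: Int_bump].
by exists 1 => x; rewrite bump_itv// ltW.
Qed.

Lemma barenblatt_adm s M : 0 < s < 1 / 2 -> adm (barenblatt s M).
Proof.
move=> H; have /andP[s0 s1] := H; rewrite /barenblatt.
have : 0 <= barenblatt_radius s M by exact: powR_ge0.
rewrite le_eqVlt => /orP[/eqP <-|r0].
  have -> : barenblatt_profile s 0 = fun=> 0 by apply/funext => x; rewrite barenblatt_profile0//; lra.
  split; last by exists 0.
  split; [exact: measurable_cst|by exists 0 => x; rewrite lexx|exact: Int0].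
set rad := barenblatt_radius s M in r0 *.
have -> : barenblatt_profile s rad = fun x => bar_const s * rad `^ (2 - 2 * s) * bump (1 - s) (rad^-1 * x).
  by apply/funext => x; rewrite barenblatt_profileE.
split.
  apply: nice_scale; [exact: bump_nice| |by rewrite invr_gt0].
  by rewrite mulr_ge0 ?powR_ge0// ltW// bar_const_gt0.
exists rad; first exact: ltW.
move=> y yr; rewrite bump_far ?mulr0//; first by apply/eqP; lra.
by rewrite normrM gtr0_norm ?invr_gt0// mulrC ltr_pdivlMr// mul1r.
Qed.

(** This reconciles the two explicit prefactors: [int_bump] at b = 1 - s, followed by the recursion
    of Gamma at 3/2 - s, which brings in the factor 3 - 2 s. *)
Lemma int_bump_const s : 0 < s < 1 / 2 -> bar_const s * \int[mu]_x bump (1 - s) x = barenblatt_mass_const s.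
Proof.
move=> H; have /andP[s0 s1] := H.
have b0 : 0 < 1 - s by lra.
have s32 : 0 < 3 / 2 - s by lra.
have E1 : 1 - s + 1 = 2 - s by ring.
have E2 : 1 - s + 3 / 2 = (3 / 2 - s) + 1 by ring.
have E3 : 3 - 2 * s = 2 * (3 / 2 - s) by field.
have E4 : 2 `^ (2 * s) = 2 * 2 `^ (2 * s - 1) :> R by rewrite mulr_powRB1//; lra.
have E5 : (pi : R) `^ (1 / 2) = Num.sqrt pi by rewrite mul1r powR12_sqrt// ltW// pi_gt0.
have := int_bump b0; rewrite E1 E2 Gamma_rec//.
have [_ _ G1 G2 _] := Gamma_half_gt0 H; move: G1 G2.
rewrite /bar_const /barenblatt_mass_const E3 E4 E5.
move: (3 / 2 - s) s32 (Gamma (2 - s)) (Gamma (3 / 2 - s)) (Gamma (3 / 2)) (Num.sqrt pi) (2 `^ (2 * s - 1)) (\int[mu]_x bump (1 - s) x).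
move=> G G0 A B C D F J A0 B0 E.
have -> : J = D * A / (G * B) by rewrite E mulfK// gt_eqF// mulr_gt0.
by field; rewrite !gt_eqF.
Qed.

Lemma barenblatt_mass s M : 0 < s < 1 / 2 -> 0 <= M -> mass (barenblatt s M) = M.
Proof.
move=> H M0; have /andP[s0 s1] := H; have m0 := barenblatt_mass_const_gt0 H.
have := M0; rewrite le_eqVlt => /orP[/eqP <-|Mp].
  rewrite /mass /barenblatt /barenblatt_radius mul0r powR0; last by rewrite invr_neq0//; apply/eqP; lra.
  by rewrite (eq_int (g := fun=> 0)) ?int0// => x; rewrite barenblatt_profile0//; lra.
have r0 : 0 < barenblatt_radius s M by rewrite powR_gt0// divr_gt0.
rewrite /mass /barenblatt (eq_int (fun x => barenblatt_profileE s x r0)).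
set rad := barenblatt_radius s M in r0 *.
have ri : 0 < rad^-1 by rewrite invr_gt0.
have [_ _ Ib] := bump_nice H.
rewrite intZ; last first.
  have := Int_affine 0 (lt0r_neq0 ri) Ib; apply: eq_Int => x; by rewrite addr0.
rewrite int_scale// invrK.
have -> : bar_const s * rad `^ (2 - 2 * s) * (rad * \int[mu]_x bump (1 - s) x) =
   (rad * rad `^ (2 - 2 * s)) * (bar_const s * \int[mu]_x bump (1 - s) x) by ring.
rewrite int_bump_const//.
have -> : rad * rad `^ (2 - 2 * s) = rad `^ (3 - 2 * s).
  have -> : 2 - 2 * s = (3 - 2 * s) - 1 by ring.
  by rewrite mulr_powRB1 ?ltW//; lra.
rewrite /rad /barenblatt_radius -powRrM mulVf; last by apply/eqP; lra.
by rewrite powRr1 ?(divr_ge0 M0 (ltW m0))// divfK// gt_eqF.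
Qed.
End BarenblattMass.

(** * Entropy of a profile *)

Section Profiles.
Context {R : realType}.
Local Notation mu := (@lebesgue_measure R).
Variable s : R.
Hypothesis hs : 0 < s < 1 / 2.
Implicit Types (f g : R -> R) (x y M E : R).

Local Notation q := (2 * s - 1).
Local Notation c := (riesz_const s).
Let q0 : q < 0. Proof. by have := hs; lra. Qed.
Let q1 : -1 < q. Proof. by have := hs; lra. Qed.
Let c0 : 0 < c. Proof. exact: riesz_const_gt0. Qed.
Let c_ge0 : 0 <= c. Proof. exact: ltW. Qed.

Lemma rieszE f : riesz s f = fun x => c * pot q 0 f x.
Proof. by apply/funext => x; rewrite /riesz /pot /W; congr (_ * _); apply: eq_int => y; rewrite addr0. Qed.

(** Both parts of the entropy density are nonnegative, so its integrability controls the second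
    moment. With f bounded by B on [-1, 1] and by x^2 f outside, f is then integrable too. *)
Lemma nice_of_entropy f : (forall x, {for x, continuous f}) -> (forall x, 0 <= f x) ->
  (exists B, forall x, f x <= B) -> Int (entropy_density s f) -> nice f /\ Int (fun x => x ^+ 2 * f x).
Proof.
move=> cf f0 [B fB] Id; have mf := continuous_meas cf.
have I2 : Int (fun x => x ^+ 2 * f x).
  apply: (Int_dom _ (IntZ 2 Id)); first by apply: measurable_funM => //; exact: meas_sq.
  move=> x; rewrite ger0_norm; last by rewrite mulr_ge0 ?sqr_ge0.
  rewrite /entropy_density rieszE; have : 0 <= f x * (c * pot q 0 f x) by apply: mulr_ge0 => //; apply: mulr_ge0 => //; exact: pot_ge0.
  lra.
split=> //; split=> //; first by exists B => x; rewrite f0 fB.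
have n22 : (-2 : R) <= 2 by lra.
have [I1 _] := int_itv_len n22.
apply: (Int_dom mf (IntD (IntZ B I1) I2)) => x; rewrite ger0_norm//.
have xf : 0 <= x ^+ 2 * f x by rewrite mulr_ge0 ?sqr_ge0.
have [x1|x1] := leP `|x| 1.
  rewrite (_ : (- 2 < x <= 2) = true) ?mulr1; last by move: x1; rewrite ler_norml; lra.
  by apply: (le_trans (fB x)); rewrite lerDl.
apply: (@le_trans _ _ (x ^+ 2 * f x)).
  by rewrite ler_peMl// -(real_normK (num_real x)) expr_ge1// ltW.
by rewrite lerDr mulr_ge0// (le_trans (f0 0)).
Qed.

Lemma entropyE f : nice f -> Int (fun x => x ^+ 2 * f x) -> entropy s f = Ent q c f.
Proof.
move=> nf I2; rewrite /entropy /entropy_density rieszE /Ent -!intZ//; last exact: Int_fpot.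
rewrite -intD; [|apply: IntZ; exact: Int_fpot|exact: IntZ].
by apply: eq_int => x; congr (_ + _); field.
Qed.

Lemma entropy_barenblatt_ge0 M : 0 <= entropy s (barenblatt s M).
Proof.
have ab := barenblatt_adm M hs; have [nb _] := ab.
rewrite entropyE//; last exact: adm_sq ab.
by apply: Ent_ge0 => // x; exact: nice_ge0.
Qed.

Lemma relative_entropy_le f : nice f -> Int (fun x => x ^+ 2 * f x) ->
  entropy s f - entropy s (barenblatt s (mass f)) <= Ent q c f - ment q c * (mass f) `^ p_exp q.
Proof.
move=> nf I2; have M0 : 0 <= mass f by apply: int_ge0 => x; exact: nice_ge0.
have ab := barenblatt_adm (mass f) hs; have [nb _] := ab.
rewrite (entropyE nf I2) (entropyE nb (adm_sq ab)) lerD2l lerN2.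
by have := ment_adm q0 q1 c_ge0 ab; rewrite -/(mass (barenblatt _ _)) barenblatt_mass.
Qed.

(** For the mass a inside [-1, 1], where the kernel is at least 2^q, the interaction energy gives c
    2^q a^2 <= 2 E, and a <= 1 + a^2. The mass outside is at most the second moment, hence the last
    2 E. *)
Definition mass_bd E := 1 + 2 * E / (c * 2 `^ q) + 2 * E.

Lemma mass_le f E : nice f -> Int (fun x => x ^+ 2 * f x) -> Ent q c f <= E -> mass f <= mass_bd E.
Proof.
move=> nf I2 fE; have f0 x := nice_ge0 x nf.
have mle : measurable_fun setT (fun x : R => (`|x| <= 1)%R%:R : R) by exact: measurable_leb.
have I1 := Int_boolM mle (nice_Int nf).
set a := \int[mu]_x ((`|x| <= 1)%R%:R * f x).
have a0 : 0 <= a by apply: int_ge0 => x; rewrite mulr_ge0.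
have P0 : 0 <= \int[mu]_x (f x * pot q 0 f x) by apply: int_ge0 => x; rewrite mulr_ge0 ?pot_ge0.
have S0 : 0 <= \int[mu]_x (x ^+ 2 * f x) by apply: int_ge0 => x; rewrite mulr_ge0 ?sqr_ge0.
have tw : 0 < (2 : R) `^ q by exact: powR_gt0.
have H1 : mass f <= a + \int[mu]_x (x ^+ 2 * f x).
  rewrite /mass /a -intD//; apply: int_le => [||x]; [exact: nice_Int|exact: IntD|].
  have [x1|x1] := leP `|x| 1; first by rewrite mul1r lerDl mulr_ge0 ?sqr_ge0.
  by rewrite mul0r add0r ler_peMl// -(real_normK (num_real x)) expr_ge1// ltW.
have pot_ge x : `|x| <= 1 -> 2 `^ q * a <= pot q 0 f x.
  move=> x1; rewrite -intZ//; apply: int_ae_le; [exact: IntZ|exact: Int_pot|].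
  apply: ae_imp (ae_neq x) => y yx; have [y1|y1] := leP `|y| 1; last first.
    by rewrite mul0r mulr0 mulr_ge0 ?W_ge0.
  rewrite mul1r; apply: ler_wpM2r => //; rewrite /W addr0; apply: powR_le_neg; [exact: ltW|by rewrite normr_gt0 subr_eq0 eq_sym|].
  by move: x1 y1; rewrite !ler_norml; lra.
have H2 : 2 `^ q * a * a <= \int[mu]_x (f x * pot q 0 f x).
  rewrite -{2}/a -intZ//; apply: int_le => [||x]; [exact: IntZ|exact: Int_fpot|].
  have [x1|x1] := leP `|x| 1; last by rewrite mul0r mulr0 mulr_ge0 ?pot_ge0.
  by rewrite mul1r mulrC ler_wpM2l// pot_ge.
have cP : c * \int[mu]_x (f x * pot q 0 f x) <= 2 * E.
  by move: fE; rewrite /Ent; lra.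
have cP2 : 0 <= c * \int[mu]_x (f x * pot q 0 f x) by rewrite mulr_ge0.
have SE : \int[mu]_x (x ^+ 2 * f x) <= 2 * E.
  by move: fE; rewrite /Ent; lra.
have aa : a ^+ 2 <= 2 * E / (c * 2 `^ q).
  rewrite ler_pdivlMr ?(mulr_gt0 c0 tw)//; apply: (le_trans _ cP).
  have := ler_wpM2l c_ge0 H2; rewrite expr2; congr (_ <= _); ring.
have a1 : a <= 1 + a ^+ 2 by have := sqr_ge0 (a - 1 / 2); rewrite !expr2; lra.
by rewrite /mass_bd; lra.
Qed.

Lemma moment_le f E : nice f -> Ent q c f <= E -> \int[mu]_x (x ^+ 2 * f x) <= 2 * E.
Proof.
move=> nf; have f0 x := nice_ge0 x nf.
have : 0 <= \int[mu]_x (f x * pot q 0 f x) by apply: int_ge0 => x; rewrite mulr_ge0 ?pot_ge0.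
by move=> /(mulr_ge0 c_ge0); rewrite /Ent; lra.
Qed.

Lemma energy_le f E : nice f -> Ent q c f <= E -> c * \int[mu]_x (f x * pot q 0 f x) <= 2 * E.
Proof.
move=> nf; have f0 x := nice_ge0 x nf.
have : 0 <= \int[mu]_x (x ^+ 2 * f x) by apply: int_ge0 => x; rewrite mulr_ge0 ?sqr_ge0.
by rewrite /Ent; lra.
Qed.

Lemma derive1_riesz f f1 f2 x : nice f -> (forall x : R, is_derive x 1 f (f1 x)) ->
  (forall x : R, is_derive x 1 f1 (f2 x)) -> (forall x : R, {for x, continuous f2}) ->
  derive1 (riesz s f) x = c * dpot0 q f x.
Proof.
move=> nf df df1 cf2; rewrite rieszE derive1E.
have D := is_deriveZ c (pot0_derive q0 q1 nf df df1 x).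
by have /= -> := @derive_val _ _ _ _ _ _ _ D.
Qed.

(* [Ent (f + e g)] expanded to second order in [e], bounded below by the minimal energy at its mass. *)
Lemma ment_perturb f g e : nice f -> nice g -> Int (fun x => x ^+ 2 * f x) -> Int (fun x => x ^+ 2 * g x) ->
  0 <= e ->
  ment q c * (mass f + e * mass g) `^ p_exp q <=
  Ent q c f + e * \int[mu]_x (g x * (c * pot q 0 f x + x ^+ 2 / 2)) +
  e ^+ 2 / 2 * (c * \int[mu]_x (g x * pot q 0 g x)).
Proof.
move=> nf ng If2 Ig2 e0.
have If := nice_Int nf; have Ig := nice_Int ng.
have nh : nice (fun x => f x + e * g x).
  have [mf [B fB] _] := nf; have [mg [B' gB'] _] := ng.
  split; [apply: measurable_funD => //; exact: measurable_funM| |by apply: IntD => //; exact: IntZ].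
  exists (B + e * B') => x; have /andP[f0 fb] := fB x; have /andP[g0 gb] := gB' x.
  by rewrite addr_ge0 ?mulr_ge0// lerD// ler_wpM2l.
have Ih2 : Int (fun x => x ^+ 2 * (f x + e * g x)).
  by apply: eq_Int (IntD If2 (IntZ e Ig2)) => x; ring.
have := ment_le q0 q1 c_ge0 nh Ih2; rewrite intD ?intZ//; last exact: IntZ.
move=> H; apply: (le_trans H); rewrite le_eqVlt; apply/orP; left; apply/eqP.
have potD x : pot q 0 (fun x => f x + e * g x) x = pot q 0 f x + e * pot q 0 g x.
  rewrite /pot -intZ -?intD; [|exact: Int_pot|apply: IntZ; exact: Int_pot|exact: Int_pot].
  by apply: eq_int => y; ring.
have Iff := Int_fpot q0 q1 nf nf (lexx 0); have Ifg := Int_fpot q0 q1 nf ng (lexx 0).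
have Igf := Int_fpot q0 q1 ng nf (lexx 0); have Igg := Int_fpot q0 q1 ng ng (lexx 0).
have E1 : \int[mu]_x ((f x + e * g x) * pot q 0 (fun x => f x + e * g x) x) =
  \int[mu]_x (f x * pot q 0 f x) + 2 * e * \int[mu]_x (g x * pot q 0 f x) + e ^+ 2 * \int[mu]_x (g x * pot q 0 g x).
  transitivity (\int[mu]_x ((f x * pot q 0 f x) + (e * (g x * pot q 0 f x)) + (e * (f x * pot q 0 g x) + e ^+ 2 * (g x * pot q 0 g x)))).
    by apply: eq_int => x; rewrite potD; ring.
  rewrite intD; [|by apply: IntD => //; exact: IntZ|by apply: IntD; exact: IntZ].
  rewrite intD//; last exact: IntZ.
  rewrite intD; [|exact: IntZ|exact: IntZ].
  by rewrite !intZ// (pot_sym q0 q1 ng nf (lexx 0)); ring.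
have E2 : \int[mu]_x (x ^+ 2 * (f x + e * g x)) = \int[mu]_x (x ^+ 2 * f x) + e * \int[mu]_x (x ^+ 2 * g x).
  by rewrite -intZ// -intD//; [apply: eq_int => x; ring|exact: IntZ].
have E3 : \int[mu]_x (g x * (c * pot q 0 f x + x ^+ 2 / 2)) = c * \int[mu]_x (g x * pot q 0 f x) + 1 / 2 * \int[mu]_x (x ^+ 2 * g x).
  rewrite -!intZ// -intD; [|exact: IntZ|exact: IntZ].
  by apply: eq_int => x; field.
by rewrite /Ent E1 E2 E3; field.
Qed.

End Profiles.

(** * Maximum points, explicit constants and power calculus *)

Section Maxima.
Context {R : realType}.
Implicit Types (g : R -> R) (x t l : R).

(** One-sided because the maximum over a time window may be attained at its final time. *)
Lemma derive_left_max g t l (a : R) : a < t -> is_derive t 1 g l ->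
  (forall u : R, a < u <= t -> g u <= g t) -> 0 <= l.
Proof.
move=> at0 dg gm; pose d := (t - a) / 2; have d0 : 0 < d by rewrite divr_gt0 ?subr_gt0.
have tn0 n : - (d * eps_ n) != 0 :> R.
  by rewrite oppr_eq0 mulf_neq0//; [rewrite gt_eqF|exact: lt0r_neq0 (eps_gt0 n)].
have tnc : - (d * eps_ n) @[n --> \oo] --> (0 : R).
  by rewrite -oppr0 -(mulr0 d); apply: cvgN; apply: cvgM; [exact: cvg_cst|exact: eps_cvg0].
have H := is_derive_seqP dg tn0 tnc.
rewrite -(cvg_lim _ H)//; apply: limr_ge; first by apply/cvg_ex; eexists; exact: H.
apply: nearW => n; have e0 : 0 < d * eps_ n by rewrite mulr_gt0 ?eps_gt0.
have e1 : d * eps_ n <= d by rewrite ler_piMr ?(ltW d0)// invf_le1 ?ltr0n// ler1n.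
rewrite invrN mulNr -mulrN mulr_ge0 ?invr_ge0 ?(ltW e0)// oppr_ge0 subr_le0.
by apply: gm; move: e0 e1; rewrite /d; lra.
Qed.

Lemma derive_max g x l : (forall y : R, derivable g y 1) -> is_derive x 1 g l ->
  (forall u : R, g u <= g x) -> l = 0.
Proof.
move=> dg [_ <-] gm; have [|||_] := @derive1_at_max R g (x - 1) (x + 1) x _ _ _ (fun u _ => gm u) => //.
  by lra.
by rewrite in_itv/=; apply/andP; split; lra.
Qed.
End Maxima.

Lemma mulr_powR_gt0 {R : realType} (x a : R) : 0 < x -> x * x `^ a = x `^ (1 + a).
Proof. by move=> x0; rewrite powRD ?(gt_eqF x0) ?implybT// powRr1// ltW. Qed.

Section Constants.
Context {R : realType}.
Implicit Types (s r E : R).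

(* At a spatial maximum of height N the velocity field has divergence at most [1 - compression_rate s E * N `^ (2 - q)], q = 2 s - 1. *)
Definition compression_rate s E :=
  riesz_const s * (- (2 * s - 1)) * ((1 - (2 * s - 1)) * mass_bd s E) `^ (2 * s - 1 - 1).

(* The factor 2 is the inverse length of the time window [t - 1 / 2, t] used in the maximum principle. *)
Definition sup_const s E := 2 * (2 / compression_rate s E) `^ (2 - (2 * s - 1))^-1.

(** Bounds the self energy of rho^r: rho^r is at most [sup_const ^ (r - 1)] times rho, the energy is
    quadratic, and that of rho, multiplied by the Riesz constant, is at most 2 E. *)
Definition self_const s r E := (sup_const s E `^ (r - 1)) ^+ 2 * (2 * E).

(** The first term serves both as starting value of the comparison at t = 1 and as bound on ]0, 1[;
    the second collects the forcing. *)
Definition decay_const s r E := expR 2 * E + self_const s r E / 2.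

End Constants.

Section PowerCalculus.
Context {R : realType}.
Local Notation mu := (@lebesgue_measure R).
Implicit Types (g : R -> R) (x y p K : R).

(** The absolute value gives a two-sided derivative at 0, where masses and densities may vanish; on
    negative reals [powR] is not a power. *)
Lemma is_derive_abs_powR p x : 1 < p -> 0 <= x -> is_derive x 1 (fun y => `|y| `^ p) (p * x `^ (p - 1)).
Proof.
move=> p1; rewrite le_eqVlt => /predU1P[<-|x0]; last first.
  apply: is_derive_near (is_derive1_powR p x0).
  near=> y; have y0 : 0 < y by near: y; exact: lt_nbhsr.
  by rewrite ger0_norm// ltW.
have p0 : p - 1 != 0 by rewrite gt_eqF// subr_gt0.
have pp : p != 0 by rewrite gt_eqF//; lra.
rewrite powR0// mulr0; apply: is_derive_seq => t t0 tc.
apply/cvgr0Pnorm_lt => e e0.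
have tp : (forall n, 0 < `|t n|) /\ `|t n| @[n --> \oo] --> (0 : R).
  by split => [n|]; [rewrite normr_gt0|rewrite -(normr0 R); exact: cvg_norm].
have p10 : 0 < p - 1 by lra.
have /cvg_at_rightP H := @powR_cvg0 R (p - 1) p10.
have /cvgr0Pnorm_lt/(_ e e0) := H _ tp.
apply: filterS => n; rewrite addr0 normr0 powR0// subr0 normrM normfV.
rewrite (ger0_norm (powR_ge0 _ (p - 1))) (ger0_norm (powR_ge0 _ p)) -(@mulr_powRB1 _ `|t n| p)//; last lra.
by rewrite mulKf// normr_eq0.
Unshelve. all: by end_near. Qed.

Lemma powR_tangent p x y : 1 < p -> 0 <= x -> x <= y ->
  x `^ p + p * x `^ (p - 1) * (y - x) <= y `^ p <= x `^ p + p * y `^ (p - 1) * (y - x).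
Proof.
move=> p1 x0; rewrite le_eqVlt => /predU1P[<-|xy]; first by rewrite subrr !mulr0 addr0 lexx.
have y0 : 0 < y by exact: le_lt_trans xy.
have D z : x <= z <= y -> is_derive z 1 (fun y => `|y| `^ p) (p * z `^ (p - 1)).
  by move=> /andP[xz _]; apply: is_derive_abs_powR => //; exact: le_trans xz.
have [z /andP[xz zy]] := mvt_eq xy D.
rewrite (ger0_norm x0) (ger0_norm (ltW y0)) => E.
have z0 : 0 <= z by exact: le_trans (ltW xz).
have -> : y `^ p = x `^ p + p * z `^ (p - 1) * (y - x) by rewrite -E; ring.
have p0 : 0 <= p by lra.
rewrite !lerD2l; apply/andP; split; apply: ler_wpM2r; rewrite ?subr_ge0 ?(ltW xy)//; apply: ler_wpM2l => //.
  by apply: ge0_ler_powR; rewrite ?nnegrE ?(ltW xz) ?subr_ge0 ?(ltW p1).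
by apply: ge0_ler_powR; rewrite ?nnegrE ?(ltW zy) ?subr_ge0 ?(ltW p1) ?(ltW y0).
Qed.

Lemma powR_tangent_le p (N M d : R) : 1 < p -> 0 <= N -> N <= M -> 0 <= d ->
  N `^ p + p * N `^ (p - 1) * d <= (M + d) `^ p.
Proof.
move=> p1 N0 NM d0; have Nd : N <= d + N by rewrite lerDr.
have /andP[+ _] := powR_tangent p1 N0 Nd; rewrite addrK => H.
apply: (le_trans H); apply: ge0_ler_powR; rewrite ?nnegrE; first lra.
- by rewrite addr_ge0.
- by rewrite addr_ge0// (le_trans N0).
- by rewrite addrC lerD2r.
Qed.

Lemma Int_ball K g : (forall x, {for x, continuous g}) -> Int (fun x => (`|x| <= K)%R%:R * g x).
Proof.
move=> cg; have [D HD] := cont_bounded (- K) K cg.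
have [K0|K0] := ltP K 0.
  by apply: eq_Int (@Int0 R) => x; rewrite leNgt (lt_le_trans K0)// mul0r.
have KK : - K - 1 <= K by lra.
have [I1 _] := int_itv_len KK.
apply: (Int_dom _ (IntZ `|D| I1)).
  by apply: measurable_funM; [exact: measurable_leb|exact: continuous_meas].
move=> x; have [xK|xK] := leP `|x| K; last by rewrite mul0r normr0 mulr_ge0.
have xx : - K <= x <= K by rewrite -ler_norml.
rewrite (_ : (- K - 1 < x <= K) = true); last by lra.
by rewrite mul1r mulr1; apply: le_trans (HD x xx) _; exact: ler_norm.
Qed.

Lemma int_ball_ftc K g (F : R -> R) : 0 < K -> (forall x, {for x, continuous g}) ->
  (forall x : R, is_derive x 1 F (g x)) -> \int[mu]_x ((`|x| <= K)%R%:R * g x) = F K - F (- K).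
Proof.
move=> K0 cg dF; apply: EFin_inj; rewrite EFin_int; last exact: Int_ball.
have KK : - K < K by lra.
rewrite -(@ftc_ab R g F _ _ KK)//.
rewrite -(integral_bool (fun x : R => `|x| <= K)).
by congr (integral _ _ _); apply/seteqP; split => x /=; rewrite in_itv/= -ler_norml.
Qed.

End PowerCalculus.

(** * Scalar inequalities and the Gronwall comparison *)

Section Arithmetic.
Context {R : realType}.

(** The second-order comparison with a perturbation of size e T, divided by T. Here e stands for the
    time factor of the absorption and T for 1 + t. *)
Lemma absorption_arith (H Np m a e T A G Q D : R) : 0 < T -> Q <= D ->
  m * (Np + a * (e * T * G)) <= H + e * T * A + (e * T) ^+ 2 / 2 * Q ->
  - (e * A) + m * a * (e * G) <= (H - m * Np) / T + e ^+ 2 * T * D / 2.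
Proof.
move=> T0 QD Hm.
have H1 : (e * T) ^+ 2 / 2 * Q <= (e * T) ^+ 2 / 2 * D by rewrite ler_wpM2l// divr_ge0 ?sqr_ge0.
rewrite -(ler_pM2r T0) mulrDl [(H - m * Np) / T + _]addrC mulrDl divfK ?gt_eqF//.
have -> : e ^+ 2 * T * D / 2 * T = (e * T) ^+ 2 / 2 * D by field.
move: H1 Hm; rewrite !mulrDr; lra.
Qed.

Lemma double_le (H I X : R) : H - 1 / 2 * I <= X -> 2 * (H - X) <= I.
Proof. lra. Qed.

Lemma sub_le_of_le_add (a b d : R) : a <= b + d -> a - b <= d.
Proof. lra. Qed.

(** A share C k of the dissipation is set aside for the flux through the cut-off, with k = 1 / K.
    The rest still yields 2 y up to an error of order k, which includes the mass missed by the
    cut-off. *)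
Lemma dissipation_arith (I H m Mp Np E C k : R) : 0 <= C -> 0 <= k <= 1 -> C * k <= 1 ->
  0 <= E -> 2 * (H - m * Mp) <= I -> m * (Mp - Np) <= C * (2 * E * k ^+ 2) -> 0 <= m * Np -> H <= E ->
  - I + C * k * I <= - (2 * (H - m * Np)) + 6 * C * E * k.
Proof.
move=> C0 /andP[k0 k1] Ck E0 HI HM Np0 HE.
have Ck0 : 0 <= C * k by rewrite mulr_ge0.
have CE : 0 <= C * E by rewrite mulr_ge0.
set y := H - m * Np; have yE : y <= E by rewrite /y; lra.
have H1 : (1 - C * k) * (2 * y - 2 * (C * (2 * E * k ^+ 2))) <= (1 - C * k) * I.
  by apply: ler_wpM2l; [lra|move: HI HM; rewrite /y mulrBr; lra].
have H2 : C * k * y <= C * k * E by rewrite ler_wpM2l.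
have kk : k ^+ 2 <= k by rewrite expr2 ler_piMl.
have H3 : (1 - C * k) * (C * (2 * E * k ^+ 2)) <= 2 * (C * E * k).
  apply: (@le_trans _ _ (1 * (C * (2 * E * k ^+ 2)))).
    apply: ler_wpM2r; last lra.
    by rewrite mulr_ge0// mulr_ge0 ?sqr_ge0// mulr_ge0.
  have := ler_wpM2l CE kk; lra.
move: H1 H2 H3; rewrite !mulrBl !mul1r !mulrBr; lra.
Qed.
End Arithmetic.

Section Gronwall.
Context {R : realType}.

Lemma entropy_slope_arith (I e A a m N' k M G T D C E y : R) :
  0 <= m * a <= C -> 0 <= k -> 0 <= I -> 0 <= M ->
  - (k * (M + I)) - e * G <= N' ->
  - I + C * k * I <= - (2 * y) + 6 * C * E * k ->
  - (e * A) + m * a * (e * G) <= y / T + e ^+ 2 * T * D / 2 ->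
  - I - e * A - m * (a * N') <= - (2 * y) + y / T + e ^+ 2 * T * D / 2 + (6 * C * E + C * M) * k.
Proof.
move=> /andP[ma0 maC] k0 I0 M0 HN HI HA.
have H1 : m * a * (- (k * (M + I)) - e * G) <= m * a * N' by rewrite ler_wpM2l.
have H2 : m * a * (k * (M + I)) <= C * (k * (M + I)).
  by rewrite ler_wpM2r// mulr_ge0// addr_ge0.
move: H1 H2; rewrite !mulrBr !mulrDr !mulrN; lra.
Qed.

(* Comparison for [exp (2 u) * y u / (1 + u)]. *)
Lemma gronwall_decay (y dy : R -> R) (l b D C t : R) : 1 <= t -> 0 <= D -> 0 <= C -> b <= 1 -> b <= l ->
  (forall u : R, 1 <= u -> is_derive u 1 y (dy u)) ->
  (forall u : R, 1 <= u -> dy u <= - (2 * y u) + y u / (1 + u) + expR (- (l * u)) ^+ 2 * (1 + u) * D / 2 + C) ->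
  y t <= (1 + t) * expR (- (2 * t)) * (expR 2 * y 1 / 2 + t * (D / 2 * expR (2 * (1 - b) * t) + C * expR (2 * t))).
Proof.
move=> t1 D0 C0 b1 bl ydy Hy.
pose z u := expR (2 * u) * (y u / (1 + u)).
pose dz u := expR (2 * u) * (2 * (y u / (1 + u)) + dy u / (1 + u) - y u / (1 + u) ^+ 2).
have zdz (u : R) : 1 <= u -> is_derive u 1 z (dz u).
  move=> u1; have u0 : 1 + u != 0 by apply/eqP; lra.
  have d2 : is_derive u 1 (fun u : R => 2 * u) 2.
    have [a1 a2] := is_deriveZ (2 : R) (is_derive_id u (1 : R)).
    by split => //; rewrite a2 /GRing.scale/= mulr1.
  have dE := @is_derive1_comp R expR (fun u : R => 2 * u) u _ _ (is_derive_expR _) d2.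
  have d1 : is_derive u 1 (fun u : R => 1 + u) 1.
    have [a1 a2] := is_deriveD (is_derive_cst (1 : R) u 1) (is_derive_id u (1 : R)).
    by split => //; rewrite a2 add0r.
  have [a1 a2] := is_deriveM dE (is_deriveM (ydy u u1) (is_deriveV u0 d1)).
  by split => //; rewrite a2 /GRing.scale/= -[(y * _) u]/(y u * (1 + u)^-1) /dz; field.
have B0 : 0 <= D / 2 * expR (2 * (1 - b) * t) + C * expR (2 * t).
  by rewrite addr_ge0// mulr_ge0 ?expR_ge0 ?divr_ge0.
have dz_le u : 1 <= u <= t -> dz u <= D / 2 * expR (2 * (1 - b) * t) + C * expR (2 * t).
  move=> /andP[u1 ut]; have T0 : 0 < 1 + u by lra.
  (* exp (2 u) / (1 + u) is the integrating factor of y' = - 2 y + y / (1 + u), so only the forcing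
     remains. *)
  have -> : dz u = expR (2 * u) * ((dy u - (- (2 * y u) + y u / (1 + u))) / (1 + u)).
    by rewrite /dz; field; rewrite gt_eqF.
  have H1 : (dy u - (- (2 * y u) + y u / (1 + u))) / (1 + u) <= expR (- (l * u)) ^+ 2 * (D / 2) + C.
    rewrite ler_pdivrMr//.
    have := Hy u u1; have : C * 1 <= C * (1 + u) by rewrite ler_wpM2l//; lra.
    by rewrite mulrDl; lra.
  apply: (le_trans (ler_wpM2l (expR_ge0 _) H1)).
  rewrite mulrDr; apply: lerD; last by rewrite mulrC ler_wpM2l// ler_expR; lra.
  have -> : expR (2 * u) * (expR (- (l * u)) ^+ 2 * (D / 2)) = D / 2 * expR (2 * ((1 - l) * u)).
    by rewrite mulrA mulrC; congr (_ * _); rewrite expr2 -!expRD; congr expR; ring.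
  apply: ler_wpM2l; first by rewrite divr_ge0.
  (* Lowering l to b <= 1 makes the exponent nonnegative, hence largest at u = t. *)
  rewrite ler_expR -mulrA ler_wpM2l//; apply: (@le_trans _ _ ((1 - b) * u)).
    by rewrite ler_wpM2r//; lra.
  by rewrite ler_wpM2l// subr_ge0.
have H : z t <= z 1 + t * (D / 2 * expR (2 * (1 - b) * t) + C * expR (2 * t)).
  move: t1; rewrite le_eqVlt => /predU1P[tE|t1].
    by rewrite -tE in B0 *; rewrite lerDl mulr_ge0.
  have [v /andP[v1 v2] E] := mvt_eq t1 (fun u hu => zdz u (proj1 (andP hu))).
  have := dz_le v; rewrite (ltW v1) (ltW v2) => /(_ isT) Hv.
  have -> : z t = z 1 + dz v * (t - 1) by rewrite -E; ring.
  rewrite lerD2l; apply: (@le_trans _ _ ((D / 2 * expR (2 * (1 - b) * t) + C * expR (2 * t)) * (t - 1))).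
    by rewrite ler_wpM2r// subr_ge0 ltW.
  by rewrite mulrC ler_wpM2r//; lra.
have -> : y t = (1 + t) * expR (- (2 * t)) * z t.
  have e0 : expR (2 * t) != 0 by rewrite gt_eqF ?expR_gt0.
  have u0 : 1 + t != 0 by apply/eqP; lra.
  by rewrite /z expRN; field; rewrite ?e0 ?u0.
apply: ler_wpM2l; first by rewrite mulr_ge0 ?expR_ge0//; lra.
by move: H; rewrite {2}/z mulr1 mulrA.
Qed.

Lemma half_mul_le (e y E : R) : 0 <= e -> 0 <= E -> y <= E -> e * y / 2 <= e * E.
Proof. by move=> e0 E0 yE; have := ler_wpM2l e0 yE; have := mulr_ge0 e0 E0; lra. Qed.

Lemma le_of_inv_error (X Y Z K0 : R) : (forall K, K0 <= K -> 1 <= K -> X <= Y + Z * K^-1) -> X <= Y.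
Proof.
move=> H; apply/ler_addgt0Pr => e e0.
pose K := `|K0| + 1 + `|Z| / e.
have q0 : 0 <= `|Z| / e by rewrite divr_ge0// ltW.
have K1 : 1 <= K by rewrite /K; have := normr_ge0 K0; lra.
have KK : K0 <= K by rewrite /K; have := ler_norm K0; lra.
apply: (le_trans (H K KK K1)); rewrite lerD2l ler_pdivrMr; last lra.
apply: (le_trans (ler_norm Z)); rewrite -ler_pdivrMl// mulrC /K; have := normr_ge0 K0; lra.
Qed.
End Gronwall.

(** * Decay along the flow *)

Section Solution.
Context {R : realType}.
Local Notation mu := (@lebesgue_measure R).
Variables (s r : R) (rho : R -> R -> R).
Hypothesis hs : 0 < s < 1 / 2.
Hypothesis hr : 4 - 2 * s < r.
Hypothesis rho_ge0 : forall x t, 0 < t -> 0 <= rho x t.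
Hypothesis rho_smooth : smooth_on half_space rho.
Hypothesis rho_vanishes : vanishes_at_infinity rho.
Hypothesis rho_solves : solves_equation s r rho.
Hypothesis rho_entropy : entropy_identity s r rho.
Implicit Types (x y t : R) (w : seq bool).

Local Notation q := (2 * s - 1).
Local Notation c := (riesz_const s).
Local Notation f t := (rho ^~ t).
Local Notation E0 := (entropy s (f 0)).
Local Notation M' := (mass_bd s E0).
Let q0 : q < 0. Proof. by have := hs; lra. Qed.
Let q1 : -1 < q. Proof. by have := hs; lra. Qed.
Let c0 : 0 < c. Proof. exact: riesz_const_gt0. Qed.
Let c_ge0 : 0 <= c. Proof. exact: ltW. Qed.

Lemma partial_cont w x t : 0 < t -> {for (x, t), continuous (fun z : R * R => partial w rho z.1 z.2)}.
Proof. by move=> t0; have [] := rho_smooth w (z := (x, t)) t0. Qed.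

Lemma partial_x w x t : 0 < t -> is_derive x 1 (partial w rho ^~ t) (partial (false :: w) rho x t).
Proof.
move=> t0; have [_ d _] := rho_smooth w (z := (x, t)) t0.
by split => //=; rewrite /d_space derive1E.
Qed.

Lemma partial_t w x t : 0 < t -> is_derive t 1 (partial w rho x) (partial (true :: w) rho x t).
Proof.
move=> t0; have [_ _ d] := rho_smooth w (z := (x, t)) t0.
by split => //=; rewrite /d_time derive1E.
Qed.

Lemma partial_cont_x w x t : 0 < t -> {for x, continuous (partial w rho ^~ t)}.
Proof. by move=> t0; exact: is_derive_continuous (partial_x w x t0). Qed.

Lemma slice_bounded t : 0 < t -> exists B, forall x, f t x <= B.
Proof.
move=> t0; have [K HK] := rho_vanishes t t0 ltr01.
have [D HD] := cont_bounded (- K) K (fun x => partial_cont_x (w := [::]) (x := x) t0).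
exists (1 + `|D|) => x; apply: le_trans (ler_norm _) _.
have [xK|xK] := leP K `|x|.
  by apply: (le_trans (HK x t _ xK)); [rewrite !lexx|rewrite lerDl].
apply: (@le_trans _ _ D); first by apply: HD; move: xK; rewrite ltr_norml; lra.
by apply: le_trans (ler_norm _) _; rewrite lerDr.
Qed.

Lemma slice_nice t : 0 < t -> nice (f t) /\ Int (fun x => x ^+ 2 * f t x).
Proof.
move=> t0; apply: (nice_of_entropy hs).
- by move=> x; exact: (partial_cont_x (w := [::]) (x := x) t0).
- by move=> x; exact: rho_ge0.
- exact: slice_bounded.
- by have [H _ _ _] := rho_entropy; apply: H; exact: ltW.
Qed.

Let rx := partial [:: false] rho.
Let rxx := partial [:: false; false] rho.

Lemma slice_dx t x : 0 < t -> is_derive x 1 (f t) (rx x t).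
Proof. exact: (partial_x [::]). Qed.
Lemma slice_dxx t x : 0 < t -> is_derive x 1 (rx ^~ t) (rxx x t).
Proof. exact: (partial_x [:: false]). Qed.
Lemma slice_cxx t x : 0 < t -> {for x, continuous (rxx ^~ t)}.
Proof. exact: (partial_cont_x (w := [:: false; false]) (x := x)). Qed.

Definition vel t y := c * dpot0 q (f t) y + y.
Definition decay t := expR (- (lambda s * delta s r * t)).

Lemma derive1_riesz_slice t x : 0 < t -> derive1 (riesz s (f t)) x + x = vel t x.
Proof.
move=> t0; have [nf _] := slice_nice t0.
by rewrite (derive1_riesz hs x nf (fun x => slice_dx x t0) (fun x => slice_dxx x t0) (fun x => slice_cxx (x:=x) t0)).
Qed.

Lemma vel_derive t x : 0 < t -> is_derive x 1 (vel t) (c * ddpot0 q (f t) x + 1).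
Proof.
move=> t0; have [nf _] := slice_nice t0.
have D := dpot0_derive q0 q1 nf (fun x => slice_dx x t0) (fun x => slice_dxx x t0) (fun x => slice_cxx (x:=x) t0) x.
exact: is_deriveD (is_deriveZ c D) (is_derive_id x 1).
Qed.

Lemma flux_derive t x : 0 < t ->
  is_derive x 1 (fun y => f t y * vel t y) (rx x t * vel t x + f t x * (c * ddpot0 q (f t) x + 1)).
Proof.
move=> t0; have [u v] := is_deriveM (slice_dx x t0) (vel_derive x t0).
by split => //; rewrite v /GRing.scale/=; ring.
Qed.

Lemma time_derivative t x : 0 < t ->
  d_time rho x t + decay t * f t x `^ r = rx x t * vel t x + f t x * (c * ddpot0 q (f t) x + 1).
Proof.
move=> t0; rewrite (rho_solves x t0) subrK.
have -> : (fun x' => rho x' t * (derive1 (riesz s (f t)) x' + x')) = fun y => f t y * vel t y.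
  by apply/funext => y; rewrite derive1_riesz_slice.
by rewrite derive1E; have [_ ->] := flux_derive x t0.
Qed.

Lemma dissipationE t : 0 < t ->
  Int (fun x => f t x * vel t x ^+ 2) /\ dissipation s (f t) = \int[mu]_x (f t x * vel t x ^+ 2).
Proof.
move=> t0; have E : dissipation_density s (f t) = fun x => f t x * vel t x ^+ 2.
  by apply/funext => x; rewrite /dissipation_density derive1_riesz_slice.
have [_ H _ _] := rho_entropy; have [I _] := H t t0.
by rewrite /dissipation -E.
Qed.

Lemma dissipation_ge0 t : 0 < t -> 0 <= dissipation s (f t).
Proof. by move=> t0; apply: int_ge0 => x; rewrite mulr_ge0 ?sqr_ge0// rho_ge0. Qed.

Lemma absorption_ge0 t : 0 < t -> 0 <= absorption s r (f t).
Proof.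
move=> t0; apply: int_ge0 => x; apply: mulr_ge0; first exact: powR_ge0.
rewrite rieszE; apply: addr_ge0; last by rewrite divr_ge0 ?sqr_ge0.
by apply: mulr_ge0 => //; apply: pot_ge0 => y; exact: rho_ge0.
Qed.

Lemma entropy_nonincreasing t u : 0 < t -> t < u -> entropy s (f u) <= entropy s (f t).
Proof.
move=> t0 tu; have [_ _ H _] := rho_entropy.
have [v /andP[tv vu]] := @mvt_eq R (fun t => entropy s (f t)) _ t u tu (fun v hv => H v (lt_le_trans t0 (proj1 (andP hv)))).
have v0 : 0 < v by exact: lt_trans tv.
move=> E; rewrite -subr_le0 E; apply: mulr_le0_ge0; last by rewrite subr_ge0 ltW.
have := dissipation_ge0 v0; have := mulr_ge0 (expR_ge0 (- (lambda s * delta s r * v))) (absorption_ge0 v0).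
lra.
Qed.

(** Monotonicity holds on positive times; the right limit at 0 in [entropy_identity] extends the
    comparison to the initial datum. *)
Lemma entropy_le t : 0 < t -> Ent q c (f t) <= E0.
Proof.
move=> t0; have [nf I2] := slice_nice t0; rewrite -(entropyE hs nf I2).
have [_ _ _ H] := rho_entropy; rewrite leNgt; apply/negP => H0.
have N := cvgr_lt _ H _ H0.
near (0 : R)^'+ => u.
have u0 : 0 < u by near: u; exact: nbhs_right_gt.
have ut : u < t by near: u; exact: nbhs_right_lt.
have := entropy_nonincreasing u0 ut; rewrite leNgt => /negP; apply.
by near: u; exact: N.
Unshelve. all: by end_near. Qed.

Lemma E0_ge0 : 0 <= E0.
Proof.
apply: le_trans (entropy_le ltr01); apply: Ent_ge0 => // x; exact: rho_ge0.
Qed.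

Lemma mass_le_bd t : 0 < t -> 0 <= mass (f t) <= M'.
Proof.
move=> t0; have [nf I2] := slice_nice t0.
rewrite (mass_le hs nf I2 (entropy_le t0)) andbT; apply: int_ge0 => x; exact: rho_ge0.
Qed.

Lemma mass_bd_ge1 : 1 <= M'.
Proof.
have e0 := E0_ge0; rewrite /mass_bd -addrA lerDl; apply: addr_ge0; last by rewrite mulr_ge0.
by apply: divr_ge0; [rewrite mulr_ge0|apply: mulr_ge0 => //; exact: powR_ge0].
Qed.

(** * A sup bound from the maximum principle *)

Local Notation kappa := (compression_rate s E0).
Local Notation sup_bd := (sup_const s E0).

Lemma kappa_gt0 : 0 < kappa.
Proof.
apply: mulr_gt0; first by apply: mulr_gt0 => //; rewrite oppr_gt0.
by apply: powR_gt0; apply: mulr_gt0; [have := q1; have := q0; lra|exact: lt_le_trans mass_bd_ge1].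
Qed.

Lemma sup_bd_ge0 : 0 <= sup_bd.
Proof. by rewrite mulr_ge0 ?powR_ge0. Qed.

Lemma velocity_div_max t x : 0 < t -> (forall y, f t y <= f t x) -> 0 < f t x ->
  c * ddpot0 q (f t) x <= - kappa * f t x `^ (2 - q).
Proof.
move=> t0 mx fx; have [nf _] := slice_nice t0.
have M1 : 0 < M' by exact: lt_le_trans mass_bd_ge1.
have q2 : 0 < 1 - q by have := q0; lra.
(* This [eta] makes the negative term of [ddpot0_max] twice the positive one. *)
pose eta := (1 - q) * M' / f t x.
have e0 : 0 < eta by rewrite divr_gt0// mulr_gt0.
have H := ddpot0_max q0 q1 nf (fun x => slice_dx x t0) (fun x => slice_dxx x t0) (fun x => slice_cxx (x:=x) t0) e0 mx.
have /andP[m0 m1] := mass_le_bd t0.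
have qq : 0 <= q * (q - 1) by apply: mulr_le0; [exact: ltW|have := q0; lra].
have H2 : ddpot0 q (f t) x <= 2 * q * eta `^ (q - 1) * f t x + q * (q - 1) * eta `^ (q - 2) * M'.
  apply: (le_trans H); rewrite lerD2l; apply: ler_wpM2l => //.
  by rewrite mulr_ge0 ?powR_ge0.
have E1 : eta `^ (q - 1) = eta * eta `^ (q - 2).
  by rewrite [q - 2](_ : _ = (q - 1) - 1) ?mulr_powR_gt0//; [congr (_ `^ _)|]; ring.
have E2 : eta * f t x = (1 - q) * M' by rewrite /eta divfK// gt_eqF.
have E3 : 2 * q * eta `^ (q - 1) * f t x + q * (q - 1) * eta `^ (q - 2) * M' = q * (eta `^ (q - 1) * f t x).
  have -> : eta `^ (q - 1) * f t x = eta `^ (q - 2) * (eta * f t x) by rewrite E1; ring.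
  transitivity (2 * q * eta `^ (q - 2) * (eta * f t x) + q * (q - 1) * eta `^ (q - 2) * M').
    by rewrite E1; ring.
  by rewrite E2; ring.
have E4 : eta `^ (q - 1) * f t x = ((1 - q) * M') `^ (q - 1) * f t x `^ (2 - q).
  rewrite /eta powRM ?invr_ge0 ?(ltW fx)//; last by rewrite ltW// mulr_gt0.
  rewrite -mulrA; congr (_ * _); rewrite -powR_inv1 ?ltW// -powRrM mulrC mulr_powR_gt0//.
  by congr (_ `^ _); ring.
have := ler_wpM2l c_ge0 H2; rewrite E3 E4 /compression_rate; congr (_ <= _); ring.
Qed.

Lemma max_principle_arith (N h l k B : R) : 0 < N -> 0 < h <= 1 -> 0 <= l * h + N ->
  l <= N * (- k * B + 1) -> k * B * h <= 2.
Proof.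
move=> N0 /andP[h0 h1] H1 H2.
have H3 : 0 <= N * (- k * B + 1) * h + N.
  by apply: le_trans H1 _; rewrite lerD2r ler_wpM2r// ltW.
have : 0 <= N * (h - k * B * h + 1) by move: H3; congr (_ <= _); ring.
by rewrite pmulr_rge0//; lra.
Qed.

(** Uniform vanishing at infinity, at the level rho (x0, t), reduces the strip to a compact
    rectangle that contains (x0, t). The weight u - (t - 1/2) is zero at the lower edge, which keeps
    the maximum off it. *)
Lemma window_max t x0 : 1 <= t -> 0 < f t x0 -> exists z : R * R,
  [/\ t - 1 / 2 < z.2 <= t,
     forall y u, t - 1 / 2 <= u <= t -> f u y * (u - (t - 1 / 2)) <= f z.2 z.1 * (z.2 - (t - 1 / 2)) & 0 < f z.2 z.1].
Proof.
move=> t1 fx; set t0 := t - 1 / 2.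
have t00 : 0 < t0 by rewrite /t0; lra.
pose F (z : R * R) := rho z.1 z.2 * (z.2 - t0).
have [K HK] := rho_vanishes t t00 fx.
pose L := `|K| + `|x0|.
have ne : (`[- L, L] `*` `[t0, t])%classic !=set0.
  exists (x0, t); split => /=; rewrite in_itv/=; last by rewrite /t0; apply/andP; split; lra.
  by rewrite /L -ler_norml lerDr.
have cp : compact (`[- L, L] `*` `[t0, t])%classic by apply: compact_setX; exact: segment_compact.
have [|z zA zm] := compact_EVT_max ne cp (_ : {within _, continuous F}).
  apply: continuous_in_subspaceT => -[x u]; rewrite inE => -[_ /=]; rewrite in_itv/= => /andP[u1 _].
  have u0 : 0 < u by exact: lt_le_trans u1.
  rewrite /F; apply: cvgM; first exact: (partial_cont (w := [::]) (x := x) u0).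
  by apply: cvgB; [exact: cvg_snd|exact: cvg_cst].
have Fx : 0 < F (x0, t) by rewrite /F/= mulr_gt0// /t0; lra.
have Fz : F (x0, t) <= F z.
  apply: zm; rewrite inE; split => /=; rewrite in_itv/=; last by rewrite /t0; apply/andP; split; lra.
  by rewrite /L -ler_norml lerDr.
move: zA; rewrite inE => -[z1 z2]; move: z1 z2; rewrite /= !in_itv/= => z1 /andP[z2 z3].
have Fzp : 0 < F z by exact: lt_le_trans Fz.
have zt : t0 < z.2.
  by rewrite lt_neqAle z2 andbT; apply/eqP => E; move: Fzp; rewrite /F -E subrr mulr0 ltxx.
exists z; split; first by rewrite zt.
  move=> y u ut; have [yL|yL] := leP `|y| L.
    by apply: (zm (y, u)); rewrite inE; split => /=; rewrite in_itv//= -ler_norml.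
  apply: le_trans Fz; rewrite /F/=; have /andP[u1 u2] := ut.
  have Ky : K <= `|y|.
    by apply: (le_trans (ler_norm K)); apply: le_trans (ltW yL); rewrite /L lerDl.
  apply: ler_pM; [by apply: rho_ge0; exact: lt_le_trans u1|by rewrite subr_ge0| |by rewrite lerD2r].
  by apply: le_trans (ler_norm _) _; exact: HK.
by move: Fzp; rewrite /F pmulr_lgt0// subr_gt0.
Qed.

(* Maximum principle for [rho x u * (u - (t - 1/2))] on the strip [t - 1/2 <= u <= t]. *)
Lemma slice_sup t x : 1 <= t -> f t x <= sup_bd.
Proof.
move=> t1; have [fx|fx] := leP (f t x) 0; first exact: le_trans fx sup_bd_ge0.
have [[y u] /= [/andP[u1 u2] mx fyu]] := window_max t1 fx.
set t0 := t - 1 / 2 in u1 u2 mx.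
have u0 : 0 < u by rewrite /t0 in u1; lra.
pose h := u - t0; have h0 : 0 < h by rewrite subr_gt0.
have h1 : h <= 1 by rewrite /h /t0; lra.
have mxy z : f u z <= f u y by have := mx z u; rewrite (ltW u1) u2 => /(_ isT); rewrite ler_pM2r.
have rx0 : rx y u = 0.
  apply: (derive_max _ (slice_dx y u0) mxy) => z; by have [] := slice_dx z u0.
have dt : is_derive u 1 (fun v => rho y v * (v - t0)) (d_time rho y u * h + rho y u).
  have Did : is_derive u 1 (fun v : R => v - t0) 1.
    have [a b] := is_deriveB (is_derive_id u 1) (is_derive_cst t0 u 1).
    by split => //; rewrite b subr0.
  have [a b] := is_deriveM (partial_t [::] y u0) Did.
  by split => //; rewrite b /GRing.scale/= mulr1 addrC [X in X + _]mulrC.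
have H1 : 0 <= d_time rho y u * h + rho y u.
  apply: (derive_left_max u1 dt) => v /andP[v1 v2]; apply: mx.
  by rewrite (ltW v1) (le_trans v2).
have H2 : d_time rho y u <= f u y * (- kappa * f u y `^ (2 - q) + 1).
  have := time_derivative y u0; rewrite rx0 mul0r add0r => E.
  have : 0 <= decay u * f u y `^ r by rewrite mulr_ge0 ?powR_ge0 ?expR_ge0.
  have := ler_wpM2l (ltW fyu) (velocity_div_max u0 mxy fyu).
  rewrite !mulrDr mulr1 in E *; lra.
have k0 := kappa_gt0.
have H3 : kappa * f u y `^ (2 - q) * h <= 2.
  by apply: (max_principle_arith fyu _ H1 H2); rewrite h0.
have q2 : 1 <= 2 - q by have := q0; lra.
(* Since h <= 1 <= 2 - q, the power [h ^ (2 - q)] is at most h, so the single factor h of the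
   previous bound suffices. *)
have H4 : (f u y * h) `^ (2 - q) <= 2 / kappa.
  rewrite ler_pdivlMr// powRM ?(ltW fyu) ?(ltW h0)// mulrC mulrA; apply: le_trans H3.
  apply: ler_wpM2l; first by rewrite mulr_ge0 ?(ltW k0) ?powR_ge0.
  by apply: ge1r_powR => //; rewrite h0.
have H5 : f u y * h <= (2 / kappa) `^ (2 - q)^-1.
  have p0 : 0 <= f u y * h by rewrite mulr_ge0 ?(ltW fyu) ?(ltW h0).
  rewrite -(powRr1 p0) -[X in _ `^ X](mulfV (_ : 2 - q != 0)); last by rewrite gt_eqF//; lra.
  rewrite powRrM; apply: ge0_ler_powR => //; rewrite ?nnegrE ?powR_ge0 ?invr_ge0//.
  - lra.
  - by rewrite divr_ge0 ?(ltW k0).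
have H6 := mx x t; rewrite lexx andbT /t0 in H6.
have : f t x * (t - (t - 1 / 2)) <= f u y * h by apply: H6; lra.
rewrite /sup_const; lra.
Qed.

Local Notation ld := (lambda s * delta s r).
Local Notation p := (p_exp q).
Local Notation m1 := (ment q c).

Let r1 : 1 < r. Proof. by have := hr; have := hs; lra. Qed.
Let p1 : 1 < p. Proof. exact: p_exp_gt1. Qed.
Let m10 : 0 <= m1. Proof. exact: ment_ge0. Qed.

Local Notation L := (sup_bd `^ (r - 1)).
Definition pw t x := f t x `^ r.

Lemma pw_le t x : 1 <= t -> 0 <= pw t x <= L * f t x.
Proof.
move=> t1; have t0 : 0 < t by lra.
rewrite powR_ge0 /= /pw -(mulr_powRB1 (rho_ge0 x t0)); last by have := r1; lra.
rewrite mulrC; apply: ler_wpM2r; first exact: rho_ge0.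
apply: ge0_ler_powR; rewrite ?nnegrE ?rho_ge0 ?sup_bd_ge0 ?slice_sup//; have := r1; lra.
Qed.

Lemma pw_nice t : 1 <= t -> nice (pw t) /\ Int (fun x => x ^+ 2 * pw t x).
Proof.
move=> t1; have t0 : 0 < t by lra.
have [[mf _ If] I2] := slice_nice t0.
have mp : measurable_fun setT (pw t) by apply: measurableT_comp (measurable_powR _) mf.
have Ip : Int (pw t).
  apply: (Int_dom mp (IntZ L If)) => x; have /andP[a b] := pw_le x t1; by rewrite ger0_norm.
split; last first.
  apply: (Int_dom _ (IntZ L I2)); first by apply: measurable_funM => //; exact: meas_sq.
  move=> x; have /andP[a b] := pw_le x t1.
  rewrite ger0_norm; last by rewrite mulr_ge0 ?sqr_ge0.
  by rewrite mulrCA; apply: ler_wpM2l => //; exact: sqr_ge0.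
split => //; exists (L * sup_bd) => x; have /andP[a b] := pw_le x t1; rewrite a (le_trans b)//.
by apply: ler_wpM2l; [exact: powR_ge0|exact: slice_sup].
Qed.

Local Notation self_bd := (self_const s r E0).

Lemma pw_self t : 1 <= t -> c * \int[mu]_x (pw t x * pot q 0 (pw t) x) <= self_bd.
Proof.
move=> t1; have t0 : 0 < t by lra.
have [nf I2] := slice_nice t0; have [np _] := pw_nice t1.
have L0 : 0 <= L by exact: powR_ge0.
have pp x : pot q 0 (pw t) x <= L * pot q 0 (f t) x.
  rewrite /pot -intZ; last exact: Int_pot.
  apply: int_le; [exact: Int_pot|apply: IntZ; exact: Int_pot|] => y.
  have /andP[_ b] := pw_le y t1; rewrite mulrCA; apply: ler_wpM2l => //; exact: W_ge0.
have H : \int[mu]_x (pw t x * pot q 0 (pw t) x) <= L ^+ 2 * \int[mu]_x (f t x * pot q 0 (f t) x).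
  rewrite -intZ; last exact: Int_fpot.
  apply: int_le; [exact: Int_fpot|apply: IntZ; exact: Int_fpot|] => x.
  have /andP[a b] := pw_le x t1.
  have -> : L ^+ 2 * (f t x * pot q 0 (f t) x) = (L * f t x) * (L * pot q 0 (f t) x) by ring.
  apply: ler_pM => //; apply: pot_ge0 => y; exact: powR_ge0.
have := ler_wpM2l c_ge0 H; have := ler_wpM2l (sqr_ge0 L) (energy_le nf (entropy_le t0)).
rewrite /self_const; lra.
Qed.

(** * Mass seen through a parabolic cut-off *)

Section Cutoff.
Variable K : R.
Hypothesis K1 : 1 <= K.
Let K0 : 0 < K. Proof. by have := K1; lra. Qed.
Local Notation ball x := ((`|x| <= K)%R%:R).

(** The parabola vanishes at -K and K, so there is no boundary flux; its slope on the ball is of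
    order 1 / K, and its defect from 1 is controlled by the second moment over K^2. *)
Definition parab x := 1 - (x / K) ^+ 2.
Definition cutmass t := \int[mu]_x (ball x * (parab x * f t x)).

Lemma parab_itv x : `|x| <= K -> 0 <= parab x <= 1.
Proof.
move=> xK; have : (x / K) ^+ 2 <= 1.
  rewrite -(real_normK (num_real _)) expr_le1// normrM normfV (gtr0_norm K0).
  by rewrite ler_pdivrMr// mul1r.
by rewrite /parab; have := sqr_ge0 (x / K); lra.
Qed.

Lemma ball_parab_itv x : 0 <= (ball x * parab x : R) <= 1.
Proof.
have [/parab_itv|_] := leP `|x| K; first by rewrite mul1r.
by rewrite mul0r lexx ler01.
Qed.

Lemma meas_ball_parab : measurable_fun setT (fun x : R => ball x * parab x : R).
Proof.
apply: measurable_funM; first exact: measurable_leb.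
apply: measurable_funB => //; apply: measurable_funX; exact: measurable_funM.
Qed.

Lemma Int_ball_parab g : Int g -> Int (fun x => ball x * (parab x * g x)).
Proof.
move=> Ig; have := @Int_mulb R g (fun x => ball x * parab x) 1 meas_ball_parab _ Ig.
move=> H; apply: eq_Int (H _) => [x|x]; first by rewrite mulrA.
by have /andP[a b] := ball_parab_itv x; rewrite ger0_norm.
Qed.

Lemma cutmass_itv t : 0 < t -> [/\ 0 <= cutmass t, cutmass t <= mass (f t) &
  mass (f t) - cutmass t <= 2 * E0 * K^-1 ^+ 2].
Proof.
move=> t0; have [nf I2] := slice_nice t0; have If := nice_Int nf.
have Ic := Int_ball_parab If.
split.
- apply: int_ge0 => x; rewrite mulrA mulr_ge0 ?rho_ge0//; by case/andP: (ball_parab_itv x).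
- apply: int_le => // x; rewrite mulrA ler_piMl ?rho_ge0//; by case/andP: (ball_parab_itv x).
rewrite mulrC; apply: (@le_trans _ _ (K^-1 ^+ 2 * \int[mu]_x (x ^+ 2 * f t x))); last first.
  by apply: ler_wpM2l; [exact: sqr_ge0|exact: (moment_le hs nf (entropy_le t0))].
rewrite /mass /cutmass -intB// -intZ//; apply: int_le; [exact: IntB|exact: IntZ|] => x.
have fx := rho_ge0 x t0; have [xK|xK] := leP `|x| K.
  by rewrite mul1r /parab expr_div_n exprVn le_eqVlt; apply/orP; left; apply/eqP; ring.
rewrite mul0r subr0 mulrA ler_peMl// -exprMn -(real_normK (num_real _)) expr_ge1//.
by rewrite normrM normfV (gtr0_norm K0) mulrC ler_pdivlMr// mul1r ltW.
Qed.

(** On the compact rectangle [-K, K] x [t / 2, 2 t] the time derivative is continuous, hence bounded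
    by a constant, which serves as majorant under the integral. *)
Lemma cutmass_derive t : 0 < t ->
  is_derive t 1 cutmass (\int[mu]_x (ball x * (parab x * d_time rho x t))).
Proof.
move=> t0.
pose F u x := ball x * (parab x * rho x u) : R.
have ne : (`[- K, K] `*` `[t / 2, 2 * t])%classic !=set0.
  exists (0, t); split => /=; rewrite in_itv/=; last by apply/andP; split; lra.
  by have := K0; lra.
have cp : compact (`[- K, K] `*` `[t / 2, 2 * t])%classic by apply: compact_setX; exact: segment_compact.
have [|z _ zm] := compact_EVT_max (f := fun z : R * R => `|d_time rho z.1 z.2|) ne cp.
  apply: continuous_in_subspaceT => -[x u]; rewrite inE => -[_ /=]; rewrite in_itv/= => /andP[u1 _].
  have u0 : 0 < u by lra.
  by apply: cvg_norm; exact: (partial_cont (w := [:: true]) (x := x) u0).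
set D := `|_| in zm.
have dF (u x : R) : 0 < u -> is_derive u 1 (F ^~ x) (ball x * (parab x * d_time rho x u)).
  move=> u0; have E : F ^~ x = (ball x * parab x) \*: rho x.
    by apply/funext => v; rewrite /F mulrA.
  by rewrite E mulrA; exact: is_deriveZ (partial_t [::] x u0).
have tI : (`]t / 2, 2 * t[)%classic t by rewrite /= in_itv/=; apply/andP; split; lra.
have Ipos u : (`]t / 2, 2 * t[)%classic u -> 0 < u by rewrite /= in_itv/= => /andP[]; lra.
have h1 u : (`]t / 2, 2 * t[)%classic u -> mu.-integrable setT (EFin \o F u).
  by move=> /Ipos u0; apply: Int_ball_parab; exact: nice_Int (slice_nice u0).1.
have h2 u x : (`]t / 2, 2 * t[)%classic u -> setT x -> derivable (F ^~ x) u 1.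
  by move=> /Ipos u0 _; have [] := dF u x u0.
have KK : - K - 1 <= K by have := K0; lra.
have [I1 _] := int_itv_len KK.
pose G x := D * (- K - 1 < x <= K)%R%:R : R.
have G0 x : 0 <= G x by rewrite /G mulr_ge0 // /D normr_ge0.
have h3 u x : (`]t / 2, 2 * t[)%classic u -> setT x -> `|partial1of2 F u x| <= G x.
  move=> uI _; have u0 := Ipos u uI.
  rewrite partial1of2E; have [_ ->] := dF u x u0.
  have [xK|xK] := leP `|x| K; last by rewrite mul0r normr0 G0.
  rewrite mul1r normrM /G (_ : (- K - 1 < x <= K) = true); last first.
    by move: xK; rewrite ler_norml; lra.
  have /andP[b0 b1] := parab_itv xK; rewrite mulr1 (ger0_norm b0).
  apply: (@le_trans _ _ `|d_time rho x u|); first by rewrite ler_piMl.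
  apply: (zm (x, u)); rewrite inE; split => /=; first by rewrite in_itv/= -ler_norml.
  by move: uI; rewrite /= !in_itv/=; lra.
have IG : mu.-integrable setT (EFin \o G) by apply: IntZ.
have d := derivable_under_integral measurableT tI h1 h2 G0 IG h3.
have e := differentiation_under_integral measurableT tI h1 h2 G0 IG h3.
split; first exact: d.
rewrite -derive1E e; apply: eq_Rintegral => x _; rewrite partial1of2E; by have [_ ->] := dF t x t0.
Qed.

(** Integration by parts: [parab x * (f t x * vel t x)] vanishes at -K and K, leaving the term with
    the slope of the parabola. There - 2 (x / K) v <= (x / K)^2 + v^2 <= 1 + v^2, and integrating
    against f / K gives mass and dissipation. *)
Lemma flux_bound t : 1 <= t ->
  \int[mu]_x (ball x * (parab x * (d_time rho x t + decay t * pw t x))) >=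
  - (K^-1 * (mass (f t) + dissipation s (f t))).
Proof.
move=> t1; have t0 : 0 < t by lra.
have [nf _] := slice_nice t0; have If := nice_Int nf; have [Id ->] := dissipationE t0.
pose F x := parab x * (f t x * vel t x).
pose j1 x := parab x * (d_time rho x t + decay t * pw t x).
pose j2 x := - (2 * K^-1 * (x / K)) * (f t x * vel t x).
have db x : is_derive x 1 parab (- (2 * K^-1 * (x / K))).
  have dK : is_derive x 1 (fun y : R => y / K) K^-1.
    have [a b] := is_deriveZ K^-1 (is_derive_id x (1 : R)).
    have E : (fun y : R => y / K) = (fun y => K^-1 *: y) by apply/funext => y; rewrite mulrC.
    by rewrite E; split => //; rewrite b /GRing.scale/= mulr1.
  have [a b] := is_deriveB (is_derive_cst (1 : R) x 1) (is_deriveM dK dK).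
  have E : parab = (fun y : R => 1 - y / K * (y / K)) by apply/funext => y; rewrite /parab expr2.
  by rewrite E; split => //; rewrite b /GRing.scale/=; ring.
have dF x : is_derive x 1 F (j1 x + j2 x).
  have [a b] := is_deriveM (db x) (flux_derive x t0).
  split => //; rewrite b -(time_derivative x t0) /GRing.scale/= /j1 /j2 /pw; ring.
have cv x : {for x, continuous (vel t)} by exact: is_derive_continuous (vel_derive x t0).
have cf x : {for x, continuous (f t)} by exact: is_derive_continuous (slice_dx x t0).
have cpw x : {for x, continuous (pw t)}.
  have E : pw t = (fun y => `|y| `^ r) \o f t by apply/funext => y; rewrite /pw/= ger0_norm// rho_ge0.
  rewrite E; apply: continuous_comp; first exact: cf.
  exact: is_derive_continuous (is_derive_abs_powR r1 (rho_ge0 x t0)).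
have cb x : {for x, continuous parab} by exact: is_derive_continuous (db x).
have cj1 x : {for x, continuous j1}.
  apply: cvgM; first exact: cb.
  apply: cvgD; first exact: (partial_cont_x (w := [:: true]) (x := x) t0).
  by apply: cvgM; [exact: cvg_cst|exact: cpw].
have cj2 x : {for x, continuous j2}.
  apply: cvgM; last by apply: cvgM; [exact: cf|exact: cv].
  apply: cvgN; apply: cvgM; first exact: cvg_cst.
  by apply: cvgM; [exact: cvg_id|exact: cvg_cst].
have cj x : {for x, continuous (fun x => j1 x + j2 x)} by apply: cvgD; [exact: cj1|exact: cj2].
have := int_ball_ftc K0 cj dF.
have -> : F K - F (- K) = 0.
  by rewrite /F /parab mulNr sqrrN divff ?gt_eqF// expr1n subrr !mul0r subrr.
have Ij1 := Int_ball K cj1; have Ij2 := Int_ball K cj2.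
rewrite (eq_int (g := fun x => ball x * j1 x + ball x * j2 x)); last by move=> x; rewrite mulrDr.
rewrite intD// => E.
rewrite lerNl; have -> : - (\int[mu]_x (ball x * (parab x * (d_time rho x t + decay t * pw t x)))) = \int[mu]_x (ball x * j2 x) by rewrite -/(j1 _); lra.
rewrite -intD// -intZ; last exact: IntD.
apply: int_le => //; first by apply: IntZ; exact: IntD.
move=> x; have fx := rho_ge0 x t0; have Ki : 0 < K^-1 by rewrite invr_gt0.
have [xK|xK] := leP `|x| K; last first.
  by rewrite mul0r mulr_ge0 ?(ltW Ki)// addr_ge0// mulr_ge0// sqr_ge0.
rewrite mul1r /j2.
have -> : - (2 * K^-1 * (x / K)) * (f t x * vel t x) = K^-1 * (f t x * (- (2 * (x / K) * vel t x))) by ring.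
have -> : f t x + f t x * vel t x ^+ 2 = f t x * (1 + vel t x ^+ 2) by ring.
apply: ler_wpM2l; first exact: ltW.
apply: ler_wpM2l => //.
have := parab_itv xK; rewrite /parab => /andP[b0 _].
have := sqr_ge0 (x / K + vel t x); rewrite sqrrD -mulr_natl; lra.
Qed.

Lemma cutmass_derive_ge t : 1 <= t ->
  \int[mu]_x (ball x * (parab x * d_time rho x t)) >=
  - (K^-1 * (mass (f t) + dissipation s (f t))) - decay t * mass (pw t).
Proof.
move=> t1; have t0 : 0 < t by lra.
have [np _] := pw_nice t1; have Ip := nice_Int np.
have Ib := Int_ball_parab Ip.
have cbd x : {for x, continuous (fun x => parab x * d_time rho x t)}.
  apply: cvgM; last exact: (partial_cont_x (w := [:: true]) (x := x) t0).
  apply: cvgB; first exact: cvg_cst.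
  apply: (continuous_comp (f := fun x : R => x / K) (g := fun x => x ^+ 2)); last exact: exprn_continuous.
  by apply: cvgM; [exact: cvg_id|exact: cvg_cst].
have Id := Int_ball K cbd.
have := flux_bound t1.
rewrite (eq_int (g := fun x => ball x * (parab x * d_time rho x t) + decay t * (ball x * (parab x * pw t x)))); last by move=> x; ring.
rewrite intD// ?intZ//; last exact: IntZ.
have : \int[mu]_x (ball x * (parab x * pw t x)) <= mass (pw t).
  apply: int_le => // x; rewrite mulrA ler_piMl ?powR_ge0//; by case/andP: (ball_parab_itv x).
move=> /(ler_wpM2l (expR_ge0 (- (ld * t)))); rewrite -/(decay t); lra.
Qed.

End Cutoff.

(* Excess over the minimal energy at the cut-off mass: [cutmass K] is differentiated under the integral, which the full mass does not allow without a bound on the tails of the time derivative. *)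
Definition lyap K t := entropy s (f t) - m1 * `|cutmass K t| `^ p.
Local Notation C1 := (m1 * p * M' `^ (p - 1)).

Let p0 : 0 <= p. Proof. by have := p1; lra. Qed.

Lemma C1_ge0 : 0 <= C1.
Proof. by apply: mulr_ge0; [exact: mulr_ge0|exact: powR_ge0]. Qed.

Lemma powR_mass_bd_le x : 0 <= x -> x <= M' -> x `^ (p - 1) <= M' `^ (p - 1).
Proof.
move=> x0 xM; apply: ge0_ler_powR; rewrite ?nnegrE//; [by have := p1; lra|exact: le_trans xM].
Qed.

Lemma slope_le K t : 1 <= K -> 0 < t -> m1 * (p * cutmass K t `^ (p - 1)) <= C1.
Proof.
move=> K1 t0; rewrite mulrA; apply: ler_wpM2l; first exact: mulr_ge0.
have [N0 NM _] := cutmass_itv K1 t0; have /andP[_ MM] := mass_le_bd t0.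
exact: (powR_mass_bd_le N0 (le_trans NM MM)).
Qed.

Definition lyap_slope K t :=
  - dissipation s (f t) - decay t * absorption s r (f t) -
  m1 * (p * cutmass K t `^ (p - 1) * \int[mu]_x ((`|x| <= K)%R%:R * (parab K x * d_time rho x t))).

Lemma lyap_derive K t : 1 <= K -> 1 <= t -> is_derive t 1 (lyap K) (lyap_slope K t).
Proof.
move=> K1 t1; have t0 : 0 < t by lra.
have [N0 _ _] := cutmass_itv K1 t0.
have [_ _ H _] := rho_entropy; have dH := H t t0.
have dN := cutmass_derive K1 t0.
have dp := @is_derive1_comp R (fun y => `|y| `^ p) (cutmass K) t _ _ (is_derive_abs_powR p1 N0) dN.
exact: is_deriveB dH (is_deriveZ m1 dp).
Qed.

(** Losing mass lowers the reference energy at rate m1 p N^(p-1) per unit mass, while absorption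
    lowers the entropy. At a minimiser the weight c pot + x^2 / 2 of the absorption equals that rate
    on the support, and [ment_perturb] measures the deviation otherwise. The condition C1 <= K keeps
    the share of dissipation spent on the flux at most one. *)
Lemma lyap_slope_le K t : 1 <= K -> C1 <= K -> 1 <= t ->
  lyap_slope K t <= - (2 * lyap K t) + lyap K t / (1 + t) + decay t ^+ 2 * (1 + t) * self_bd / 2
    + (6 * C1 * E0 + C1 * M') * K^-1.
Proof.
move=> K1 CK t1; have t0 : 0 < t by lra.
have K0 : 0 < K by lra.
have T0 : 0 < 1 + t by lra.
have [nf I2] := slice_nice t0; have [np Ip2] := pw_nice t1.
have [N0 NM NE] := cutmass_itv K1 t0; have /andP[M0 MM] := mass_le_bd t0.
have k0 : 0 <= K^-1 by rewrite invr_ge0 ltW.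
have Ck : C1 * K^-1 <= 1.
  by have := ler_wpM2r k0 CK; rewrite mulfV ?lt0r_neq0.
have k1 : 0 <= K^-1 <= 1 by rewrite k0 invf_le1.
have [Id IE] := dissipationE t0.
have G0 : 0 <= mass (pw t) by apply: int_ge0 => x; exact: powR_ge0.
set N := cutmass K t in N0 NM NE *.
have lyapE : lyap K t = entropy s (f t) - m1 * N `^ p by rewrite /lyap ger0_norm.
have HE : entropy s (f t) = Ent q c (f t) by exact: (entropyE hs).
have AE : absorption s r (f t) = \int[mu]_x (pw t x * (c * pot q 0 (f t) x + x ^+ 2 / 2)).
  by apply: eq_int => x; rewrite /absorption_density rieszE.
have e0 : 0 <= decay t * (1 + t) by apply: mulr_ge0; [exact: expR_ge0|exact: ltW].
have Hmin := ment_perturb hs nf np I2 Ip2 e0.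
(* Convexity of the power p lets the tangent be taken at the cut-off mass N instead of the full
   mass, matching the slope in [lyap_slope]. *)
have Htan : N `^ p + p * N `^ (p - 1) * (decay t * (1 + t) * mass (pw t)) <= (mass (f t) + decay t * (1 + t) * mass (pw t)) `^ p.
  exact: (powR_tangent_le p1 N0 NM (mulr_ge0 e0 G0)).
have HA : - (decay t * absorption s r (f t)) + m1 * (p * N `^ (p - 1)) * (decay t * mass (pw t)) <=
    lyap K t / (1 + t) + decay t ^+ 2 * (1 + t) * self_bd / 2.
  rewrite lyapE; apply: (absorption_arith T0 (pw_self t1)).
  rewrite HE AE; apply: (le_trans _ Hmin); apply: ler_wpM2l => //.
have HI : - dissipation s (f t) + C1 * K^-1 * dissipation s (f t) <= - (2 * lyap K t) + 6 * C1 * E0 * K^-1.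
  rewrite lyapE; apply: (@dissipation_arith R _ _ m1 (mass (f t) `^ p) (N `^ p) E0 C1 _ C1_ge0 k1 _ E0_ge0).
  - exact: Ck.
  - apply: double_le; rewrite HE IE.
    exact: (Ent_diss q0 q1 c_ge0 nf (fun x => slice_dx x t0) (fun x => slice_dxx x t0) (fun x => slice_cxx (x := x) t0) I2 Id).
  - have /andP[_ H] := powR_tangent p1 N0 NM.
    have H1 := sub_le_of_le_add H.
    apply: (le_trans (ler_wpM2l m10 H1)); have X0 := mulr_ge0 (mulr_ge0 m10 p0) (powR_ge0 (mass (f t)) (p - 1)).
    have Y0 : 0 <= mass (f t) - N by rewrite subr_ge0.
    rewrite [leLHS](_ : _ = m1 * p * mass (f t) `^ (p - 1) * (mass (f t) - N)); last by rewrite !mulrA.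
    apply: (ler_pM X0 Y0 _ NE).
    apply: ler_wpM2l; first by apply: (mulr_ge0 m10 p0).
    exact: (powR_mass_bd_le M0 MM).
  - by apply: (mulr_ge0 m10); exact: powR_ge0.
  - by rewrite HE; exact: entropy_le.
have Hs : 0 <= m1 * (p * N `^ (p - 1)) <= C1.
  rewrite (slope_le K1 t0) andbT; exact: (mulr_ge0 m10 (mulr_ge0 p0 (powR_ge0 _ _))).
have H := entropy_slope_arith Hs k0 (dissipation_ge0 t0) M0 (cutmass_derive_ge K1 t1) HI HA.
apply: (le_trans H); rewrite lerD2l; apply: (ler_wpM2r k0); rewrite lerD2l.
exact: (ler_wpM2l C1_ge0 MM).
Qed.

Lemma self_bd_ge0 : 0 <= self_bd.
Proof. by rewrite mulr_ge0 ?sqr_ge0// mulr_ge0// E0_ge0. Qed.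

(** The cut-off mass is below the full one, so the excess is at most [lyap K t]. For fixed t the
    errors in the comparison are of order 1 / K, and [le_of_inv_error] removes them. *)
Lemma entropy_excess_le t : 1 <= t ->
  Ent q c (f t) - m1 * mass (f t) `^ p <=
  (1 + t) * expR (- (2 * t)) * (expR 2 * E0 + t * (self_bd / 2 * expR (2 * (1 - Num.min 1 ld) * t))).
Proof.
move=> t1; have t0 : 0 < t by lra.
set b := Num.min 1 ld.
have b1 : b <= 1 by rewrite /b ge_min lexx.
have bl : b <= ld by rewrite /b ge_min lexx orbT.
pose C2 := 6 * C1 * E0 + C1 * M'.
have C20 : 0 <= C2.
  have := C1_ge0; have := E0_ge0; have := mass_bd_ge1 => m e h.
  by apply: addr_ge0; apply: mulr_ge0 => //; [exact: mulr_ge0|lra].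
have T0 : 0 <= (1 + t) * expR (- (2 * t)) by rewrite mulr_ge0 ?expR_ge0//; lra.
apply: (@le_of_inv_error R _ _ ((1 + t) * expR (- (2 * t)) * (t * (C2 * expR (2 * t)))) C1) => K CK K1.
have k0 : 0 <= K^-1 by rewrite invr_ge0; lra.
have [N0 NM _] := cutmass_itv K1 t0.
have yE : Ent q c (f t) - m1 * mass (f t) `^ p <= lyap K t.
  have [nf I2] := slice_nice t0.
  have H : m1 * cutmass K t `^ p <= m1 * mass (f t) `^ p.
    apply: ler_wpM2l => //; apply: ge0_ler_powR; rewrite ?nnegrE//; exact: le_trans N0 NM.
  by rewrite /lyap (ger0_norm N0) (entropyE hs nf I2); apply: lerB.
apply: (le_trans yE).
have CK0 : 0 <= C2 * K^-1 by rewrite mulr_ge0.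
have := @gronwall_decay R (lyap K) (lyap_slope K) ld b self_bd (C2 * K^-1) t t1 self_bd_ge0 CK0 b1 bl
   (fun u hu => lyap_derive K1 hu) (fun u hu => lyap_slope_le K1 CK hu).
move=> H; apply: (le_trans H).
have y1 : lyap K 1 <= E0.
  have [nf I2] := slice_nice (ltr01 : 0 < 1 :> R).
  have : 0 <= m1 * `|cutmass K 1| `^ p by rewrite mulr_ge0 ?powR_ge0.
  move=> H1; apply: le_trans (entropy_le (ltr01 : 0 < 1 :> R)).
  by rewrite /lyap (entropyE hs nf I2) gerBl.
have y2 : expR 2 * lyap K 1 / 2 <= expR 2 * E0.
  exact: (half_mul_le (expR_ge0 _) E0_ge0 y1).
rewrite [leRHS](_ : _ = (1 + t) * expR (- (2 * t)) *
  (expR 2 * E0 + t * (self_bd / 2 * expR (2 * (1 - b) * t) + C2 * K^-1 * expR (2 * t)))); last by ring.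
apply: (ler_wpM2l T0); by rewrite lerD2r.
Qed.

Lemma relative_entropy_decay t : 0 < t ->
  entropy s (f t) - entropy s (barenblatt s (mass (f t))) <=
  decay_const s r E0 * (1 + t) ^+ 2 * expR (- (2 * Num.min 1 ld * t)).
Proof.
move=> t0; set b := Num.min 1 ld.
have b1 : b <= 1 by rewrite /b ge_min lexx.
have [nf I2] := slice_nice t0; have e0 := E0_ge0; have s0 := self_bd_ge0.
have [t1|t1] := leP 1 t.
  apply: (le_trans (relative_entropy_le hs nf I2)); apply: (le_trans (entropy_excess_le t1)).
  rewrite -/b.
  have E1 : expR (- (2 * t)) * expR (2 * (1 - b) * t) = expR (- (2 * b * t)).
    by rewrite -expRD; congr expR; ring.
  have E2 : expR (- (2 * t)) <= expR (- (2 * b * t)).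
    rewrite ler_expR lerN2 -mulrA ler_wpM2l// ler_piMl//; exact: ltW.
  set x := expR (- (2 * b * t)) in E1 E2 *.
  have x0 : 0 <= x by exact: expR_ge0.
  have -> : (1 + t) * expR (- (2 * t)) * (expR 2 * E0 + t * (self_bd / 2 * expR (2 * (1 - b) * t))) =
    (1 + t) * (expR 2 * E0 * expR (- (2 * t)) + t * (self_bd / 2) * x) by rewrite -E1; ring.
  have -> : decay_const s r E0 * (1 + t) ^+ 2 * x = (1 + t) * ((1 + t) * (expR 2 * E0 * x) + (1 + t) * (self_bd / 2 * x)).
    by rewrite /decay_const; ring.
  have a0 : 0 <= expR 2 * E0 by rewrite mulr_ge0 ?expR_ge0.
  have d0 : 0 <= self_bd / 2 * x by rewrite mulr_ge0// divr_ge0.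
  apply: ler_wpM2l; first lra.
  apply: lerD.
    apply: (le_trans (ler_wpM2l a0 E2)); rewrite ler_peMl ?mulr_ge0//; lra.
  by rewrite -mulrA ler_wpM2r//; lra.
(* For t < 1 monotonicity of the entropy is enough: b t <= 1, so [expR 2] outweighs the decaying
   exponential. *)
have H : entropy s (f t) <= E0 by rewrite (entropyE hs nf I2); exact: entropy_le.
apply: (@le_trans _ _ E0); first by have := entropy_barenblatt_ge0 hs (mass (f t)); lra.
have E3 : 1 <= expR 2 * expR (- (2 * b * t)).
  rewrite -expRD -[leLHS]expR0 ler_expR; have : b * t <= 1 * t by rewrite ler_wpM2r// ltW.
  by rewrite -mulrA; lra.
have T1 : 1 <= (1 + t) ^+ 2 by rewrite expr_ge1//; lra.
have x0 := expR_ge0 (- (2 * b * t)).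
apply: (@le_trans _ _ (E0 * (expR 2 * expR (- (2 * b * t))))); first by rewrite ler_peMr.
have -> : E0 * (expR 2 * expR (- (2 * b * t))) = expR 2 * E0 * 1 * expR (- (2 * b * t)) by ring.
apply: ler_wpM2r => //; apply: ler_pM => //; first by rewrite mulr_ge0 ?expR_ge0.
by rewrite /decay_const lerDl divr_ge0.
Qed.

End Solution.

Lemma norm1_mass {R : realType} (u : R -> R) : in_L1 u ->
  {ae @lebesgue_measure R, forall x, 0 <= u x} -> norm1 u = mass u.
Proof.
move=> u1 u0; have Iu : Int u by move: u1 => /Lfun1_integrable.
rewrite /norm1 Lnorm1 /mass; have := int_ae_eq (Int_norm Iu) Iu.
rewrite /Rintegral => H; apply: H; apply: ae_imp u0 => x; exact: ger0_norm.
Qed.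

Theorem theorem3p3 (R : realType) :
  exists C : R -> R -> R -> R -> R -> R,
    forall (s r : R) (u0 : R -> R) (rho : R -> R -> R),
      0 < s < 1 / 2 ->
      4 - 2 * s < r ->
      in_L1 u0 ->
      in_Linfty u0 ->
      {ae @lebesgue_measure R, forall x, 0 <= u0 x} ->
      smooth_solution s r u0 rho ->
      forall t : R, 0 < t ->
        entropy s (rho ^~ t) - entropy s (barenblatt s (mass (rho ^~ t)))
        <= C (norm1 u0) (norm_infty u0) r s (relative_entropy s u0)
           * (1 + t) ^+ 2
           * expR (- (2 * Num.min 1 (lambda s * delta s r) * t)).
Proof.
(* Adding the entropy of the profile of mass [norm1 u0] to the relative entropy recovers the initial
   entropy, so the constant is a function of the permitted data. *)
exists (fun m _ r s h => decay_const s r (h + entropy s (barenblatt s m))) => s r u0 rho hs hr u1 _ u0_ge0.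
move=> [rho0 rho_ge0 [sm van] [eqn ent] _] t t0.
have u00 : rho ^~ 0 = u0 by apply/funext.
have mE : norm1 u0 = mass u0 by exact: norm1_mass.
have -> : relative_entropy s u0 + entropy s (barenblatt s (norm1 u0)) = entropy s (rho ^~ 0).
  by rewrite mE /relative_entropy subrK u00.
exact: relative_entropy_decay.
Qed.
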